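(* Let $K$ be a convex body in $\mathbb{R}^n$ and let $c\colon K\times K\to\mathbb{R}$ be a Lipschitz function. Let $\mu,\nu$ be two Borel probability measures on $K$ in convex order. Let $\mathcal{K}$ denote the set of continuous functions $g$ on the disjoint union of two copies of $K$ such that for all non-negative $\lambda_1,\dotsc,\lambda_{n+1}$ that add up to one and all $x_1,\dotsc,x_{n+1}\in K$ there is $$g_1\Big(\sum_{i=1}^{n+1}\lambda_i x_i\Big)-\sum_{i=1}^{n+1}\lambda_ig_2(x_i)\leq \sum_{i=1}^{n+1}\lambda_i c\Big(\sum_{j=1}^{n+1}\lambda_jx_j,x_i\Big).$$ Let $\mathcal{P}$ denote the set of pairs of Borel probability measures on $K$ that are in convex order, and let $\mathcal{E}$ be the set of extreme points of $\mathcal{P}$. Suppose that the supremum of integrals $$\int_Kf_1 \,d\mu-\int_K f_2\,d\nu$$ taken over $f\in\mathcal{K}$ is attained. Then it is equal to the infimum of integrals $$\int_{\mathcal{E}}\int_{K\times K} c\,d(\xi_1\otimes \xi_2)\,d\pi(\xi)$$ over the set of all Borel probability measures $\pi$ on $\mathcal{E}$ such that $$(\mu,\nu)=\int_{\mathcal{E}}\xi \,d\pi(\xi).$$ Moreover, the infimum is attained. It is also equal to the infimum of integrals $$\int_{K\times K} c\,d\pi$$ over all $\pi\in \Theta(\mu,\nu)$, where $\Theta(\mu,\nu)$ is the set of all Borel probability measures on $K\times K$ whose marginals are $\mu,\nu$ and that are distributions of a one-step martingale.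
   Context: A convex body is a convex, compact set with non-empty interior. Borel probability measures $\mu,\nu$ on $K$ are in convex order if $\int_K g\,d\mu\le\int_K g\,d\nu$ for all continuous convex $g\colon K\to\mathbb{R}$. For a function $g$ on the disjoint union of two copies of $K$, $g_1$ and $g_2$ denote its restrictions to the first and second copy of $K$, respectively. Elements of $\mathcal{E}$ are written $\xi=(\xi_1,\xi_2)$. The integral $\int_{\mathcal{E}}\xi\,d\pi(\xi)$ is understood weakly (componentwise, tested against continuous functions on $K$), with the weak topology on measures. A Borel probability measure $\pi$ on $K\times K$ is the distribution of a one-step martingale if, for $(X,Y)$ distributed according to $\pi$, $\mathbb{E}(Y|X)=X$. *)

(* Defs.v *)
From HB Require Import structures.
From mathcomp Require Import all_boot all_order all_algebra.
From mathcomp Require Import all_classical all_reals all_analysis.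

Set Implicit Arguments.
Unset Strict Implicit.
Unset Printing Implicit Defensive.

Import Order.TTheory GRing.Theory Num.Theory.
Import numFieldNormedType.Exports.

Local Open Scope classical_set_scope.
Local Open Scope ring_scope.

Record convexBody (R : realType) (n : nat) := ConvexBody {
  body :> set 'rV[R]_n ;
  body_convex : convex_set body ;
  body_compact : compact body ;
  body_interior : body° !=set0 }.

Definition point_of (R : realType) (n : nat) (K : convexBody R n) : Type :=
  set_type (body K).

Section point_of_instances.
Variables (R : realType) (n : nat) (K : convexBody R n).

Let point_of_point : point_of K.
Proof.
have h : exists x, x \in body K.
  by have [x /interior_subset Kx] := body_interior K; exists x; rewrite inE.
by case: (cid h) => x Kx; exists x.
Qed.

HB.instance Definition _ := Topological.copy (point_of K) (set_type (body K)).
HB.instance Definition _ := isPointed.Build (point_of K) point_of_point.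

End point_of_instances.

Definition coords (R : realType) (n : nat) (K : convexBody R n)
  (x : point_of K) : 'rV[R]_n := set_val x.

Notation borel T := (g_sigma_algebraType (@open T)).

(* Real functions on K are represented by functions on R^n of which only the
   values on K are ever used. *)
Record contOn (R : realType) (n : nat) (K : convexBody R n) := ContOn {
  contOn_fun :> 'rV[R]_n -> R ;
  contOn_continuous : {within K, continuous contOn_fun} }.

HB.instance Definition _ (R : realType) (n : nat) (K : convexBody R n) :=
  gen_eqMixin (contOn K).
HB.instance Definition _ (R : realType) (n : nat) (K : convexBody R n) :=
  gen_choiceMixin (contOn K).

Section convex_order.
Variables (R : realType) (n : nat) (K : convexBody R n).
Local Notation PrK := (probability (borel (point_of K)) R).
Local Open Scope ereal_scope.

Definition convex_order (mu nu : PrK) : Prop :=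
  forall g : contOn K, convex_function (body K) g ->
    \int[mu]_x (g (coords x))%:E <= \int[nu]_x (g (coords x))%:E.

(* The weak topology, i.e. the coarsest one for which mu |-> \int g dmu is
   continuous for every continuous g on K. *)
Definition weakProb : Type :=
  initial_topology (fun mu : PrK =>
    (fun g : contOn K => (\int[mu]_x g (coords x))%R) :
      {ptws contOn K -> R}).

HB.instance Definition _ := Topological.on weakProb.

(* A probability is a function on all sets, measurable or not; two of them are
   the same Borel measure when they agree on the Borel sets. The weak topology,
   hence its Borel sigma-algebra, does not separate such copies. *)
Definition same_measure (a b : PrK) : Prop :=
  forall A, measurable A -> a A = b A.

Definition is_mixture (t : R) (m a b : PrK) :=
  forall A, measurable A -> m A = t%:E * a A + (1 - t)%:E * b A.

Definition ordered_pairs : set (weakProb * weakProb) :=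
  [set xi | convex_order xi.1 xi.2].

Definition extreme_pairs : set (weakProb * weakProb) :=
  [set xi | ordered_pairs xi /\
    forall (a b : weakProb * weakProb) (t : R),
      ordered_pairs a -> ordered_pairs b -> (0 < t < 1)%R ->
      is_mixture t xi.1 a.1 b.1 -> is_mixture t xi.2 a.2 b.2 ->
      same_measure a.1 b.1 /\ same_measure a.2 b.2].

Definition extremePair : Type := set_type extreme_pairs.

HB.instance Definition _ :=
  Topological.copy extremePair (set_type extreme_pairs).

Lemma dirac_extremal (x : borel (point_of K)) (a b : PrK) (t : R) :
  (0 < t < 1)%R -> is_mixture t (\d_x : PrK) a b -> same_measure a (\d_x : PrK).
Proof.
move=> /andP[t0 t1] h.
have null (A : set (borel (point_of K))) : measurable A -> ~ A x -> a A = 0.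
  move=> mA Ax; have := h A mA; rewrite /= diracE memNset// => /esym/eqP.
  rewrite padde_eq0; last 2 first.
  - by rewrite mule_ge0// lee_fin ltW.
  - by rewrite mule_ge0// lee_fin subr_ge0 ltW.
  by move=> /andP[+ _]; rewrite mule_eq0 eqe (gt_eqF t0)/= => /eqP.
move=> A mA; transitivity ((x \in A)%:R%:E : \bar R); last by [].
have [xA|xA] := boolP (x \in A).
  have := probability_setC a (measurableC mA); rewrite setCK => ->.
  rewrite null ?sube0//; first exact: measurableC.
  by move=> /=; apply; rewrite inE in xA.
by rewrite null//; move/negP: xA; rewrite inE.
Qed.

Lemma dirac_extreme_pair (x : borel (point_of K)) :
  extreme_pairs (\d_x : PrK, \d_x : PrK).
Proof.
split=> [g _|a b t _ _ t01 /= h1 h2]; first by [].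
have t01' : (0 < 1 - t < 1)%R.
  by case/andP: t01 => t0 t1; rewrite subr_gt0 t1 ltrBlDr ltrDl t0.
have sw m c d : is_mixture t m c d -> is_mixture (1 - t) m d c.
  by move=> h A mA; rewrite h// opprB addrCA subrr addr0 addeC.
have same c d : is_mixture t (\d_x : PrK) c d -> same_measure c d.
  move=> h A mA.
  by rewrite (dirac_extremal t01 h mA) (dirac_extremal t01' (sw _ _ _ h) mA).
by split; exact: same.
Qed.

Let extremePair_point : extremePair :=
  exist (fun xi => xi \in extreme_pairs) _ (mem_set (dirac_extreme_pair point)).

HB.instance Definition _ := isPointed.Build extremePair extremePair_point.

Definition extreme_fst (xi : extremePair) : PrK := (set_val xi).1.
Definition extreme_snd (xi : extremePair) : PrK := (set_val xi).2.

End convex_order.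

Section problems.
Variables (R : realType) (n : nat) (K : convexBody R n).
Local Notation PrK := (probability (borel (point_of K)) R).
Variable c : 'rV[R]_n * 'rV[R]_n -> R.
Variables mu nu : PrK.
Local Open Scope ereal_scope.

(* A continuous function on the disjoint union of two copies of K is the pair
   of its restrictions to the copies. *)
Definition admissible : set (contOn K * contOn K) :=
  [set f : contOn K * contOn K |
    forall (l : 'I_n.+1 -> R) (x : 'I_n.+1 -> 'rV[R]_n),
    (forall i, 0 <= l i)%R -> (\sum_i l i = 1)%R -> (forall i, body K (x i)) ->
    (f.1 (\sum_i l i *: x i) - \sum_i l i * f.2 (x i)
       <= \sum_i l i * c (\sum_j l j *: x j, x i))%R].

Definition dual_value (f : contOn K * contOn K) : \bar R :=
  \int[mu]_x (f.1 (coords x))%:E - \int[nu]_x (f.2 (coords x))%:E.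

Definition representing : set (probability (borel (extremePair K)) R) :=
  [set pi : probability (borel (extremePair K)) R | forall g : contOn K,
    \int[mu]_x (g (coords x))%:E =
      \int[pi]_xi \int[extreme_fst xi]_x (g (coords x))%:E /\
    \int[nu]_x (g (coords x))%:E =
      \int[pi]_xi \int[extreme_snd xi]_x (g (coords x))%:E].

Definition extreme_cost (pi : probability (borel (extremePair K)) R) : \bar R :=
  \int[pi]_xi \int[extreme_fst xi \x extreme_snd xi]_p
    (c (coords p.1, coords p.2))%:E.

(* Z is a version of the conditional expectation of Y given the
   sigma-algebra G. *)
Definition is_cond_exp d (T : measurableType d) (P : probability T R)
    (G : set_system T) (Y Z : T -> R) : Prop :=
  [/\ P.-integrable setT (EFin \o Y),
      P.-integrable setT (EFin \o Z),
      (forall B : set (measurableTypeR R), measurable B -> G (Z @^-1` B)) &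
      forall A, G A -> \int[P]_(x in A) (Z x)%:E = \int[P]_(x in A) (Y x)%:E].

(* The product sigma-algebra on K * K; it is the Borel one since K is second
   countable. *)
Definition pairProb :=
  probability (borel (point_of K) * borel (point_of K))%type R.

(* E(Y|X) = X, coordinate by coordinate, for (X, Y) = (fst, snd). *)
Definition one_step_martingale (pi : pairProb) : Prop :=
  forall i : 'I_n,
    is_cond_exp pi (preimage_set_system setT fst measurable)
      (fun p => coords p.2 ord0 i) (fun p => coords p.1 ord0 i).

Definition martingale_couplings : set pairProb :=
  [set pi : pairProb |
    [/\ forall A, measurable A -> pushforward pi fst A = mu A,
        forall A, measurable A -> pushforward pi snd A = nu A &
        one_step_martingale pi]].

Definition transport_cost (pi : pairProb) : \bar R :=
  \int[pi]_p (c (coords p.1, coords p.2))%:E.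

End problems.

(* Main.v *)
From HB Require Import structures.
Require Import Defs.
From mathcomp Require Import all_boot all_order all_algebra finmap.
From mathcomp Require Import all_classical all_reals all_analysis.
From mathcomp Require Import measurable_realfun.
From mathcomp Require Import lra ring.

(* Both dual problems are solved by one device: for a compact set S and a cone
   of continuous functions on S with prescribed bounds on their means, the
   Hahn-Banach theorem on functions on the Cantor space, which maps onto S,
   gives a finitely additive, hence countably additive, law on S that respects
   the bounds ([cone_measure]).

   Let v be the value of the dual problem. On S = K * K, the functions
   f1 x - f2 y + H x (y - x) + t c (x, y) yield a one-step martingale coupling
   of mu and nu of cost at most v. Conversely the inequality defining
   [admissible] holds, by Caratheodory's theorem, for all finite convex
   combinations, so that it integrates along every martingale.

   The first component of an extreme pair is a Dirac mass: otherwise a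
   martingale coupling of the pair, conditioned on the position of its starting
   point, splits it. Hence the product of the components is the law of a
   martingale, which gives weak duality for [representing].

   On the set S of pairs (l, x) of n + 1 weights and nodes, one gets a law such
   that the centre sum_i l_i x_i has law mu, a random node has law nu, and the
   mean cost is at most v. Among these laws take one that maximises the mean of
   the strictly convex function sum_i l_i^2: this function is then almost surely
   touched from above by functions that are affine in l for fixed nodes and
   centre, and so the pair (delta_centre, sum_i l_i delta_{x_i}) is almost
   surely extreme. Its law is the optimal representing measure. *)

Set Implicit Arguments.
Unset Strict Implicit.
Unset Printing Implicit Defensive.

Import Order.TTheory GRing.Theory Num.Theory.
Import numFieldNormedType.Exports.

Local Open Scope classical_set_scope.
Local Open Scope ring_scope.

(** * The Hahn-Banach theorem *)

(** Indicators of clopen subsets of the Cantor space are continuous, and a clopen set has no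
    infinite partition into nonempty clopen sets. Hence a positive functional yields a measure
    without the Riesz representation theorem.

    The obstacle in the representation problem is that extreme pairs need not form a closed set:
    three nodes of a triangle may become collinear in the limit. A law found by compactness may
    therefore charge other pairs. Configurations form a compact set that maps continuously to pairs,
    and a configuration fails to give an extreme pair only if its weights split while nodes and
    centre stay fixed. All prescribed bounds concern functions that are affine along such a split,
    whereas the sum of squared weights increases in the mean, so a maximiser should not charge these
    configurations. Carrying out the split under the integral would require a measurable choice of
    it. The dual of the maximisation problem avoids this: nearly optimal majorants of the sum of
    squares have small mean excess over it, and thus come arbitrarily close to it at almost every
    configuration. *)

Section hahn_banach.
Variables (R : realType) (V : lmodType R) (D : set V) (p : V -> R).
Hypothesis D0 : D 0.
Hypothesis DD : forall u v, D u -> D v -> D (u + v).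
Hypothesis DZ : forall a u, D u -> D (a *: u).
Hypothesis pD : forall u v, D u -> D v -> p (u + v) <= p u + p v.
Hypothesis pZ : forall a u, D u -> 0 <= a -> p (a *: u) = a * p u.

Let dominated_graph (G : set (V * R)) :=
  [/\ forall x, G x -> D x.1 /\ x.2 <= p x.1,
      forall x y, G x -> G y -> G (x.1 + y.1, x.2 + y.2) &
      forall a x, G x -> G (a *: x.1, a * x.2)].

Let dominated_graph_fun G x y : dominated_graph G -> G x -> G y ->
  x.1 = y.1 -> x.2 = y.2.
Proof.
move=> [Gp GD GZ] Gx Gy xy.
have p0 : p 0 = 0 by rewrite -(scale0r (0 : V)) pZ// mul0r.
have key x' y' : G x' -> G y' -> x'.1 = y'.1 -> x'.2 <= y'.2.
  move=> Gx' Gy' e; have := GD _ _ Gx' (GZ (-1) _ Gy').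
  move=> /Gp[_] /=; rewrite e scaleN1r subrr p0 mulN1r; lra.
by apply/eqP; rewrite eq_le !key.
Qed.

(* The values admissible for an extension at [u] lie between
   [sup (r - p (w - u))] and [inf (p (w + u) - r)] over the graph. *)
Let dominated_graph_ext G u : dominated_graph G -> D u -> G (0, 0) ->
  exists s, dominated_graph
    [set z | exists a x, G x /\ z = (x.1 + a *: u, x.2 + a * s)].
Proof.
move=> [Gp GD GZ] Du G00.
have lohi x y : G x -> G y -> x.2 - p (x.1 - u) <= p (y.1 + u) - y.2.
  move=> Gx Gy; have [_ /= h] := Gp _ (GD _ _ Gx Gy).
  have [Dx _] := Gp _ Gx; have [Dy _] := Gp _ Gy.
  have DNu : D (- u) by rewrite -scaleN1r; exact: DZ.
  have := pD (DD Dx DNu) (DD Dy Du).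
  rewrite addrACA addNr addr0; lra.
pose L := [set x.2 - p (x.1 - u) | x in G].
have supL : has_sup L.
  split; first by exists (0 - p (0 - u)); exists (0, 0).
  exists (p (0 + u) - 0) => _ [x Gx <-].
  exact: (lohi x (0, 0)).
exists (sup L).
have lo x : G x -> x.2 - p (x.1 - u) <= sup L.
  by move=> Gx; apply: ub_le_sup; [exact: supL.2|exists x].
have hi y : G y -> sup L <= p (y.1 + u) - y.2.
  by move=> Gy; apply: ge_sup; [exact: supL.1|move=> _ [x Gx <-]; exact: lohi].
split.
- move=> _ [a [x [Gx ->]]] /=; have [Dx xp] := Gp _ Gx.
  split; first by apply: DD => //; exact: DZ.
  (* Dividing by the absolute value of [a] reduces the two signs to the two one-sided bounds on the
     value at [u]. *)
  have [a0|a0|->] := ltgtP a 0; last by rewrite mul0r scale0r !addr0.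
  + have a0' : 0 < - a by rewrite oppr_gt0.
    have /= := lo _ (GZ (- a)^-1 _ Gx).
    have -> : (- a)^-1 *: x.1 - u = (- a)^-1 *: (x.1 + a *: u).
      by rewrite scalerDr scalerA invrN mulNr mulVf ?scaleN1r// lt_eqF.
    rewrite pZ; [|by apply: DD => //; exact: DZ|by rewrite invr_ge0 ltW].
    rewrite -mulrBr ler_pdivrMl//; lra.
  + have := hi _ (GZ a^-1 _ Gx) => /=.
    have -> : a^-1 *: x.1 + u = a^-1 *: (x.1 + a *: u).
      by rewrite scalerDr scalerA mulVf ?scale1r// gt_eqF.
    rewrite pZ; [|by apply: DD => //; exact: DZ|by rewrite invr_ge0 ltW].
    rewrite -mulrBr ler_pdivlMl//; lra.
- move=> _ _ [a [x [Gx ->]]] [b [y [Gy ->]]] /=.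
  exists (a + b), (x.1 + y.1, x.2 + y.2); split; first exact: GD.
  by congr pair => /=; [rewrite scalerDl addrACA|ring].
- move=> b _ [a [x [Gx ->]]] /=.
  exists (b * a), (b *: x.1, b * x.2); split; first exact: GZ.
  by rewrite /= scalerDr scalerA mulrDr mulrA.
Qed.

Theorem hahn_banach : exists f : V -> R,
  [/\ forall u, D u -> f u <= p u,
      forall u v, D u -> D v -> f (u + v) = f u + f v &
      forall a u, D u -> f (a *: u) = a * f u].
Proof.
have p0 : p 0 = 0 by rewrite -(scale0r (0 : V)) pZ// mul0r.
(* Adjoining [(0, 0)] provides the element that the extension step requires, even for the empty
   graph. *)
pose P := [set G | dominated_graph (G `|` [set (0, 0)])].
have graph0 G : dominated_graph G -> G !=set0 -> G (0, 0).
  by move=> [_ _ GZ] [x /(GZ 0)]; rewrite scale0r mul0r.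
have [|G [PG maxG]] := @Zorn_bigcup _ P.
  move=> F FP totF; rewrite /P/=; split.
  - move=> x [[G FG Gx]|->]; last by rewrite /= p0.
    by have [h _ _] := FP _ FG; apply: h; left.
  - move=> x y [[G FG Gx]|->]; last first.
      by rewrite !add0r => h; case: y h.
    move=> [[H FH Hy]|->]; last by rewrite !addr0; left; exists G => //; case: x Gx.
    have [GH|HG] := totF _ _ FG FH.
      have [_ h _] := FP _ FH.
      have [|//|?] := h x y _ (or_introl Hy); first by left; exact: GH.
        by left; exists H.
      by right.
    have [_ h _] := FP _ FG.
    have [//||?] := h x y (or_introl Gx) _; first by left; exact: HG.
      by left; exists G.
    by right.
  - move=> a x [[G FG Gx]|->]; last by right; rewrite /= scaler0 mulr0.
    have [_ _ h] := FP _ FG.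
    have [?|?] := h a x (or_introl Gx); last by right.
    by left; exists G.
pose H := G `|` [set (0, 0)].
have H00 : H (0, 0) by right.
have total u : D u -> exists r, H (u, r).
  move=> Du; apply: contrapT => nu.
  have [s Ps] := dominated_graph_ext PG Du H00.
  set H' := (X in dominated_graph X) in Ps.
  have HH' : H `<=` H'.
    by move=> [x r] Hx; exists 0, (x, r); rewrite /= scale0r mul0r !addr0.
  have H'u : H' (u, s).
    by exists 1, (0, 0); rewrite scale1r mul1r !add0r.
  apply: (maxG H').
    split; first by move=> x Gx; apply: HH'; left.
    by move=> /(_ _ H'u) Gu; apply: nu; exists s; left.
  rewrite /P/= (_ : H' `|` _ = H')//.
  by apply/setUidPl => _ ->; exact: HH'.
have [f fP] : exists f : V -> R, forall u, D u -> H (u, f u).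
  have /choice[f fP] : forall u, exists r, D u -> H (u, r).
    move=> u; have [/total[r]|] := pselect (D u); first by exists r.
    by exists 0.
  by exists f.
case: (PG) => Hp HD HZ; exists f; split.
- by move=> u Du; have [] := Hp _ (fP _ Du).
- move=> u v Du Dv.
  exact: (dominated_graph_fun PG (fP _ (DD Du Dv)) (HD _ _ (fP _ Du) (fP _ Dv))).
- move=> a u Du.
  exact: (dominated_graph_fun PG (fP _ (DZ a Du)) (HZ a _ (fP _ Du))).
Qed.

End hahn_banach.

(** * Means of bounded measurable functions *)

Section bounded_measurable.
Context d (T : measurableType d) (R : realType).
Implicit Types g h : T -> R.

(** On this class integrals are real numbers and [mean] is linear, with no integrability condition
    to check. It contains all the functions that occur, since they come from continuous functions on
    compact sets and from indicators. *)
Definition bounded_measurable h :=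
  measurable_fun setT h /\ exists M, forall x, `|h x| <= M.
Local Notation bm := bounded_measurable.

Lemma bm_cst r : bm (fun=> r).
Proof. by split; [exact: measurable_cst|exists `|r|]. Qed.

Lemma bmD g h : bm g -> bm h -> bm (fun x => g x + h x).
Proof.
move=> [mg [M gM]] [mh [N hN]]; split; first exact: measurable_funD.
by exists (M + N) => x; rewrite (le_trans (ler_normD _ _))// lerD.
Qed.

Lemma bmM g h : bm g -> bm h -> bm (fun x => g x * h x).
Proof.
move=> [mg [M gM]] [mh [N hN]]; split; first exact: measurable_funM.
by exists (M * N) => x; rewrite normrM ler_pM.
Qed.

Lemma bmN g : bm g -> bm (fun x => - g x).
Proof.
move=> bg; have := bmM (bm_cst (-1)) bg.
by rewrite (_ : (fun x => - g x) = (fun x => -1 * g x))//; apply/funext => x; rewrite mulN1r.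
Qed.

Lemma bmB g h : bm g -> bm h -> bm (fun x => g x - h x).
Proof. by move=> bg bh; apply: bmD => //; exact: bmN. Qed.

Lemma bm_sum (I : Type) (s : seq I) (F : I -> T -> R) :
  (forall i, bm (F i)) -> bm (fun x => \sum_(i <- s) F i x).
Proof.
move=> bF; elim: s => [|i s ih].
  rewrite (_ : (fun=> _) = fun=> 0); first exact: bm_cst.
  by apply/funext => x; rewrite big_nil.
rewrite (_ : (fun x => _) = fun x => F i x + \sum_(j <- s) F j x).
  exact: bmD.
by apply/funext => x; rewrite big_cons.
Qed.

Lemma bm_indic (A : set T) : measurable A -> bm (\1_A).
Proof.
move=> mA; split; first exact: measurable_indic.
by exists 1 => x; rewrite indicE; case: (_ \in _); rewrite ?normr1 ?normr0.
Qed.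

Lemma bm_norm g : bm g -> bm (fun x => `|g x|).
Proof.
move=> [mg [M gM]]; split; first exact: measurableT_comp.
by exists M => x; rewrite normr_id.
Qed.

End bounded_measurable.

Section mean.
Context d (T : measurableType d) (R : realType) (P : probability T R).
Implicit Types g h : T -> R.
Local Notation bm := bounded_measurable.

Lemma bm_integrable h : bm h -> P.-integrable setT (EFin \o h).
Proof.
move=> [mh [M hM]]; apply: measurable_bounded_integrable => //.
  by rewrite ltey_eq fin_num_measure.
exists M; split=> [|r Mr x _ /=]; first exact: num_real.
by rewrite (le_trans (hM x))// ltW.
Qed.

Definition mean h : R := (\int[P]_x h x)%R.

Lemma meanE h : bm h -> (\int[P]_x (h x)%:E = (mean h)%:E)%E.
Proof.
by move=> bh; rewrite /mean /Rintegral fineK// integrable_fin_num//; exact: bm_integrable.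
Qed.

Lemma mean_cst r : mean (fun=> r) = r.
Proof. by rewrite /mean Rintegral_cst//= probability_setT mulr1. Qed.

Lemma meanD g h : bm g -> bm h -> mean (fun x => g x + h x) = mean g + mean h.
Proof. by move=> bg bh; rewrite /mean RintegralD//; exact: bm_integrable. Qed.

Lemma meanB g h : bm g -> bm h -> mean (fun x => g x - h x) = mean g - mean h.
Proof. by move=> bg bh; rewrite /mean RintegralB//; exact: bm_integrable. Qed.

Lemma meanZ r h : bm h -> mean (fun x => r * h x) = r * mean h.
Proof. by move=> bh; rewrite /mean RintegralZl//; exact: bm_integrable. Qed.

Lemma meanN h : bm h -> mean (fun x => - h x) = - mean h.
Proof.
move=> bh; rewrite -mulN1r -meanZ//; congr mean.
by apply/funext => x; rewrite mulN1r.
Qed.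

Lemma mean_sum (I : Type) (s : seq I) (F : I -> T -> R) :
  (forall i, bm (F i)) ->
  mean (fun x => \sum_(i <- s) F i x) = \sum_(i <- s) mean (F i).
Proof.
move=> bF; elim: s => [|i s ih].
  rewrite big_nil (_ : (fun=> _) = fun=> 0) ?mean_cst//.
  by apply/funext => x; rewrite big_nil.
rewrite big_cons -ih -meanD//; last exact: bm_sum.
by congr mean; apply/funext => x; rewrite big_cons.
Qed.

Lemma le_mean g h : bm g -> bm h -> (forall x, g x <= h x) -> mean g <= mean h.
Proof. by move=> bg bh gh; apply: le_Rintegral => //; exact: bm_integrable. Qed.

Lemma mean_ge0 h : (forall x, 0 <= h x) -> 0 <= mean h.
Proof. by move=> h0; apply: Rintegral_ge0. Qed.

Lemma mean_indic (A : set T) : measurable A -> mean (\1_A) = fine (P A).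
Proof. by move=> mA; rewrite /mean /Rintegral integral_indic// setIT. Qed.

Lemma mean_dist g h e : bm g -> bm h -> (forall x, `|g x - h x| <= e) ->
  `|mean g - mean h| <= e.
Proof.
move=> bg bh ghe; rewrite -meanB// ler_norml.
have bgh := bmB bg bh.
rewrite -{1}(mean_cst (- e)) -{2}(mean_cst e).
apply/andP; split; apply: le_mean => //; try exact: bm_cst.
  by move=> x; have := ghe x; rewrite ler_norml => /andP[].
by move=> x; have := ghe x; rewrite ler_norml => /andP[].
Qed.

End mean.

(** The target carries only a topology, so one notion serves ['rV[R]_n], the Cantor space,
    configurations and extreme pairs. *)
Definition borel_fun d (T : measurableType d) (V : topologicalType) (q : T -> V) :=
  forall U, open U -> measurable (q @^-1` U).

Section borel_fun.
Context d (T : measurableType d) (R : realType) (V : topologicalType).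

Lemma borel_fun_comp (W : topologicalType) (S : set V) (q : T -> V) (F : V -> W) :
  borel_fun q -> (forall t, S (q t)) -> {within S, continuous F} -> borel_fun (F \o q).
Proof.
move=> bq Sq cF A oA; move/continuousP : cF => /(_ _ oA) /open_subspaceP[B oB SB].
rewrite (_ : _ @^-1` _ = q @^-1` B); first exact: bq.
apply/seteqP; split => t /= ht.
  have : (B `&` S) (q t) by rewrite SB; split => //; exact: Sq.
  by case.
have : (F @^-1` A `&` S) (q t) by rewrite -SB; split => //; exact: Sq.
by case.
Qed.

Lemma borel_fun_within (q : T -> V) (S : set V) (h : V -> R) :
  borel_fun q -> (forall t, S (q t)) -> {within S, continuous h} ->
  measurable_fun setT (h \o q).
Proof.
move=> bq Sq ch; apply: (measurability _ (RGenOInfty.measurableE R)).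
move=> /= _ [_ [a ->]] <-; rewrite setTI.
exact: (@borel_fun_comp R S q h bq Sq ch _ (rray_open a)).
Qed.

Lemma borel_fun_bm (q : T -> V) (S : set V) (h : V -> R) :
  compact S -> borel_fun q -> (forall t, S (q t)) -> {within S, continuous h} ->
  bounded_measurable (h \o q).
Proof.
move=> cS bq Sq ch; split; first exact: borel_fun_within ch.
have [M [_ hM]] : exists M : R, M \is Num.real /\
    forall r, M < r -> forall y, (h @` S) y -> `|y| <= r.
  exact: (compact_bounded (continuous_compact ch cS)).
by exists (M + 1) => t /=; apply: (hM (M + 1)); [rewrite ltrDl|exists (q t)].
Qed.

End borel_fun.

(** * Laws dominated by a cone of functions *)

Section compact_cantor_image.
Variable R : realType.

(** The Hausdorff-Alexandroff theorem for the subspace [S], seen as a pointed pseudometric space of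
    its own. *)
Lemma cantor_image (V : pseudoMetricType R) (S : set V) :
  compact S -> hausdorff_space V -> S !=set0 ->
  exists q : cantor_space -> V, continuous q /\ range q = S.
Proof.
move=> cS hV [s Ss].
pose W : pseudoMetricType R := set_type S.
pose T : pseudoPMetricType R := HB.pack (set_type S)
  (PseudoMetric.class W) (isPointed.Build (set_type S) (exist _ s (mem_set Ss))).
(* [T] is the image of [S] under [g], which inverts the inclusion; continuity of [g] on [S] is
   continuity of its composition with the inclusion, the identity. *)
have cT : compact [set: T].
  pose g (x : V) : T := if pselect (S x) is left Sx then exist _ x (mem_set Sx)
    else exist _ s (mem_set Ss).
  have -> : [set: T] = [set g x | x in S].
    apply/seteqP; split => // -[x Sx] _; exists x; first exact: set_mem.
    by rewrite /g; case: pselect => [Sx'|/(_ (set_mem Sx))//]; exact: eq_sig_hprop.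
  apply: continuous_compact => //.
  apply: (@continuous_comp_initial _ (subspace S) V (set_val : T -> V)).
  have idg : {in S, (idfun : subspace S -> V) =1 (set_val : T -> V) \o g}.
    by move=> x /set_mem Sx; rewrite /g /=; case: pselect.
  apply: (subspace_eq_continuous idg).
  by apply: continuous_subspaceT => x; exact: cvg_id.
have hT : hausdorff_space T.
  rewrite open_hausdorff => x y xy.
  have : set_val x != set_val y.
    by apply: contra xy => /eqP xy; apply/eqP; exact: eq_sig_hprop.
  move: hV; rewrite open_hausdorff => /[apply] -[[A B]] /=.
  move=> [/set_mem Ax /set_mem By] [oA oB AB].
  exists (set_val @^-1` A, set_val @^-1` B); first by split; exact: mem_set.
  split; [by exists A|by exists B|].
  by rewrite -preimage_setI (eqP AB)// preimage_set0.
have [f cf] := cantor_surj cT hT.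
exists (set_val \o f); split.
  move=> x; apply: continuous_comp; first exact: cf.
  exact: initial_continuous.
apply/seteqP; split => [_ [x _ <-]|y Sy]; first exact: set_valP.
have [x _ fx] := @surj _ _ _ _ f (exist _ y (mem_set Sy)) I.
by exists x => //=; rewrite fx.
Qed.

Lemma cantor_second_countable : @second_countable cantor_space.
Proof.
pose W : pseudoMetricType R := prod_topology (fun _ : nat => bool).
pose T : pseudoPMetricType R := HB.pack (prod_topology (fun _ : nat => bool))
  (PseudoMetric.class W) (isPointed.Build (prod_topology (fun _ : nat => bool)) point).
exact: (@compact_second_countable R T cantor_space_compact).
Qed.

End compact_cantor_image.

(** An alias whose measurable sets are the clopen sets only. They form an algebra, the starting
    point of the extension of a content to a measure. *)
Definition clopen_space : Type := cantor_space.

HB.instance Definition _ := Pointed.on clopen_space.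

HB.instance Definition _ := @isAlgebraOfSets.Build default_measure_display
  clopen_space (@clopen cantor_space) clopen0 (@clopenU cantor_space)
  (fun A cA => @clopenC cantor_space A A cA).

Section clopen_extension.
Variables (R : realType) (m : set cantor_space -> R).
Hypothesis m_ge0 : forall A, 0 <= m A.
Hypothesis mU : forall A B, A `&` B = set0 -> m (A `|` B) = m A + m B.
Hypothesis mT : m setT = 1.

Definition clopen_content (A : set clopen_space) : \bar R := (m A)%:E.

Let m0 : m set0 = 0.
Proof.
have := @mU set0 set0; rewrite setI0 setU0 => /(_ erefl) /esym/eqP.
by rewrite -subr_eq0 addrK => /eqP.
Qed.

Let content0 : clopen_content set0 = 0%E.
Proof. by rewrite /clopen_content m0. Qed.

Let content_ge0 A : (0 <= clopen_content A)%E.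
Proof. by rewrite lee_fin. Qed.

(* A countable partition of a clopen set into clopen sets is finite, by
   compactness, so finite additivity suffices. *)
Let content_sigma_additive : semi_sigma_additive clopen_content.
Proof.
move=> F mF tF [oU cU].
have cmpU : compact (\bigcup_n F n : set cantor_space).
  by apply: (subclosed_compact cU cantor_space_compact).
move: cmpU; rewrite compact_cover => /(_ nat setT F)[||D _ UD].
- by move=> i _; have [] := mF i.
- by [].
(* All indices of the finite subcover lie below [N]. The later sets are disjoint from this subcover
   of their own union, hence empty. *)
pose N := (\max_(i : D) (val i)).+1.
have UN : \bigcup_n F n = \big[setU/set0]_(i < N) F i.
  apply/seteqP; split; last by move=> x; rewrite -bigcup_mkord => -[i _ Fx]; exists i.
  move=> x /UD[i Di Fx]; rewrite -bigcup_mkord; exists i => //=.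
  rewrite /N ltnS; exact: (@leq_bigmax _ (fun i : D => val i) [` Di]%fset).
have F0 n : (N <= n)%N -> F n = set0.
  move=> Nn; rewrite -subset0 => x Fx.
  have : (\bigcup_n F n) x by exists n.
  rewrite UN -bigcup_mkord => -[i /= iN Fix].
  have := tF n i I I; rewrite (_ : n = i :> nat); last by apply/(tF n i) => //; exists x.
  by move=> _; move: iN; rewrite ltnNge -{1}(tF n i I I) ?Nn//; exists x.
have add n : m (\big[setU/set0]_(i < n) F i) = \sum_(i < n) m (F i).
  elim: n => [|n ih]; first by rewrite !big_ord0.
  rewrite !big_ord_recr/= mU ?ih//.
  rewrite -subset0 => x; rewrite -bigcup_mkord => -[[i /= ni Fix] Fnx].
  by move: ni; rewrite (tF i n I I) ?ltnn//; exists x.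
rewrite UN /clopen_content add; apply: cvg_near_cst.
exists N => // n /= Nn; rewrite sumEFin; congr EFin.
rewrite -(subnKC Nn) big_mkord big_split_ord/= [X in _ + X]big1 ?addr0// => i _.
by rewrite F0 ?leq_addr.
Qed.

HB.instance Definition _ := isMeasure.Build _ _ _ clopen_content
  content0 content_ge0 content_sigma_additive.

Let T := g_sigma_algebraType (@measurable _ clopen_space).
Let P : set T -> \bar R := measure_extension clopen_content.

Let P_clopen (A : set cantor_space) : clopen A -> P A = (m A)%:E.
Proof. by move=> cA; rewrite /P /measure_extension measurable_mu_extE. Qed.

Let PT : P setT = 1%E.
Proof. by rewrite P_clopen ?mT//; exact: clopenT. Qed.

HB.instance Definition _ := Measure.on P.
HB.instance Definition _ := Measure_isProbability.Build _ _ _ P PT.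

(** The map [e] is the identity; it separates the topology of the Cantor space from the
    sigma-algebra that the clopen sets generate. *)
Lemma clopen_extension : exists d (T : measurableType d) (e : T -> cantor_space)
  (P : probability T R), borel_fun e /\
    forall A, clopen A -> P (e @^-1` A) = (m A)%:E.
Proof.
exists _, T, idfun, P; split; last exact: P_clopen.
move=> U oU; rewrite preimage_id.
(* The clopen sets are countably many and form a base, so [U] is the countable union of those that
   it contains. *)
have /pfcard_geP[c0|[f]] := clopen_countable cantor_space_compact
  (cantor_second_countable R).
  by move: (@clopen0 cantor_space); rewrite c0.
pose g n := if `[< f n `<=` U >] then f n else set0.
have -> : U = \bigcup_n g n.
  apply/seteqP; split=> [x Ux|x [n _]]; last first.
    by rewrite /g; case: asboolP => // fU /fU.
  have [A [Ax cA] AU] : filter_from [set D | D x /\ clopen D] id U.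
    apply: (@zero_dimensional_cvg _ x cantor_space_hausdorff
      cantor_zero_dimensional cantor_space_compact).
    by rewrite nbhsE; exists U.
  have [n _ fn] := @surj _ _ _ _ f _ cA.
  by exists n => //; rewrite /g fn; case: asboolP.
apply: bigcupT_measurable => n; rewrite /g; case: ifP => _.
  by apply: sub_sigma_algebra; exact: (@funS _ _ _ _ f n).
exact: measurable0.
Qed.

End clopen_extension.

Lemma In_map (A : eqType) (B : Type) (f : A -> B) (s : seq A) x :
  x \in s -> List.In (f x) (map f s).
Proof.
elim: s => //= a s ih; rewrite inE => /predU1P[->|/ih]; [by left|by right].
Qed.

Section step_function.
Variables (T : Type) (R : realType).
Implicit Types l : seq (set T * R).

(** The first cell that contains [x] decides, so a finite cover can be used without making it
    disjoint. *)
Fixpoint step l (x : T) : R :=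
  if l is (A, c) :: l' then if x \in A then c else step l' x else 0.

Lemma step_near l x (y e : R) : (exists2 Ac, List.In Ac l & Ac.1 x) ->
  (forall Ac, List.In Ac l -> Ac.1 x -> `|y - Ac.2| <= e) -> `|y - step l x| <= e.
Proof.
elim: l => [[Ac []]|[A c] l ih] //= [Ac Acl Acx] h.
case: ifPn => [/set_mem Ax|/negP xA]; first by apply: (h (A, c)) => //; left.
apply: ih => [|Bc Bcl]; last by apply: h; right.
case: Acl => [AcE|Acl]; last by exists Ac.
by case: xA; apply: mem_set; rewrite -AcE in Acx.
Qed.

(** Removing the first cell shrinks [B], and the remainder has the same form; this drives the
    induction over the cells in [cone_measure]. *)
Lemma indic_step_cons (B A : set T) c l :
  (fun x => \1_B x * step ((A, c) :: l) x) =
  (fun x => c * \1_(B `&` A) x + \1_(B `\` A) x * step l x).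
Proof.
apply/funext => x /=; rewrite !indicE in_setD in_setI.
by case: (x \in B); case: (x \in A); rewrite /= ?mul1r ?mul0r ?mulr1 ?mulr0 ?addr0 ?add0r.
Qed.

End step_function.

Section cone_measure.
Variables (R : realType) (V : pseudoMetricType R) (S : set V).
Variable W : set ((V -> R) * R).
Hypotheses (cS : compact S) (hV : hausdorff_space V) (S0 : S !=set0).
Hypothesis W_cont : forall w, W w -> {within S, continuous w.1}.
Hypothesis WD : forall u w, W u -> W w ->
  W (fun x => u.1 x + w.1 x, u.2 + w.2).
Hypothesis WZ : forall a w, 0 <= a -> W w -> W (fun x => a * w.1 x, a * w.2).
Hypothesis W_cst : forall r, W (fun=> r, r).
Hypothesis W_ge0 : forall w, W w -> (forall x, S x -> 0 <= w.1 x) -> 0 <= w.2.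

Let q : cantor_space -> V := sval (cid (cantor_image cS hV S0)).

Let q_cont : continuous q.
Proof. by rewrite /q; case: cid => ? []. Qed.

Let q_range : range q = S.
Proof. by rewrite /q; case: cid => ? []. Qed.

Let F : lmodType R := cantor_space -> R^o.

Let D : set F := [set h | exists M, forall x, `|h x| <= M].

(** The infimum of these bounds is the sublinear functional for the Hahn-Banach theorem: the least
    bound that [W] imposes on a function above [h]. Constants in [W] make the set nonempty for
    bounded [h], and [W_ge0] bounds it from below. *)
Let above (h : F) : set R :=
  [set v | exists2 w, W w & (forall x, h x <= w.1 (q x)) /\ w.2 = v].

Let p (h : F) := inf (above h).

Let D0 : D 0.
Proof. by exists 0 => x; rewrite normr0. Qed.

Let DD u v : D u -> D v -> D (u + v).
Proof.
move=> [M uM] [N vN]; exists (M + N) => x.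
by rewrite (le_trans (ler_normD _ _))// lerD.
Qed.

Let DZ a u : D u -> D (a *: u).
Proof.
move=> [M uM]; exists (`|a| * M) => x.
by rewrite [X in `|X|](_ : _ = a * u x)// normrM ler_wpM2l.
Qed.

Let above_ge h M v : (forall x, - M <= h x) -> above h v -> - M <= v.
Proof.
move=> hM [w Ww [hw <-]]; suff : 0 <= w.2 + M by lra.
apply: (W_ge0 (WD Ww (W_cst M))) => y; rewrite -q_range => -[x _ <-] /=.
by rewrite -lerBlDr sub0r (le_trans (hM x)).
Qed.

Let above_inf h : D h -> has_inf (above h).
Proof.
move=> [M hM]; split.
  exists M, (fun=> M, M) => //; split => // x.
  by rewrite (le_trans (ler_norm _)).
exists (- M) => v; apply: above_ge => x.
by have := hM x; rewrite ler_norml => /andP[].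
Qed.

Let p_le h w : D h -> W w -> (forall x, h x <= w.1 (q x)) -> p h <= w.2.
Proof.
move=> Dh Ww hw; apply: ge_inf; first exact: (above_inf Dh).2.
by exists w.
Qed.

Let le_p h r : D h -> (forall w, W w -> (forall x, h x <= w.1 (q x)) -> r <= w.2) ->
  r <= p h.
Proof.
move=> Dh hr; apply: lb_le_inf; first exact: (above_inf Dh).1.
by move=> _ [w Ww [hw <-]]; exact: hr.
Qed.

Let pD u v : D u -> D v -> p (u + v) <= p u + p v.
Proof.
move=> Du Dv; rewrite -lerBlDr; apply: le_p => // w Ww uw.
rewrite lerBlDr -lerBlDl; apply: le_p => // w' Ww' vw'.
rewrite lerBlDl; apply: (p_le (DD Du Dv) (WD Ww Ww')) => x /=.
exact: lerD.
Qed.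

Let pZ a u : D u -> 0 <= a -> p (a *: u) = a * p u.
Proof.
have le b h : D h -> 0 < b -> p (b *: h) <= b * p h.
  move=> Dh b0; rewrite -ler_pdivrMl//; apply: le_p => // w Ww hw.
  rewrite ler_pdivrMl//; apply: (p_le (DZ b Dh) (WZ (ltW b0) Ww)) => x /=.
  by rewrite ler_pM2l.
move=> Du; rewrite le_eqVlt => /predU1P[<-|a0].
  rewrite scale0r mul0r; apply/eqP; rewrite eq_le; apply/andP; split.
    by apply: (p_le D0 (W_cst 0)).
  apply: le_p => // w Ww w0; rewrite -[0]oppr0; apply: (@above_ge 0) => //.
    by move=> x; rewrite oppr0.
  by exists w.
apply/eqP; rewrite eq_le le//= -ler_pdivlMl//.
have := le _ _ (DZ a Du) (_ : 0 < a^-1).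
by rewrite scalerA mulVf ?gt_eqF// scale1r; apply; rewrite invr_gt0.
Qed.

Let D_indic (A : set cantor_space) : D \1_A.
Proof. by exists 1 => x; rewrite indicE ger0_norm// lern1 leq_b1. Qed.

(** Since [W] contains the constants, a linear functional dominated by [p] is positive and
    normalised. Only its values on clopen indicators are kept, to define the measure; the bound for
    [w.1 \o q] is recovered by uniform approximation. *)
Theorem cone_measure : exists d (T : measurableType d) (e : T -> V)
  (P : probability T R), [/\ borel_fun e, forall t, S (e t) &
    forall w, W w -> mean P (w.1 \o e) <= w.2].
Proof.
have [f [fp fD fZ]] := hahn_banach D0 DD DZ pD pZ.
pose m (A : set cantor_space) := f \1_A.
have fN u : D u -> f (- u) = - f u by move=> Du; rewrite -scaleN1r fZ// mulN1r.
have m_ge0 A : 0 <= m A.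
  rewrite /m -oppr_le0 -fN//; have DN := DZ (-1) (D_indic A).
  rewrite scaleN1r in DN.
  apply: (le_trans (fp _ DN)); apply: (p_le DN (W_cst 0)) => x.
  by rewrite oppr_le0 indicE.
have mU A B : A `&` B = set0 -> m (A `|` B) = m A + m B.
  move=> AB; rewrite /m -fD//; congr f; apply/funext => x.
  rewrite [RHS](_ : _ = \1_A x + \1_B x)// !indicE in_setU.
  have : x \notin A `&` B by rewrite AB in_set0.
  by rewrite in_setI; case: (x \in A); case: (x \in B) => //=; rewrite ?addr0 ?add0r.
have mT : m setT = 1.
  have DT := D_indic setT.
  apply/eqP; rewrite eq_le; apply/andP; split.
    apply: (le_trans (fp _ DT)); apply: (p_le DT (W_cst 1)) => x.
    by rewrite indicE in_setT.
  have DN := DZ (-1) DT; rewrite scaleN1r in DN.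
  rewrite -lerN2 -fN//.
  apply: (le_trans (fp _ DN)); apply: (p_le DN (W_cst (-1))) => x.
  by rewrite [leLHS](_ : _ = - \1_setT x)// indicE in_setT.
have [d [T [e [P [be Pm]]]]] := clopen_extension m_ge0 mU mT.
exists d, T, (q \o e), P; split.
- by move=> U oU; apply: (be (q @^-1` U)); move/continuousP : q_cont; exact.
- by move=> t; rewrite -q_range; exists (e t).
move=> w Ww.
have cwq : continuous (w.1 \o q).
  apply/continuousP => U oU.
  move/continuousP : (W_cont Ww) => /(_ _ oU) /open_subspaceP[U' oU' U'S].
  rewrite (_ : _ @^-1` _ = q @^-1` U'); first by move/continuousP : q_cont; exact.
  have Sq x : S (q x) by rewrite -q_range; exists x.
  apply/seteqP; split => x /= hx.
    have : (w.1 @^-1` U `&` S) (q x) by split => //; exact: Sq.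
    by rewrite -U'S => -[].
  have : (U' `&` S) (q x) by split => //; exact: Sq.
  by rewrite U'S => -[].
have bmw : bounded_measurable (w.1 \o q \o e).
  apply: (borel_fun_bm cantor_space_compact be) => //.
  exact: continuous_subspaceT.
(* The functional and the mean agree on step functions with clopen cells. The factor [\1_B] makes
   the statement stable under removal of a cell. *)
have mean_step l : (forall Ac, List.In Ac l -> @clopen cantor_space Ac.1) ->
    forall B, clopen B -> let s := (fun x => \1_B x * step l x) in
    [/\ D s, bounded_measurable (s \o e) & mean P (s \o e) = f s].
  elim: l => [_ B cB|[A c] l ih cl B cB] s.
    have -> : s = fun=> 0 by apply/funext => x; rewrite /s /= mulr0.
    split; [exact: D0|exact: bm_cst|].
    rewrite [LHS](mean_cst P 0).
    have -> : (fun=> 0) = 0 *: (0 : F) by rewrite scale0r.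
    by rewrite fZ// mul0r.
  have cA : clopen A by apply: (cl (A, c)); left.
  have cBA : clopen (B `&` A) by exact: clopenI.
  have [||Dl bml ml] := ih _ (B `\` A).
    by move=> Ac Acl; apply: cl; right.
    by rewrite setDE; apply: clopenI => //; exact: clopenC.
  have bmBA : bounded_measurable (\1_(B `&` A) \o e : T -> R).
    rewrite (_ : _ \o _ = \1_(e @^-1` (B `&` A))); last first.
      by apply/funext => t; rewrite /= !indicE; congr (_%:R); rewrite mem_preimage.
    by apply: bm_indic; apply: be; case: cBA.
  rewrite /s indic_step_cons; split.
  - exact: (DD (DZ c (D_indic (B `&` A))) Dl).
  - by apply: bmD => //; apply: bmM => //; exact: bm_cst.
  - rewrite [LHS]meanD//; last by apply: bmM => //; exact: bm_cst.
    rewrite meanZ// ml [RHS](fD (c *: \1_(B `&` A)))//; last exact: DZ.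
    rewrite fZ//; congr (_ * _ + _).
    rewrite [X in mean P X](_ : _ = \1_(e @^-1` (B `&` A))); last first.
      by apply/funext => t; rewrite /= !indicE; congr (_%:R); rewrite mem_preimage.
    rewrite mean_indic; last by apply: be; case: cBA.
    by rewrite Pm.
apply/ler_addgt0Pr => eps eps0.
have e20 : 0 < eps / 2 by rewrite divr_gt0.
have /choice[A_ A_P] : forall x, exists A, [/\ A x, @clopen cantor_space A &
    forall y, A y -> `|w.1 (q y) - w.1 (q x)| <= eps / 2].
  move=> x.
  have [A [Ax cA] Aw] : filter_from [set A | A x /\ @clopen cantor_space A] id
      [set y | `|w.1 (q x) - w.1 (q y)| <= eps / 2].
    apply: (zero_dimensional_cvg cantor_space_hausdorff cantor_zero_dimensional
      cantor_space_compact).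
    have /cvgrPdist_le/(_ _ e20) := cwq x; exact.
  by exists A; split => // y /Aw /=; rewrite distrC.
move: cantor_space_compact; rewrite compact_cover => /(_ cantor_space setT A_)[||E _ TE].
- by move=> x _; have [_ []] := A_P x.
- by move=> x _; exists x => //; have [] := A_P x.
pose l := [seq (A_ x, w.1 (q x)) | x <- enum_fset E].
have lP Ac : List.In Ac l -> exists x, Ac = (A_ x, w.1 (q x)).
  rewrite /l; elim: (enum_fset E) => //= a s ih [<-|/ih//]; by exists a.
have lclopen Ac : List.In Ac l -> @clopen cantor_space Ac.1.
  by move=> /lP[x ->]; have [] := A_P x.
have near x : `|w.1 (q x) - step l x| <= eps / 2.
  apply: step_near.
    have [y Ey Ay] := TE x I; exists (A_ y, w.1 (q y)) => //.
    exact: In_map.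
  by move=> _ /lP[y ->] /= Ax; have [_ _] := A_P y; exact.
have [] := mean_step l lclopen setT clopenT.
rewrite (_ : (fun x => _) = step l); last first.
  by apply/funext => x; rewrite indicE in_setT mul1r.
move=> Dl bml ml.
(* One half of [eps] pays for replacing [w.1 \o q] by the step function under the mean, the other
   for dominating the step function by an element of [W]. *)
have -> : w.2 + eps = (w.2 + eps / 2) + eps / 2 by rewrite -addrA -splitr.
rewrite -lerBlDr.
apply: (@le_trans _ _ (mean P (step l \o e))).
  rewrite -[X in _ - X](mean_cst P) -meanB//; last exact: bm_cst.
  apply: le_mean => //; first by apply: bmB => //; exact: bm_cst.
  by move=> t /=; have := near (e t); rewrite ler_norml => /andP[]; lra.
rewrite ml; apply: (le_trans (fp _ Dl)).
apply: (p_le Dl (WD Ww (W_cst (eps / 2)))) => x /=.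
by have := near x; rewrite ler_norml => /andP[]; lra.
Qed.

End cone_measure.

(** * Convex combinations *)

Section convex_combinations.
Variables (R : realType) (E : lmodType R).

Lemma convex_setE (A : set E) x y (t : R) : convex_set A -> A x -> A y ->
  0 <= t <= 1 -> A (t *: x + (1 - t) *: y).
Proof.
move=> cA Ax Ay /andP[t0 t1].
have := cA x y (Itv01 t0 t1) (mem_set Ax) (mem_set Ay).
by move/set_mem.
Qed.

(** The hypothesis is closure under two-point combinations, which [jensen] can check directly for an
    epigraph. *)
Lemma convex_set_sum (A : set E) : (forall x y (t : R), A x -> A y ->
    0 <= t <= 1 -> A (t *: x + (1 - t) *: y)) ->
  forall m (l : 'I_m -> R) (x : 'I_m -> E), (forall i, 0 <= l i) ->
  \sum_i l i = 1 -> (forall i, A (x i)) -> A (\sum_i l i *: x i).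
Proof.
move=> cA; elim=> [|m ih] l x l0 l1 Ax.
  by move: l1; rewrite big_ord0 => /eqP; rewrite eq_sym oner_eq0.
rewrite big_ord_recl; move: l1; rewrite big_ord_recl => l1.
have r0 : 0 <= \sum_(i < m) l (lift ord0 i) by exact: sumr_ge0.
have [l01|l01] := eqVneq (l ord0) 1.
  rewrite big1 ?addr0 ?l01 ?scale1r// => i _.
  have /psumr_eq0P : \sum_(i < m) l (lift ord0 i) = 0 by lra.
  by move=> ->//; rewrite scale0r.
have s0 : 0 < 1 - l ord0 by rewrite lt_neqAle eq_sym subr_eq0 eq_sym l01/=; lra.
rewrite (_ : \sum_(i < m) _ = (1 - l ord0) *:
    \sum_(i < m) ((1 - l ord0)^-1 * l (lift ord0 i)) *: x (lift ord0 i)).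
  apply: cA => //; last by apply/andP; split => //; lra.
  apply: ih => // [i|]; first by rewrite mulr_ge0// invr_ge0 ltW.
  have rE : \sum_(i < m) l (lift ord0 i) = 1 - l ord0 by lra.
  by rewrite -mulr_sumr rE mulVf// gt_eqF.
rewrite scaler_sumr; apply: eq_bigr => i _.
by rewrite scalerA mulrA divff ?mul1r// gt_eqF.
Qed.

End convex_combinations.

(** The epigraph of [g] is convex, so it contains the convex combination of the points
    [(x i, g (x i))]. *)
Lemma jensen (R : realType) (E : lmodType R) (A : set E) (g : E -> R) :
  convex_set A -> convex_function A g ->
  forall m (l : 'I_m -> R) (x : 'I_m -> E), (forall i, 0 <= l i) ->
  \sum_i l i = 1 -> (forall i, A (x i)) ->
  g (\sum_i l i *: x i) <= \sum_i l i * g (x i).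
Proof.
move=> cA cg m l x l0 l1 Ax.
pose epi := [set z : E * R^o | A z.1 /\ g z.1 <= z.2].
pose S (s : seq 'I_m) : E * R^o := \sum_(i <- s) l i *: ((x i, g (x i)) : E * R^o).
have : epi (S (index_enum 'I_m)).
  apply: (@convex_set_sum _ _ epi) => //; last by move=> i; split=> /=.
  move=> -[x1 r1] [x2 r2] t [/= A1 g1] [/= A2 g2] t01.
  split=> /=; first exact: convex_setE.
  have /andP[t0 t1] := t01.
  have := cg (Itv01 t0 t1) x1 x2 (mem_set A1) (mem_set A2).
  rewrite convRE /= => /le_trans; apply.
  by apply: (@lerD _ (t * _) _ ((1 - t) * _)); apply: ler_wpM2l => //=; rewrite subr_ge0.
suff -> : forall s, S s = (\sum_(i <- s) l i *: x i, \sum_(i <- s) l i * g (x i)).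
  by case.
by elim=> [|i s ih]; rewrite /S ?big_nil// !big_cons -/(S s) ih.
Qed.

(* The number of points can be decreased as long as it exceeds [n + 1]: the
   points then satisfy an affine relation [v], and moving along [v] (with the
   sign that does not increase the value) until a weight vanishes drops a
   point. *)
Lemma caratheodory (R : realType) n (K : set 'rV[R]_n) (phi : 'rV[R]_n -> R)
    (b : 'rV[R]_n) (c : R) :
  (forall (l : 'I_n.+1 -> R) (x : 'I_n.+1 -> 'rV[R]_n), (forall i, 0 <= l i) ->
    \sum_i l i = 1 -> (forall i, K (x i)) -> \sum_i l i *: x i = b ->
    c <= \sum_i l i * phi (x i)) ->
  forall m (l : 'I_m -> R) (x : 'I_m -> 'rV[R]_n), (forall i, 0 <= l i) ->
    \sum_i l i = 1 -> (forall i, K (x i)) -> \sum_i l i *: x i = b ->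
    c <= \sum_i l i * phi (x i).
Proof.
move=> H; elim=> [|m ih] l x l0 l1 Kx lx.
  by move: l1; rewrite big_ord0 => /eqP; rewrite eq_sym oner_eq0.
(* Too few points are padded to [n.+1] points by copies of [x ord0] of weight zero. *)
have [mn|nm] := leqP m.+1 n.+1.
  pose k := (n.+1 - m.+1)%N.
  have kE : (m.+1 + k)%N = n.+1 by rewrite subnKC.
  pose l' (i : 'I_n.+1) := if fintype.split (cast_ord (esym kE) i) is inl j then l j else 0.
  pose x' (i : 'I_n.+1) := if fintype.split (cast_ord (esym kE) i) is inl j then x j else x ord0.
  have sumE (U : nmodType) (F : 'I_n.+1 -> U) :
      (forall j, F (cast_ord kE (rshift m.+1 j)) = 0) ->
      \sum_i F i = \sum_(i < m.+1) F (cast_ord kE (lshift k i)).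
    move=> F0; rewrite (reindex (cast_ord kE)) /=; last first.
      by exists (cast_ord (esym kE)) => i _; rewrite ?cast_ordK ?cast_ordKV.
    by rewrite big_split_ord/= [X in _ + X]big1 ?addr0.
  have l'l i : l' (cast_ord kE (lshift k i)) = l i.
    by rewrite /l' cast_ordK (unsplitK (inl i : 'I_m.+1 + 'I_k)).
  have x'x i : x' (cast_ord kE (lshift k i)) = x i.
    by rewrite /x' cast_ordK (unsplitK (inl i : 'I_m.+1 + 'I_k)).
  have l'0 i : l' (cast_ord kE (rshift m.+1 i)) = 0.
    by rewrite /l' cast_ordK (unsplitK (inr i : 'I_m.+1 + 'I_k)).
  have s1 : \sum_i l' i = \sum_i l i.
    by rewrite sumE//; apply: eq_bigr => i _; rewrite l'l.
  have s2 : \sum_i l' i *: x' i = \sum_i l i *: x i.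
    rewrite sumE => [|i]; last by rewrite l'0 scale0r.
    by apply: eq_bigr => i _; rewrite l'l x'x.
  have s3 : \sum_i l' i * phi (x' i) = \sum_i l i * phi (x i).
    rewrite sumE => [|i]; last by rewrite l'0 mul0r.
    by apply: eq_bigr => i _; rewrite l'l x'x.
  rewrite -s3; apply: H; rewrite ?s1 ?s2//.
    by move=> i; rewrite /l'; case: fintype.split.
  by move=> i; rewrite /x'; case: fintype.split.
(* Row [i] is [x i] preceded by 1, so a vector of the left kernel is an affine relation between the
   points. One exists because there are more rows than columns. *)
pose M : 'M[R]_(m.+1, 1 + n) := \matrix_(i, j)
  (if fintype.split j is inr j' then x i ord0 j' else 1).
have kM : kermx M != 0.
  rewrite kermx_eq0 /row_free neq_ltn; apply/orP; left.
  by rewrite (leq_ltn_trans (rank_leq_col M)).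
have [v [v0 vM]] : exists v : 'rV[R]_m.+1, v != 0 /\ v *m M = 0.
  have /rowV0Pn[v vk v0] := kM; exists v; split => //; exact/sub_kermxP.
wlog vphi : v v0 vM / \sum_i v ord0 i * phi (x i) <= 0.
  move=> wl; have [|vphi] := leP (\sum_i v ord0 i * phi (x i)) 0; first exact: (wl v).
  apply: (wl (- v)); rewrite ?oppr_eq0// ?mulNmx ?vM ?oppr0//.
  under eq_bigr do rewrite mxE mulNr.
  by rewrite sumrN oppr_le0 ltW.
have v1 : \sum_i v ord0 i = 0.
  have := congr1 (fun A : 'rV[R]_(1 + n) => A ord0 (lshift n ord0)) vM.
  rewrite !mxE => vE; rewrite -[RHS]vE; apply: eq_bigr => i _.
  by rewrite mxE (unsplitK (inl ord0 : 'I_1 + 'I_n)) mulr1.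
have vx : \sum_i v ord0 i *: x i = 0.
  apply/rowP => j.
  have := congr1 (fun A : 'rV[R]_(1 + n) => A ord0 (rshift 1 j)) vM.
  rewrite !mxE => vE; rewrite -[RHS]vE summxE; apply: eq_bigr => i _.
  by rewrite !mxE (unsplitK (inr j : 'I_1 + 'I_n)).
have [i0 vi0] : exists i, v ord0 i < 0.
  apply/not_existsP => vge; move/eqP : v0; apply; apply/rowP => i; rewrite mxE.
  have /psumr_eq0P : \sum_i v ord0 i = 0 by [].
  by apply => // j _; rewrite leNgt; apply/negP/vge.
pose P := [pred i | v ord0 i < 0].
(* [i1] is the first index whose weight vanishes along [l + t * v]; up to that time [t] all weights
   stay nonnegative. *)
have [i1 vi1 i1min] := @arg_minP _ _ _ i0 P (fun i => l i / - v ord0 i) vi0.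
pose t := l i1 / - v ord0 i1.
have t0 : 0 <= t by rewrite divr_ge0// oppr_ge0 ltW.
pose l' i := l i + t * v ord0 i.
have l'1 : l' i1 = 0.
  by rewrite /l' /t invrN mulrN mulNr divfK ?subrr// lt_eqF.
have l'0 i : 0 <= l' i.
  rewrite /l'; have [vi|vi] := ltP (v ord0 i) 0; last by rewrite addr_ge0// mulr_ge0.
  have := i1min i vi; rewrite -/t ler_pdivlMr ?oppr_gt0// mulrN; lra.
have sumE (U : nmodType) (F : 'I_m.+1 -> U) : F i1 = 0 ->
    \sum_i F i = \sum_(i < m) F (lift i1 i).
  by move=> F0; rewrite (bigD1_ord i1)//= F0 add0r.
have := ih (l' \o lift i1) (x \o lift i1); rewrite /=.
rewrite -!(sumE _ (fun i => l' i)) -?(sumE _ (fun i => l' i *: x i))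
  -?(sumE _ (fun i => l' i * phi (x i))) ?l'1 ?scale0r ?mul0r//.
have -> : \sum_i l' i = 1 by rewrite big_split/= -mulr_sumr v1 mulr0 addr0.
have -> : \sum_i l' i *: x i = b.
  under eq_bigr do rewrite scalerDl -scalerA.
  by rewrite big_split/= -scaler_sumr vx scaler0 addr0.
move=> /(_ (fun i => l'0 _) erefl (fun i => Kx _) erefl) /le_trans; apply.
under [leLHS]eq_bigr do rewrite /l' mulrDl -mulrA.
by rewrite big_split/= -mulr_sumr gerDl mulr_ge0_le0.
Qed.

(** * Uniform continuity and fine Borel partitions *)

Lemma within_continuous_near (R : realType) (V : topologicalType)
    (K : set V) (f : V -> R) x (e : R) : {within K, continuous f} -> K x -> 0 < e ->
  nbhs x [set y | K y -> `|f x - f y| <= e].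
Proof.
move=> cf Kx e0.
have : nbhs (x : subspace K) [set y | `|f x - f y| <= e].
  by have /cvgrPdist_le := cf x; exact.
by rewrite {1}/nbhs /= -(nbhs_subspace_in Kx).
Qed.

Lemma compact_uniform_continuity (R : realType) (V : pseudoMetricType R)
    (K : set V) (f : V -> R) (e : R) :
  compact K -> {within K, continuous f} -> 0 < e ->
  exists2 d, 0 < d &
    forall x y, K x -> K y -> ball x d y -> `|f x - f y| <= e.
Proof.
move=> /compact_near_coveringP cK cf e0.
pose P (d : R) (x : V) := K x -> forall y, K y -> ball x d y -> `|f x - f y| <= e.
have : \forall d \near 0^'+, K `<=` P d.
  apply: cK => x Kx.
  have e20 : 0 < e / 2 by rewrite divr_gt0.
  have /nbhs_ballP[r /= r0 rf] := within_continuous_near cf Kx e20.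
  near=> x' d => Kx' y Ky x'y.
  have r2 : ball x (r / 2) x' by near: x'; apply: nbhsx_ballx; rewrite divr_gt0.
  have d2 : d <= r / 2 by near: d; apply: nbhs_right_le; rewrite divr_gt0.
  have xy : ball x r y.
    by rewrite [r]splitr; apply: ball_triangle r2 _; exact: le_ball x'y.
  have xx' : ball x r x' by apply: le_ball r2; lra.
  rewrite (_ : f x' - f y = (f x - f y) - (f x - f x')); last by lra.
  have h1 := rf y xy Ky; have h2 := rf x' xx' Kx'.
  rewrite (le_trans (ler_normB _ _))//; lra.
move=> KP; near (0 : R)^'+ => d.
have d0 : 0 < d by [].
exists d => // x y Kx Ky xy.
have /(_ x Kx) : K `<=` P d by near: d.
exact.
Unshelve. all: by end_near. Qed.

Lemma row_norm_le (R : realType) n (v : 'rV[R]_n) (e : R) : 0 <= e ->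
  (forall i, `|v ord0 i| <= e) -> `|v| <= e.
Proof.
move=> e0 ve; rewrite [leLHS]mx_normrE; apply: bigmax_le => // -[i j] _ /=.
by rewrite (ord1 i).
Qed.

Lemma coord_norm_le (R : realType) n (v : 'rV[R]_n) i : `|v ord0 i| <= `|v|.
Proof.
rewrite [leRHS]mx_normrE; exact: (@le_bigmax _ _ _ _ (fun ij => `|v ij.1 ij.2|) (ord0, i)).
Qed.

Section borel_sets.
Variable V : topologicalType.

Lemma borel_fun_sigma d (T : measurableType d) (q : T -> V) (B : set V) :
  borel_fun q -> <<s @open V >> B -> measurable (q @^-1` B).
Proof.
move=> bq; move: B; apply: smallest_sub => [|U oU]; last exact: bq.
split; first by rewrite /= preimage_set0.
- by move=> B /= mB; rewrite setTD preimage_setC; exact: measurableC.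
- by move=> F mF /=; rewrite preimage_bigcup; exact: bigcupT_measurable.
Qed.

End borel_sets.

(** Finitely many balls of radius [e / 2] cover [K]; a point is labelled by the first ball that
    contains it. *)
Lemma small_partition (R : realType) (V : pseudoMetricNormedZmodType R)
    (K : set V) (e : R) : compact K -> 0 < e ->
  exists m (J : V -> 'I_m.+1), (forall k, <<s @open V >> (J @^-1` [set k])) /\
    forall x y, K x -> K y -> J x = J y -> `|x - y| <= e.
Proof.
move=> cK e0.
pose p (y c : V) := `[< ball c (e / 2) y >].
have e20 : 0 < e / 2 by rewrite divr_gt0.
have [s sK] : exists s : seq V, forall y, K y -> has (p y) s.
  pose W : ptopologicalType := HB.pack V (isPointed.Build V 0).
  have : @compact W K by [].
  rewrite compact_cover => /(_ _ K (fun c => ball c (e / 2)))[||D _ KD].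
  - by move=> c _; exact: ball_open.
  - by move=> y Ky; exists y => //; exact: ballxx.
  - exists (enum_fset D) => y /KD[c Dc cy]; apply/hasP; exists c => //.
    exact/asboolP.
have [SC0 SCC SCU] := smallest_sigma_algebra setT (@open V).
have mC B : <<s @open V >> B -> <<s @open V >> (~` B).
  by move=> mB; rewrite -setTD; exact: SCC.
have mU B B' : <<s @open V >> B -> <<s @open V >> B' -> <<s @open V >> (B `|` B').
  move=> mB mB'; rewrite -bigcup2E; apply: SCU => -[|[|i]] //=.
have mI B B' : <<s @open V >> B -> <<s @open V >> B' -> <<s @open V >> (B `&` B').
  move=> mB mB'; have -> : B `&` B' = ~` (~` B `|` ~` B') by rewrite setCU !setCK.
  by apply: (mC (_ `|` _)); apply: mU; exact: mC.
have mfind k : <<s @open V >> [set y | find (p y) s = k].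
  elim: s k {sK} => [k|c s ih k] /=.
    have [->|k0] := eqVneq k 0%N.
      rewrite (_ : [set _ | _] = setT); last by rewrite -subTset => y.
      by have := SCC _ SC0; rewrite setD0.
    rewrite (_ : [set _ | _] = set0)//; apply/seteqP; split => // y /= k0'.
    by rewrite -k0' in k0.
  have mc : <<s @open V >> (ball c (e / 2)) by apply: sub_sigma_algebra; exact: ball_open.
  case: k => [|k].
    rewrite (_ : [set _ | _] = ball c (e / 2))//.
    apply/seteqP; split => y /=; rewrite /p; first by case: asboolP.
    by move=> cy; rewrite asboolT.
  rewrite (_ : [set _ | _] = ~` ball c (e / 2) `&` [set y | find (p y) s = k]).
    by apply: mI => //; exact: mC.
  apply/seteqP; split => y /=; rewrite /p; first by case: asboolP => // cy [].
  by move=> [cy <-]; rewrite asboolF.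
(* A point outside all balls gets the label [size s], hence one cell more than there are balls. *)
exists (size s), (fun y => inord (find (p y) s)); split.
  move=> k; rewrite (_ : _ @^-1` _ = [set y | find (p y) s = k])//.
  apply/seteqP; split => y /=; last by move=> ->; rewrite inord_val.
  by move=> <-; rewrite inordK// ltnS find_size.
move=> x y Kx Ky /(congr1 val) /=; rewrite !inordK ?ltnS ?find_size// => xy.
have := nth_find 0 (sK _ Kx); have := nth_find 0 (sK _ Ky).
rewrite -xy /p => /asboolP yc /asboolP xc.
have : ball x (e / 2 + e / 2) y by apply: ball_triangle yc; exact: ball_sym.
by rewrite -splitr -ball_normE => /ltW.
Qed.

(** * The martingale inequality *)

Section weighted_mean.
Context d (T : measurableType d) (R : realType) (P : probability T R).
Implicit Types psi h : T -> R.
Local Notation bm := bounded_measurable.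

(** The bound on [h] is required only where [psi] lives, and only if [psi] has positive mass: in the
    applications [psi] is the indicator of a cell, and a null cell has no meaningful barycentre to
    compare with. *)
Lemma weighted_mean_le psi h r : bm psi -> bm h -> (forall t, 0 <= psi t) ->
  (mean P psi != 0 -> forall t, psi t != 0 -> h t <= r) ->
  mean P (fun t => psi t * h t) <= mean P psi * r.
Proof.
move=> bpsi bh psi0 hr; have [p0|p0] := eqVneq (mean P psi) 0; last first.
  rewrite mulrC -meanZ//; apply: le_mean; [exact: bmM|by apply: bmM => //; exact: bm_cst|].
  move=> t; rewrite mulrC; have [->|pt0] := eqVneq (psi t) 0; first by rewrite !mulr0.
  by rewrite ler_wpM2r// hr.
case: (bh) => _ [M hM]; rewrite p0 mul0r -(mulr0 M) -p0 -meanZ//.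
apply: le_mean; [exact: bmM|by apply: bmM => //; exact: bm_cst|].
by move=> t; rewrite mulrC ler_wpM2r// (le_trans _ (hM t))// ler_norm.
Qed.

Lemma weighted_mean_ge psi h r : bm psi -> bm h -> (forall t, 0 <= psi t) ->
  (mean P psi != 0 -> forall t, psi t != 0 -> r <= h t) ->
  mean P psi * r <= mean P (fun t => psi t * h t).
Proof.
move=> bpsi bh psi0 hr.
have := @weighted_mean_le psi (fun t => - h t) (- r) bpsi (bmN bh) psi0.
have -> : (fun t => psi t * - h t) = (fun t => - (psi t * h t)).
  by apply/funext => t; rewrite mulrN.
rewrite meanN; last exact: bmM.
by rewrite mulrN lerN2; apply => p0 t pt0; rewrite lerN2 hr.
Qed.

Lemma weighted_mean_eq0 psi h : bm psi -> bm h -> (forall t, 0 <= psi t) ->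
  mean P psi = 0 -> mean P (fun t => psi t * h t) = 0.
Proof.
move=> bpsi bh psi0 p0; apply/eqP; rewrite eq_le.
have := @weighted_mean_le psi h 0 bpsi bh psi0; rewrite p0 mul0r => -> /=; last by rewrite eqxx.
have := @weighted_mean_ge psi h 0 bpsi bh psi0; rewrite p0 mul0r => -> //.
by rewrite eqxx.
Qed.

End weighted_mean.

Section partition_indicators.
Context d (T : measurableType d) (R : realType) (V : topologicalType).

Lemma bm_indic_borel (Z : T -> V) (B : set V) : borel_fun Z ->
  <<s @open V >> B -> bounded_measurable (fun t => \1_B (Z t) : R).
Proof.
move=> bZ mB; rewrite (_ : (fun t => _) = \1_(Z @^-1` B)).
  by apply: bm_indic; exact: borel_fun_sigma bZ mB.
by apply/funext => t; rewrite !indicE; congr (_%:R); apply/idP/idP; rewrite !inE.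
Qed.

Lemma sum_indic_fiber m (J : V -> 'I_m) (F : 'I_m -> R) x :
  \sum_k \1_(J @^-1` [set k]) x * F k = F (J x).
Proof.
rewrite (bigD1 (J x))//= big1 ?addr0 => [|k /negPf kJ].
  by rewrite indicE mem_set// mul1r.
by rewrite indicE memNset ?mul0r// => /= Jk; rewrite Jk eqxx in kJ.
Qed.

Lemma indic_fiber_neq0 m (J : V -> 'I_m) k x :
  (\1_(J @^-1` [set k]) x : R) != 0 -> J x = k.
Proof.
rewrite indicE; case: (boolP (x \in _)) => [/set_mem //|_].
by rewrite eqxx.
Qed.

End partition_indicators.

Section barycentre.
Context d (T : measurableType d) (R : realType) (P : probability T R).
Context n (K : set 'rV[R]_n).
Hypotheses (cK : compact K) (vK : convex_set K).
Local Notation bm := bounded_measurable.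

Lemma bm_coord (Z : T -> 'rV[R]_n) i : borel_fun Z -> (forall t, K (Z t)) ->
  bm (fun t => Z t ord0 i).
Proof.
move=> bZ KZ.
apply: (@borel_fun_bm _ _ _ _ Z K (fun v : 'rV[R]_n => v ord0 i) cK bZ KZ).
by apply: continuous_subspaceT; exact: coord_continuous.
Qed.

Definition barycentre (psi : T -> R) (Z : T -> 'rV[R]_n) : 'rV[R]_n :=
  \row_i ((mean P psi)^-1 * mean P (fun t => psi t * Z t ord0 i)).

Variables (psi : T -> R) (Z : T -> 'rV[R]_n).
Hypotheses (bpsi : bm psi) (psi0 : forall t, 0 <= psi t) (p0 : 0 < mean P psi).
Hypotheses (bZ : borel_fun Z) (KZ : forall t, K (Z t)).

Lemma barycentre_near (e : R) (G : T -> 'rV[R]_n) (x : 'rV[R]_n) :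
  0 <= e -> (forall i, bm (fun t => G t ord0 i)) ->
  (forall i, x ord0 i = (mean P psi)^-1 * mean P (fun t => psi t * G t ord0 i)) ->
  (forall t, psi t != 0 -> `|Z t - G t| <= e) -> `|barycentre psi Z - x| <= e.
Proof.
move=> e0 bG xG ZG; apply: row_norm_le => // i.
rewrite !mxE xG -mulrBr -meanB; [|by apply: bmM => //; exact: bm_coord|exact: bmM].
rewrite (_ : (fun t => _ - _) = fun t => psi t * (Z t ord0 i - G t ord0 i)); last first.
  by apply/funext => t; rewrite mulrBr.
have bZG : bm (fun t => Z t ord0 i - G t ord0 i) by apply: bmB => //; exact: bm_coord.
have ZGi t : psi t != 0 -> - e <= Z t ord0 i - G t ord0 i <= e.
  move=> pt0; rewrite -ler_norml; apply: le_trans (ZG t pt0).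
  by have := coord_norm_le (Z t - G t) i; rewrite !mxE.
have h1 : mean P psi * - e <= mean P (fun t => psi t * (Z t ord0 i - G t ord0 i)).
  by apply: weighted_mean_ge => // _ t /ZGi /andP[].
have h2 : mean P (fun t => psi t * (Z t ord0 i - G t ord0 i)) <= mean P psi * e.
  by apply: weighted_mean_le => // _ t /ZGi /andP[].
by rewrite ler_norml ler_pdivlMl// h1 ler_pdivrMl.
Qed.

Lemma barycentre_dist (e : R) (x : 'rV[R]_n) : 0 <= e ->
  (forall t, psi t != 0 -> `|Z t - x| <= e) -> `|barycentre psi Z - x| <= e.
Proof.
move=> e0 Zx; apply: (@barycentre_near e (fun=> x)) => // i; first exact: bm_cst.
rewrite (_ : (fun t => psi t * _) = fun t => x ord0 i * psi t); last first.
  by apply/funext => t; rewrite mulrC.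
by rewrite meanZ// mulrCA mulVf ?mulr1// gt_eqF.
Qed.

(** If [Z] is replaced by a representative of its cell, the barycentre becomes a finite convex
    combination of points of [K] and moves by at most the cell size; [K] is closed. *)
Lemma barycentre_mem : K (barycentre psi Z).
Proof.
apply: (compact_closed (@norm_hausdorff _ _) cK) => B /nbhs_ballP[e /= e0 eB].
have e20 : 0 < e / 2 by rewrite divr_gt0.
have [m [J [mJ JK]]] := small_partition cK e20.
have /choice[a aP] : forall k : 'I_m.+1, exists a, K a /\ forall x, K x -> J x = k -> J a = k.
  move=> k; have [[x [Kx Jx]]|nx] := pselect (exists x, K x /\ J x = k).
    by exists x.
  by exists (Z point); split => // x Kx Jx; exfalso; apply: nx; exists x.
have bw k : bm (fun t => psi t * \1_(J @^-1` [set k]) (Z t)).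
  by apply: bmM => //; exact: bm_indic_borel.
pose w k := mean P (fun t => psi t * \1_(J @^-1` [set k]) (Z t)).
pose y := \sum_k ((mean P psi)^-1 * w k) *: a k.
have sumw (F : 'I_m.+1 -> R) :
    \sum_k w k * F k = mean P (fun t => psi t * F (J (Z t))).
  rewrite (eq_bigr (fun k => mean P (fun t => F k * (psi t * \1_(J @^-1` [set k]) (Z t))))).
    rewrite -mean_sum; last by move=> k; apply: bmM => //; exact: bm_cst.
    congr mean; apply/funext => t; rewrite -(sum_indic_fiber J F) mulr_sumr.
    by apply: eq_bigr => k _; rewrite mulrCA [F k * _]mulrC.
  by move=> k _; rewrite meanZ// mulrC.
have Ky : K y.
  apply: convex_set_sum => //.
  - by move=> x1 x2 t K1 K2 t01; exact: convex_setE.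
  - move=> k; rewrite mulr_ge0 ?invr_ge0 ?(ltW p0)// mean_ge0// => t.
    by rewrite mulr_ge0// indicE.
  - rewrite -mulr_sumr (_ : \sum_k w k = mean P psi) ?mulVf ?gt_eqF//.
    transitivity (\sum_k w k * 1); first by apply: eq_bigr => k _; rewrite mulr1.
    by rewrite (sumw (fun=> 1)); congr mean; apply/funext => t; rewrite mulr1.
  - by move=> k; have [] := aP k.
exists y; split => //; apply: eB.
suff : `|barycentre psi Z - y| <= e / 2.
  by move=> zy; rewrite -ball_normE /=; apply: le_lt_trans zy _; lra.
apply: (@barycentre_near _ (fun t => a (J (Z t)))); first exact: ltW.
- move=> i; rewrite (_ : (fun t => _) = fun t =>
      \sum_k \1_(J @^-1` [set k]) (Z t) * a k ord0 i); last first.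
    by apply/funext => t; rewrite (sum_indic_fiber J (fun k => a k ord0 i)).
  apply: bm_sum => k; apply: bmM; last exact: bm_cst.
  exact: bm_indic_borel.
- move=> i; rewrite -(sumw (fun k => a k ord0 i)) mulr_sumr summxE.
  by apply: eq_bigr => k _; rewrite mxE mulrA.
- move=> t _; have [Ka aJ] := aP (J (Z t)).
  by apply: JK => //; rewrite (aJ (Z t)).
Qed.

End barycentre.

Section joint_continuous.
Context d (T : measurableType d) (R : realType) n (K : set 'rV[R]_n).
Variables (c : 'rV[R]_n * 'rV[R]_n -> R) (X Y : T -> 'rV[R]_n).
Hypotheses (cK : compact K) (cc : {within K `*` K, continuous c}).
Hypotheses (bX : borel_fun X) (bY : borel_fun Y).
Hypotheses (KX : forall t, K (X t)) (KY : forall t, K (Y t)).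

Lemma uniform_continuity2 (e : R) : 0 < e -> exists2 d, 0 < d &
  forall x x' y y', K x -> K x' -> K y -> K y' -> `|x - x'| <= d -> `|y - y'| <= d ->
    `|c (x, y) - c (x', y')| <= e.
Proof.
move=> e0; have [d1 d10 cd] := compact_uniform_continuity (compact_setX cK cK) cc e0.
exists (d1 / 2); first by rewrite divr_gt0.
move=> x x' y y' Kx Kx' Ky Ky' xx' yy'; apply: cd => //.
by split; rewrite /= -ball_normE /=; [apply: le_lt_trans xx' _|apply: le_lt_trans yy' _]; lra.
Qed.

(** [X] and [Y] are only known to be Borel separately. Measurability passes through uniform
    approximation of [c] by functions that are constant on products of cells. *)
Lemma bm_joint : bounded_measurable (fun t => c (X t, Y t)).
Proof.
split; last first.
  have [M [_ cM]] : exists M : R, M \is Num.real /\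
      forall r, M < r -> forall y, (c @` (K `*` K)) y -> `|y| <= r.
    exact: (compact_bounded (continuous_compact cc (compact_setX cK cK))).
  by exists (M + 1) => t; apply: (cM (M + 1)); [rewrite ltrDl|exists (X t, Y t) => //; split => /=].
have approx k : exists s : T -> R, measurable_fun setT s /\
    forall t, `|c (X t, Y t) - s t| <= k.+1%:R^-1.
  have e0 : (0 : R) < k.+1%:R^-1 by rewrite invr_gt0.
  have [d1 d10 cd] := uniform_continuity2 e0.
  have [m [J [mJ JK]]] := small_partition cK d10.
  have /choice[a aP] : forall k : 'I_m.+1, exists a,
      K a /\ forall x, K x -> J x = k -> J a = k.
    move=> i; have [[x [Kx Jx]]|nx] := pselect (exists x, K x /\ J x = i).
      by exists x.
    by exists (X point); split => // x Kx Jx; exfalso; apply: nx; exists x.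
  exists (fun t => c (a (J (X t)), a (J (Y t)))); split.
    rewrite (_ : (fun t => _) = fun t => \sum_i \1_(J @^-1` [set i]) (X t) *
        \sum_j \1_(J @^-1` [set j]) (Y t) * c (a i, a j)).
      suff [] : bounded_measurable (fun t => \sum_i \1_(J @^-1` [set i]) (X t) *
        \sum_j \1_(J @^-1` [set j]) (Y t) * c (a i, a j)) by [].
      apply: bm_sum => i; apply: bmM; first exact: bm_indic_borel.
      by apply: bm_sum => j; apply: bmM; [exact: bm_indic_borel|exact: bm_cst].
    apply/funext => t.
    rewrite (sum_indic_fiber J (fun i => \sum_j \1_(J @^-1` [set j]) (Y t) * c (a i, a j))).
    by rewrite (sum_indic_fiber J (fun j => c (a _, a j))).
  move=> t; have [Ka1 aJ1] := aP (J (X t)); have [Ka2 aJ2] := aP (J (Y t)).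
  apply: cd => //; apply: JK => //; first by rewrite (aJ1 (X t)).
  by rewrite (aJ2 (Y t)).
have /choice[s sP] := approx.
apply: (@measurable_fun_cvg _ _ _ _ s); first by move=> k; have [] := sP k.
move=> t _; apply/cvgrPdist_le => e e0.
near=> k; have [_ sk] := sP k; apply: (le_trans (sk t)).
apply: ltW; near: k; exact: (near_infty_natSinv_lt (PosNum e0)).
Unshelve. all: by end_near. Qed.

End joint_continuous.

(* Averaging over the cells of a fine partition of [K * K] turns the martingale
   into finitely many barycentre identities, to which the finite inequality
   applies. *)
Theorem martingale_inequality d (T : measurableType d) (R : realType)
    (P : probability T R) n (K : set 'rV[R]_n) (cK : compact K) (vK : convex_set K)
    (X Y : T -> 'rV[R]_n) (bX : borel_fun X) (bY : borel_fun Y)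
    (KX : forall t, K (X t)) (KY : forall t, K (Y t))
    (XY : forall i B, <<s @open 'rV[R]_n >> B ->
      mean P (fun t => \1_B (X t) * X t ord0 i) = mean P (fun t => \1_B (X t) * Y t ord0 i))
    (f1 f2 : 'rV[R]_n -> R) (c : 'rV[R]_n * 'rV[R]_n -> R)
    (cf1 : {within K, continuous f1}) (cf2 : {within K, continuous f2})
    (cc : {within K `*` K, continuous c})
    (f12 : forall (l : 'I_n.+1 -> R) (x : 'I_n.+1 -> 'rV[R]_n),
      (forall i, 0 <= l i) -> \sum_i l i = 1 -> (forall i, K (x i)) ->
      f1 (\sum_i l i *: x i) - \sum_i l i * f2 (x i) <=
        \sum_i l i * c (\sum_j l j *: x j, x i)) :
  mean P (f1 \o X) - mean P (f2 \o Y) <= mean P (fun t => c (X t, Y t)).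
Proof.
have bmc := bm_joint cK cc bX bY KX KY.
have bmf1 : bounded_measurable (f1 \o X) by exact: borel_fun_bm cK _ _ cf1.
have bmf2 : bounded_measurable (f2 \o Y) by exact: borel_fun_bm cK _ _ cf2.
(* One [e] each for the oscillation of [f1], [f2] and [c] on the cells. *)
suff main e : 0 < e -> mean P (f1 \o X) - mean P (f2 \o Y) <=
    mean P (fun t => c (X t, Y t)) + 3 * e.
  apply/ler_addgt0Pr => e e0.
  by rewrite (_ : e = 3 * (e / 3)); [apply: main; rewrite divr_gt0|field].
move=> e0.
have [d1 d10 f1d] := compact_uniform_continuity cK cf1 e0.
have [d2 d20 f2d] := compact_uniform_continuity cK cf2 e0.
have [d3 d30 cd] := uniform_continuity2 cK cc e0.
(* Halving [d1] and [d2] turns the weak distance bounds of the partition into membership in open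
   balls; [d3] already comes with weak bounds. *)
pose del := Num.min (d1 / 2) (Num.min (d2 / 2) d3).
have del0 : 0 < del by rewrite !lt_min d30 !divr_gt0.
have [m [J [mJ JK]]] := small_partition cK del0.
pose u j t : R := \1_(J @^-1` [set j]) (X t).
pose v k t : R := \1_(J @^-1` [set k]) (Y t).
have bu j : bounded_measurable (u j) by exact: bm_indic_borel.
have bv k : bounded_measurable (v k) by exact: bm_indic_borel.
have buv j k : bounded_measurable (fun t => u j t * v k t) by exact: bmM.
have u0 j t : 0 <= u j t by rewrite /u indicE.
have uv0 j k t : 0 <= u j t * v k t by rewrite mulr_ge0// /v indicE.
pose U j := mean P (u j).
pose w j k := mean P (fun t => u j t * v k t).
have U0 j : 0 <= U j by exact: mean_ge0.
have w0 j k : 0 <= w j k by exact: mean_ge0.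
have sumv (h : T -> R) j : bounded_measurable h ->
    \sum_k mean P (fun t => (u j t * v k t) * h t) = mean P (fun t => u j t * h t).
  move=> bh; rewrite -mean_sum; last by move=> k; exact: bmM.
  congr mean; apply/funext => t.
  rewrite -(sum_indic_fiber J (fun=> u j t * h t) (Y t)).
  by apply: eq_bigr => k _; rewrite /v; ring.
have sumu (h : T -> R) : bounded_measurable h ->
    \sum_j mean P (fun t => u j t * h t) = mean P h.
  move=> bh; rewrite -mean_sum; last by move=> k; exact: bmM.
  congr mean; apply/funext => t.
  exact: (sum_indic_fiber J (fun=> h t) (X t)).
have sumw j : \sum_k w j k = U j.
  transitivity (\sum_k mean P (fun t => (u j t * v k t) * 1)).
    by apply: eq_bigr => k _; congr mean; apply/funext => t; rewrite mulr1.
  rewrite (sumv (fun=> 1)); last exact: bm_cst.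
  by congr mean; apply/funext => t; rewrite mulr1.
have sumU : \sum_j U j = 1.
  transitivity (\sum_j mean P (fun t => u j t * 1)).
    by apply: eq_bigr => k _; congr mean; apply/funext => t; rewrite mulr1.
  by rewrite (sumu (fun=> 1)); [exact: mean_cst|exact: bm_cst].
have Upos j : U j != 0 -> 0 < mean P (u j).
  by move=> Uj; rewrite lt_neqAle eq_sym Uj; exact: U0.
have wpos j k : w j k != 0 -> 0 < mean P (fun t => u j t * v k t).
  by move=> wjk; rewrite lt_neqAle eq_sym wjk; exact: w0.
(* On null cells any point of [K] will do, as its weight in the sums below is zero. *)
pose xb j := if U j == 0 then X point else barycentre P (u j) X.
pose yb j k := if w j k == 0 then Y point else
  barycentre P (fun t => u j t * v k t) Y.
have Kxb j : K (xb j).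
  rewrite /xb; case: ifPn => // Uj; apply: barycentre_mem => //; exact: Upos.
have Kyb j k : K (yb j k).
  rewrite /yb; case: ifPn => // wjk; apply: barycentre_mem => //; exact: wpos.
have xbX j t : U j != 0 -> u j t != 0 -> `|X t - xb j| <= del.
  move=> Uj ujt; rewrite /xb (negPf Uj) distrC.
  apply: (barycentre_dist cK) => //; [exact: Upos|exact: ltW|].
  move=> s /indic_fiber_neq0 Js; apply: JK => //.
  by rewrite Js (indic_fiber_neq0 ujt).
have ybY j k t : w j k != 0 -> u j t * v k t != 0 -> `|Y t - yb j k| <= del.
  move=> wjk ujt; rewrite /yb (negPf wjk) distrC.
  apply: (barycentre_dist cK) => //; [exact: wpos|exact: ltW|].
  move: ujt; rewrite mulf_eq0 negb_or => /andP[_ /indic_fiber_neq0 Jt].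
  move=> s; rewrite mulf_eq0 negb_or => /andP[_ /indic_fiber_neq0 Js].
  by apply: JK => //; rewrite Js Jt.
have w_le_U j k : U j = 0 -> w j k = 0.
  move=> Uj; exact: weighted_mean_eq0.
(* By the martingale property the points [yb j k] with weights [w j k / U j] have barycentre [xb j].
   Their number is that of the cells, so Caratheodory's theorem is needed to apply [f12]. *)
have cell j : U j * f1 (xb j) <=
    \sum_k w j k * (f2 (yb j k) + c (xb j, yb j k)).
  have [Uj|Uj] := eqVneq (U j) 0.
    by rewrite Uj mul0r big1// => k _; rewrite w_le_U// mul0r.
  have Uj0 : 0 < U j := Upos _ Uj.
  rewrite -ler_pdivlMl// mulr_sumr.
  under eq_bigr do rewrite mulrA.
  apply: (@caratheodory _ _ K (fun y => f2 y + c (xb j, y)) (xb j)) => //.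
  - move=> l x l0 l1 Kx lx; have := f12 l x l0 l1 Kx; rewrite lx lerBlDl.
    move=> /le_trans; apply; rewrite -big_split/=.
    by under [leRHS]eq_bigr do rewrite mulrDr.
  - by move=> k; rewrite mulr_ge0// invr_ge0 ltW.
  - by rewrite -mulr_sumr sumw mulVf.
  - apply/rowP => i; rewrite summxE /xb (negPf Uj) mxE.
    rewrite XY// -(sumv (fun t => Y t ord0 i)); last exact: (bm_coord cK).
    rewrite mulr_sumr; apply: eq_bigr => k _; rewrite mxE -mulrA; congr (_ * _).
    rewrite /yb; have [wjk|wjk] := eqVneq (w j k) 0.
      by rewrite wjk mul0r weighted_mean_eq0//; exact: (bm_coord cK).
    by rewrite mxE mulrA divff// mul1r.
have le1 : mean P (f1 \o X) <= \sum_j U j * f1 (xb j) + e.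
  rewrite -[X in _ + X]mul1r -sumU mulr_suml -big_split/= -sumu//.
  apply: ler_sum => j _; rewrite -mulrDr.
  apply: weighted_mean_le => // Uj t ujt.
  have xt := xbX _ _ Uj ujt.
  have : `|f1 (X t) - f1 (xb j)| <= e.
    apply: f1d => //; rewrite -ball_normE /=; apply: le_lt_trans xt _.
    by apply: (@le_lt_trans _ _ (d1 / 2)); [rewrite ge_min lexx|lra].
  by rewrite ler_norml /= => /andP[]; lra.
have le2 : \sum_j \sum_k w j k * (f2 (yb j k) + c (xb j, yb j k)) <=
    mean P (fun t => f2 (Y t) + c (X t, Y t)) + 2 * e.
  have bh : bounded_measurable (fun t => f2 (Y t) + c (X t, Y t)) by exact: bmD.
  have [e2 e2E] : exists e2, e2 = 2 * e by exists (2 * e).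
  rewrite -e2E -[X in _ + X]mul1r -sumU mulr_suml -sumu// -big_split/=.
  apply: ler_sum => j _; rewrite -sumw mulr_suml -sumv// -big_split/=.
  apply: ler_sum => k _; rewrite -lerBlDr -mulrBr.
  apply: weighted_mean_ge => // wjk t ujt.
  have Uj : U j != 0 by apply: contra_neq wjk; exact: w_le_U.
  have ujt' : u j t != 0 by apply: contra_neq ujt => ->; rewrite mul0r.
  have xt := xbX _ _ Uj ujt'; have yt := ybY _ _ _ wjk ujt.
  have h2 : `|f2 (Y t) - f2 (yb j k)| <= e.
    apply: f2d => //; rewrite -ball_normE /=; apply: le_lt_trans yt _.
    by apply: (@le_lt_trans _ _ (d2 / 2)); [rewrite !ge_min lexx orbT|lra].
  have h3 : `|c (X t, Y t) - c (xb j, yb j k)| <= e.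
    apply: cd => //; [apply: le_trans xt _|apply: le_trans yt _];
      by rewrite !ge_min lexx !orbT.
  move: h2 h3; rewrite !ler_norml => /andP[? ?] /andP[? ?]; lra.
have := ler_sum (index_enum _) (fun j (_ : xpredT j) => cell j) => le3.
have -> : mean P (fun t => c (X t, Y t)) =
    mean P (fun t => f2 (Y t) + c (X t, Y t)) - mean P (f2 \o Y).
  by rewrite meanD//; rewrite addrAC subrr add0r.
lra.
Qed.

Lemma mean_cvg d (T : measurableType d) (R : realType) (P : probability T R)
    (h_ : nat -> T -> R) (h : T -> R) (M : R) :
  (forall k, measurable_fun setT (h_ k)) -> (forall k t, `|h_ k t| <= M) ->
  (forall t, h_ k t @[k --> \oo] --> h t) ->
  mean P (h_ k) @[k --> \oo] --> mean P h.
Proof.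
move=> mh hM hh.
have bh k : bounded_measurable (h_ k) by split => //; exists M.
have bmh : bounded_measurable h.
  split; first by apply: (measurable_fun_cvg mh) => t _; exact: hh.
  exists M => t; have ch := hh t.
  have cn : `|h_ k t| @[k --> \oo] --> `|h t| by apply: cvg_norm.
  rewrite -(cvg_lim _ cn)//; apply: limr_le; first by apply/cvg_ex; exists `|h t|.
  exact: nearW.
have H : (\int[P]_x (h_ k x)%:E)%E @[k --> \oo] --> (\int[P]_x (h x)%:E)%E.
  apply: (@dominated_cvg _ _ _ P setT measurableT _ _ (cst M%:E)) => //.
  - by move=> k; apply/measurable_EFinP.
  - by move=> t _; apply: cvg_EFin; [exact: nearW|exact: hh].
  - exact: bm_integrable (bm_cst T M).
  - by move=> k t _; rewrite /= lee_fin.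
rewrite (meanE P bmh) in H; exact: fine_cvg H.
Qed.

(** * Determination of laws by continuous functions *)

Section open_approximation.
Variables (R : realType) (V : pseudoMetricNormedZmodType R) (U : set V).

Let dist (x : V) : R := inf [set `|x - y| | y in ~` U].

Let dist_lb x : has_lbound [set `|x - y| | y in ~` U].
Proof. by exists 0 => _ [y _ <-]. Qed.

Lemma open_approximation : open U -> exists g : nat -> V -> R,
  [/\ forall k, continuous (g k), forall k x, 0 <= g k x <= 1 &
    forall x, g k x @[k --> \oo] --> (\1_U x : R)].
Proof.
(* If [U] is everything, the distance to its complement would be an infimum over the empty set.
   Otherwise the approximations are the truncations [Num.min 1 (k%:R * dist x)]. *)
move=> oU; have [[y0 Uy0]|U0] := pselect (exists y, ~ U y); last first.
  exists (fun _ _ => 1); split => [k|k x|x].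
  - exact: cst_continuous.
  - by rewrite ler01 lexx.
  - rewrite indicE mem_set; first exact: cvg_cst.
    by apply: contrapT => Ux; apply: U0; exists x.
have dist0 x : has_inf [set `|x - y| | y in ~` U].
  by split; [exists `|x - y0|, y0|exact: dist_lb].
have dist_ge0 x : 0 <= dist x.
  by apply: lb_le_inf; [exact: (dist0 x).1|move=> _ [y _ <-]].
have dist_lip x x' : dist x <= dist x' + `|x - x'|.
  rewrite -lerBlDr; apply: lb_le_inf; first exact: (dist0 x').1.
  move=> _ [y Uy <-]; rewrite lerBlDr.
  apply: (@le_trans _ _ `|x - y|); first by apply: ge_inf => //; exists y.
  by have := ler_normD (x - x') (x' - y); rewrite addrA subrK [leRHS]addrC.
have dist_cont : continuous dist.
  move=> x; apply/cvgrPdist_le => e e0; near=> x'.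
  have xx' : `|x - x'| <= e by near: x'; apply: cvgr_dist_le.
  have := dist_lip x x'; have := dist_lip x' x; rewrite distrC => h1 h2.
  by rewrite ler_norml; apply/andP; split; lra.
exists (fun k x => Num.min 1 (k%:R * dist x)); split => [k|k x|x].
- move=> x; apply: (@continuous_min R V (fun=> 1) (fun x => k%:R * dist x)).
    exact: cst_continuous.
  by apply: cvgM; [exact: cvg_cst|exact: dist_cont].
- by rewrite le_min ler01 mulr_ge0//= ge_min lexx.
- rewrite indicE; have [Ux|Ux] := boolP (x \in U).
    have [r r0 rU] : exists2 r, 0 < r & ball x r `<=` U.
      by have /nbhs_ballP[r /= r0 rU] := open_nbhs_nbhs (conj oU (set_mem Ux)); exists r.
    have dr : r <= dist x.
      apply: lb_le_inf; first exact: (dist0 x).1.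
      move=> _ [y Uy <-]; rewrite leNgt; apply/negP => xyr; apply: Uy; apply: rU.
      by rewrite -ball_normE.
    apply: cvg_near_cst; near=> k; apply: min_l.
    apply: (@le_trans _ _ (k%:R * r)); last by rewrite ler_wpM2l.
    rewrite -ler_pdivrMr// mul1r; near: k; exact: nbhs_infty_ger.
  have -> : dist x = 0.
    apply/eqP; rewrite eq_le dist_ge0 andbT; apply: ge_inf => //.
    by exists x; [move/negP: Ux; rewrite inE|rewrite subrr normr0].
  under eq_fun do rewrite mulr0 min_r//.
  exact: cvg_cst.
Unshelve. all: by end_near. Qed.

End open_approximation.

Section monotone_class.
Variables (R : realType) (V : pseudoMetricNormedZmodType R).
Context d1 (T1 : measurableType d1) (P1 : probability T1 R).
Context d2 (T2 : measurableType d2) (P2 : probability T2 R).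
Variables (Z1 : T1 -> V) (Z2 : T2 -> V) (W1 : T1 -> R) (W2 : T2 -> R).
Hypotheses (bZ1 : borel_fun Z1) (bZ2 : borel_fun Z2).
Hypotheses (bW1 : bounded_measurable W1) (bW2 : bounded_measurable W2).
Hypothesis eqZW : forall g : V -> R, continuous g -> (forall x, 0 <= g x <= 1) ->
  mean P1 (fun t => g (Z1 t) * W1 t) = mean P2 (fun t => g (Z2 t) * W2 t).

Let limit_eq (g : nat -> V -> R) (B : set V) :
  (forall k, measurable_fun setT (g k \o Z1)) ->
  (forall k, measurable_fun setT (g k \o Z2)) ->
  (forall k x, 0 <= g k x <= 1) ->
  (forall x, g k x @[k --> \oo] --> (\1_B x : R)) ->
  (forall k, mean P1 (fun t => g k (Z1 t) * W1 t) = mean P2 (fun t => g k (Z2 t) * W2 t)) ->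
  mean P1 (fun t => \1_B (Z1 t) * W1 t) = mean P2 (fun t => \1_B (Z2 t) * W2 t).
Proof.
move=> mg1 mg2 g01 gB gE.
have cvgW d (T : measurableType d) (P : probability T R) (Z : T -> V) (W : T -> R) :
    bounded_measurable W -> (forall k, measurable_fun setT (g k \o Z)) ->
    mean P (fun t => g k (Z t) * W t) @[k --> \oo] --> mean P (fun t => \1_B (Z t) * W t).
  move=> [mW [M WM]] mgZ; apply: (@mean_cvg _ _ _ _ _ _ M).
  - by move=> k; apply: measurable_funM => //; exact: mgZ.
  - move=> k t; have /andP[g0 g1] := g01 k (Z t).
    by rewrite normrM ger0_norm// (le_trans _ (WM t))// ler_piMl.
  - by move=> t; apply: cvgM; [exact: gB|exact: cvg_cst].
have H1 := cvgW _ _ P1 _ _ bW1 mg1; have H2 := cvgW _ _ P2 _ _ bW2 mg2.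
have e : (fun k => mean P1 (fun t => g k (Z1 t) * W1 t)) =
    (fun k => mean P2 (fun t => g k (Z2 t) * W2 t)) by apply/funext.
by rewrite e in H1; exact: (cvg_unique _ H1 H2).
Qed.

(** Dynkin's theorem from the pi-system of open sets, whose indicators are limits of continuous
    functions. The weights may be signed: weight 1 identifies laws, and coordinates as weights give
    the martingale property. *)
Theorem borel_mean_unique (B : set V) : <<s @open V >> B ->
  mean P1 (fun t => \1_B (Z1 t) * W1 t) = mean P2 (fun t => \1_B (Z2 t) * W2 t).
Proof.
pose V' : ptopologicalType := HB.pack V (isPointed.Build V 0).
pose M := g_sigma_algebraType (@open V').
have bind d (T : measurableType d) (Z : T -> V) (S : set V) : borel_fun Z ->
    <<s @open V >> S -> measurable_fun setT (\1_S \o Z : T -> R).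
  by move=> bZ mS; have [] := @bm_indic_borel _ _ R _ Z S bZ mS.
have ET : mean P1 W1 = mean P2 W2.
  have := eqZW (@cst_continuous _ _ (1 : R)) (fun=> _).
  rewrite (_ : (fun t => _) = W1); last by apply/funext => t; rewrite mul1r.
  rewrite [in RHS](_ : (fun t => _) = W2); last by apply/funext => t; rewrite mul1r.
  by apply; rewrite ler01 lexx.
move: B; apply: (@dynkin_induction _ M (@open V')) => //.
- exact: openI.
- rewrite (_ : (fun t => _) = W1); last by apply/funext => t; rewrite indicE in_setT mul1r.
  rewrite [in RHS](_ : (fun t => _) = W2); last by apply/funext => t; rewrite indicE in_setT mul1r.
  exact: ET.
- move=> U oU; have [g [gc g01 gU]] := open_approximation oU.
  have mg d (T : measurableType d) (Z : T -> V) k : borel_fun Z ->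
      measurable_fun setT (g k \o Z).
    move=> bZ; apply: (@borel_fun_within _ _ _ _ _ setT) => //.
    exact: continuous_subspaceT.
  by apply: (limit_eq (g := g)) => // k; [exact: mg|exact: mg|exact: eqZW].
- move=> S mS ES.
  have meanC d (T : measurableType d) (P : probability T R) (Z : T -> V) (W : T -> R) :
      borel_fun Z -> bounded_measurable W ->
      mean P (fun t => \1_(~` S) (Z t) * W t) = mean P W - mean P (fun t => \1_S (Z t) * W t).
    move=> bZ bW; rewrite -meanB//; last by apply: bmM => //; exact: bm_indic_borel.
    congr mean; apply/funext => t; rewrite !indicE in_setC.
    by case: (_ \in _); rewrite /= ?mul1r ?mul0r ?subr0 ?subrr.
  by rewrite !meanC// ES ET.
- move=> F mF tF EF.
  pose g k x : R := \sum_(i < k) \1_(F i) x.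
  have gF k x j : F j x -> g k x = (j < k)%:R.
    move=> Fjx; have F0 i : i != j -> \1_(F i) x = 0 :> R.
      move=> /eqP ij; rewrite indicE memNset// => Fix.
      by apply: ij; apply: (tF i j) => //; exists x.
    rewrite /g; have [jk|kj] := ltnP j k.
      rewrite (bigD1 (Ordinal jk))//= big1 ?addr0 ?indicE ?mem_set// => i ij.
      by apply: F0; apply: contra ij => /eqP ij; apply/eqP/val_inj.
    rewrite big1// => i _; apply: F0; rewrite neq_ltn (leq_trans (ltn_ord i))//.
  have gN k x : ~ (\bigcup_i F i) x -> g k x = 0.
    move=> Fx; rewrite /g big1// => i _; rewrite indicE memNset// => Fix.
    by apply: Fx; exists i.
  have gE d (T : measurableType d) (P : probability T R) (Z : T -> V) (W : T -> R) k :
      borel_fun Z -> bounded_measurable W ->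
      mean P (fun t => g k (Z t) * W t) = \sum_(i < k) mean P (fun t => \1_(F i) (Z t) * W t).
    move=> bZ bW; rewrite -mean_sum; last first.
      by move=> i; apply: bmM => //; apply: bm_indic_borel => //; exact: mF.
    by congr mean; apply/funext => t; rewrite mulr_suml.
  have mg d (T : measurableType d) (Z : T -> V) k : borel_fun Z ->
      measurable_fun setT (g k \o Z).
    move=> bZ; suff [] : bounded_measurable (g k \o Z) by [].
    by apply: bm_sum => i; apply: bm_indic_borel => //; exact: mF.
  apply: (limit_eq (g := g)) => [k|k|k x|x|k]; [exact: mg|exact: mg| | |].
  + have [[j _ /gF ->]|/gN ->] := pselect ((\bigcup_i F i) x); last by rewrite lexx ler01.
    by rewrite ler0n lern1 leq_b1.
  + rewrite indicE; have [[j _ Fjx]|Fx] := pselect ((\bigcup_i F i) x).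
      rewrite mem_set; last by exists j.
      apply: cvg_near_cst; exists j.+1 => // k /= jk.
      by rewrite (gF _ _ _ Fjx) jk.
    rewrite memNset//; under eq_fun do rewrite gN//.
    exact: cvg_cst.
  + by rewrite !gE//; apply: eq_bigr => i _; exact: EF.
Qed.

End monotone_class.

(** * Functions and measures on a convex body *)

Section within.
Variables (R : realType).

Lemma within_comp (U V W : topologicalType) (A : set U) (B : set V)
    (g : U -> V) (f : V -> W) : {within A, continuous g} -> (forall x, A x -> B (g x)) ->
  {within B, continuous f} -> {within A, continuous (f \o g)}.
Proof.
move=> cg AB cf; apply/continuousP => A1 oA1.
move/continuousP : cf => /(_ _ oA1) /open_subspaceP[A2 oA2 A21].
move/continuousP : cg => /(_ _ oA2) /open_subspaceP[A3 oA3 A32].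
apply/open_subspaceP; exists A3 => //; rewrite A32.
apply/seteqP; split => x /= [gx Ax]; split => //.
  have : (A2 `&` B) (g x) by split => //; exact: AB.
  by rewrite A21 => -[].
have : (f @^-1` A1 `&` B) (g x) by split => //; exact: AB.
by rewrite -A21 => -[].
Qed.

Lemma withinD (V : topologicalType) (A : set V) (f g : V -> R) :
  {within A, continuous f} -> {within A, continuous g} ->
  {within A, continuous (fun x => f x + g x)}.
Proof. by move=> cf cg x; apply: cvgD; [exact: cf|exact: cg]. Qed.

Lemma withinM (V : topologicalType) (A : set V) (f g : V -> R) :
  {within A, continuous f} -> {within A, continuous g} ->
  {within A, continuous (fun x => f x * g x)}.
Proof. by move=> cf cg x; apply: cvgM; [exact: cf|exact: cg]. Qed.

Lemma within_cst (V : topologicalType) (A : set V) (r : R) :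
  {within A, continuous (fun=> r)}.
Proof. by move=> x; exact: cvg_cst. Qed.

Lemma withinN (V : topologicalType) (A : set V) (f : V -> R) :
  {within A, continuous f} -> {within A, continuous (fun x => - f x)}.
Proof. by move=> cf x; apply: cvgN; exact: cf. Qed.

Lemma withinB (V : topologicalType) (A : set V) (f g : V -> R) :
  {within A, continuous f} -> {within A, continuous g} ->
  {within A, continuous (fun x => f x - g x)}.
Proof. by move=> cf cg; apply: withinD => //; exact: withinN. Qed.

Lemma within_sum (V : topologicalType) (A : set V) (I : Type) (s : seq I)
    (F : I -> V -> R) : (forall i, {within A, continuous (F i)}) ->
  {within A, continuous (fun x => \sum_(i <- s) F i x)}.
Proof.
move=> cF; elim: s => [|i s ih].
  rewrite (_ : (fun=> _) = fun=> 0); first exact: within_cst.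
  by apply/funext => x; rewrite big_nil.
rewrite (_ : (fun x => _) = fun x => F i x + \sum_(j <- s) F j x).
  exact: withinD.
by apply/funext => x; rewrite big_cons.
Qed.

Lemma within_bounded (V : topologicalType) (A : set V) (f : V -> R) :
  compact A -> {within A, continuous f} -> exists M, forall x, A x -> `|f x| <= M.
Proof.
move=> cA cf; have [M [_ fM]] : exists M : R, M \is Num.real /\
    forall r, M < r -> forall y, (f @` A) y -> `|y| <= r.
  exact: (compact_bounded (continuous_compact cf cA)).
by exists (M + 1) => x Ax; apply: (fM (M + 1)); [rewrite ltrDl|exists x].
Qed.

Lemma within_lipschitz (V : pseudoMetricNormedZmodType R) (A : set V) (f : V -> R) L :
  (forall x y, A x -> A y -> f x <= f y + L * `|x - y|) -> {within A, continuous f}.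
Proof.
move=> fL; rewrite continuous_subspace_in => x /set_mem Ax.
apply/cvgrPdist_le => e e0; rewrite /prop_near1 {1}/nbhs /= -nbhs_subspace_in//.
(* [L] has no sign, hence the positive denominator. *)
apply/nbhs_ballP; exists (e / (`|L| + 1)).
  by rewrite /= divr_gt0// ltr_wpDl.
move=> y /=; rewrite -ball_normE /= ltr_pdivlMr ?ltr_wpDl// => xy Ay.
have h1 := fL _ _ Ax Ay; have h2 := fL _ _ Ay Ax; rewrite distrC in h2.
have h3 : L * `|x - y| <= `|x - y| * (`|L| + 1).
  by rewrite mulrC ler_wpM2l// (le_trans (ler_norm L))// lerDl.
by rewrite ler_norml /from_subspace; apply/andP; split; lra.
Qed.

End within.

Section points.
Variables (R : realType) (n : nat) (K : convexBody R n).
Local Notation V := 'rV[R]_n.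

Lemma coordsP (x : point_of K) : body K (coords x).
Proof. exact: set_valP. Qed.

Definition to_point (z : V) : point_of K :=
  if pselect (body K z) is left Kz then exist _ z (mem_set Kz) else point.

Lemma to_pointK z : body K z -> coords (to_point z) = z.
Proof. by rewrite /to_point; case: pselect. Qed.

Lemma coordsK x : to_point (coords x) = x.
Proof. by apply: eq_sig_hprop => //; rewrite -[LHS]/(coords _) to_pointK//; exact: coordsP. Qed.

Lemma borel_point_preimage (A : set (borel (point_of K))) : measurable A ->
  exists2 B, <<s @open V >> B & A = @coords R n K @^-1` B.
Proof.
move=> mA.
pose V' : ptopologicalType := HB.pack V (isPointed.Build V 0).
have : preimage_set_system setT (@coords R n K : _ -> V') <<s @open V' >> A.
  rewrite -(@g_sigma_preimageE _ V' setT (@coords R n K)).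
  apply: (smallest_sub _ _ mA); first exact: smallest_sigma_algebra.
  move=> _ [B oB <-]; apply: sub_sigma_algebra; exists B => //.
  by rewrite setTI.
by move=> [B mB BA]; exists B => //; rewrite -BA setTI.
Qed.

Lemma borel_coords : borel_fun (@coords R n K : borel (point_of K) -> V).
Proof.
move=> U oU; apply: sub_sigma_algebra => /=.
by exists U.
Qed.

Lemma measurable_to_point d (T : measurableType d) (Z : T -> V) :
  borel_fun Z -> (forall t, body K (Z t)) ->
  measurable_fun setT (to_point \o Z : T -> borel (point_of K)).
Proof.
move=> bZ KZ _ A /borel_point_preimage[B mB ->]; rewrite setTI.
rewrite (_ : _ @^-1` _ = Z @^-1` B); first exact: borel_fun_sigma bZ mB.
by apply/seteqP; split => t /=; rewrite to_pointK.
Qed.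

Lemma bm_contOn (g : V -> R) : {within K, continuous g} ->
  bounded_measurable (fun x : borel (point_of K) => g (coords x)).
Proof.
move=> cg.
exact: (borel_fun_bm (@body_compact _ _ K) borel_coords (@coordsP) cg).
Qed.

Lemma integral_contOn (m : probability (borel (point_of K)) R) (g : contOn K) :
  (\int[m]_x (g (coords x))%:E = (mean m (fun x => g (coords x)))%:E)%E.
Proof. by rewrite meanE//; apply: bm_contOn; exact: contOn_continuous. Qed.

Lemma within_coord i : {within K, continuous (fun v : V => v ord0 i)}.
Proof. by apply: continuous_subspaceT; exact: coord_continuous. Qed.

(* The infimum over [x] of the affine functions [y |-> f1 x + H x (y - x)] is a
   continuous concave function that lies between [f2] and [f1]. *)
Lemma convex_order_affine (mu nu : probability (borel (point_of K)) R)
    (f1 f2 : V -> R) (H : 'I_n -> V -> R) : convex_order mu nu ->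
  {within K, continuous f1} -> {within K, continuous f2} ->
  (forall k, {within K, continuous (H k)}) ->
  (forall x y, body K x -> body K y ->
    0 <= f1 x - f2 y + \sum_k H k x * (y ord0 k - x ord0 k)) ->
  mean nu (fun x => f2 (coords x)) <= mean mu (fun x => f1 (coords x)).
Proof.
move=> mn cf1 cf2 cH H0.
have vK := @body_convex _ _ K.
pose v (x y : V) := f1 x + \sum_k H k x * (y ord0 k - x ord0 k).
pose g (y : V) := inf [set v x y | x in body K].
have v_ge x y : body K x -> body K y -> f2 y <= v x y.
  by move=> Kx Ky; have := H0 x y Kx Ky; rewrite /v; lra.
pose x0 := coords (point : point_of K); have Kx0 : body K x0 := coordsP _.
have infv y : body K y -> has_inf [set v x y | x in body K].
  move=> Ky; split; first by exists (v x0 y), x0.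
  by exists (f2 y) => _ [x Kx <-]; exact: v_ge.
have g_le x y : body K x -> body K y -> g y <= v x y.
  by move=> Kx Ky; apply: ge_inf; [exact: (infv y Ky).2|exists x].
have le_g r y : body K y -> (forall x, body K x -> r <= v x y) -> r <= g y.
  move=> Ky rv; apply: lb_le_inf; first exact: (infv y Ky).1.
  by move=> _ [x Kx <-]; exact: rv.
have /choice[M HM] : forall k, exists M, forall x, body K x -> `|H k x| <= M.
  by move=> k; exact: (within_bounded (@body_compact _ _ K) (cH k)).
(* The slopes [H k x] are bounded uniformly in [x], so the infimum is Lipschitz. *)
have cg : {within K, continuous g}.
  apply: (@within_lipschitz _ _ _ _ (\sum_k M k)) => y y' Ky Ky'.
  rewrite -lerBlDr; apply: le_g => // x Kx; rewrite lerBlDr.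
  apply: (le_trans (g_le x y Kx Ky)).
  rewrite /v -addrA lerD2l mulr_suml -big_split/=; apply: ler_sum => k _.
  rewrite -lerBlDl -mulrBr (_ : _ - _ = y ord0 k - y' ord0 k); last by lra.
  apply: (le_trans (ler_norm _)); rewrite normrM ler_pM ?HM//.
  by have := coord_norm_le (y - y') k; rewrite !mxE.
have gconv : convex_function (body K) (fun y => - g y).
  move=> t x y /set_mem Kx /set_mem Ky.
  pose s : R := t%:num.
  have s01 : 0 <= s <= 1 by rewrite /s ge0 le1.
  have Kz := convex_setE vK Kx Ky s01.
  suff : s * g x + (1 - s) * g y <= g (s *: x + (1 - s) *: y).
    by move=> h; rewrite convRE /= -[leRHS]opprK lerN2 opprD -!mulrN !opprK.
  case/andP: s01 => s0 s1.
  apply: le_g => // z Kzz.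
  have -> : v z (s *: x + (1 - s) *: y) = s * v z x + (1 - s) * v z y.
    rewrite /v !mulrDr [RHS]addrACA -mulrDl subrKC mul1r; congr (_ + _).
    rewrite !mulr_sumr -big_split/=; apply: eq_bigr => k _; rewrite !mxE; ring.
  by apply: lerD; apply: ler_wpM2l => //; rewrite ?subr_ge0// g_le.
have := mn (ContOn (withinN cg)) gconv; rewrite !integral_contOn lee_fin /=.
rewrite !(meanN _ (bm_contOn cg)) lerN2 => gmn.
apply: (@le_trans _ _ (mean nu (fun x => g (coords x)))).
  apply: le_mean; [exact: bm_contOn|exact: bm_contOn|] => x.
  by apply: le_g => [|z Kz]; [exact: coordsP|exact: v_ge (coordsP x)].
apply: (le_trans gmn); apply: le_mean; [exact: bm_contOn|exact: bm_contOn|] => x.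
have := g_le (coords x) (coords x) (coordsP x) (coordsP x).
by rewrite /v big1 ?addr0// => k _; rewrite subrr mulr0.
Qed.

End points.

Lemma open_preimage_fst (U V : topologicalType) (A : set U) :
  open A -> open ((fun z : U * V => z.1) @^-1` A).
Proof. by move=> oA; apply: open_comp => // z _; exact: cvg_fst. Qed.

Lemma open_preimage_snd (U V : topologicalType) (A : set V) :
  open A -> open ((fun z : U * V => z.2) @^-1` A).
Proof. by move=> oA; apply: open_comp => // z _; exact: cvg_snd. Qed.

(** * Martingale couplings *)

Section coupling.
Variables (R : realType) (n : nat) (K : convexBody R n).
Local Notation V := 'rV[R]_n.

Definition martingale d (T : measurableType d) (P : probability T R) (X Y : T -> V) :=
  forall i B, <<s @open V >> B ->
    mean P (fun t => \1_B (X t) * X t ord0 i) = mean P (fun t => \1_B (X t) * Y t ord0 i).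

Definition has_law d (T : measurableType d) (P : probability T R) (X : T -> V)
    (m : probability (borel (point_of K)) R) :=
  forall B, <<s @open V >> B ->
    mean P (fun t => \1_B (X t)) = mean m (fun x => \1_B (coords x)).

Lemma has_lawP d (T : measurableType d) (P : probability T R) (X : T -> V)
    (m : probability (borel (point_of K)) R) :
  borel_fun X -> (forall t, body K (X t)) ->
  (forall g, {within K, continuous g} ->
    mean P (g \o X) = mean m (fun x => g (coords x))) -> has_law P X m.
Proof.
move=> bX KX H B mB.
have := @borel_mean_unique _ _ _ _ P _ _ m X (@coords R n K) (fun=> 1) (fun=> 1)
  bX (@borel_coords _ _ K) (bm_cst _ _) (bm_cst _ _) _ B mB.
rewrite (_ : (fun t => _ * _) = fun t => \1_B (X t)); last first.
  by apply/funext => t; rewrite mulr1.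
rewrite [in RHS](_ : (fun t => _ * _) = fun x => \1_B (coords x)); last first.
  by apply/funext => t; rewrite mulr1.
apply => g cg _.
have := H g (continuous_subspaceT cg).
rewrite (_ : g \o X = fun t => g (X t) * 1); last by apply/funext => t; rewrite mulr1.
by move=> ->; congr mean; apply/funext => t; rewrite mulr1.
Qed.

(** In the cone, [f1] and [f2] are the multipliers of the two marginals, [H] that of the martingale
    property and [t >= 0] that of the cost bound. The hypothesis on [v] is the corresponding bound
    for the dual problem. *)
Theorem exists_martingale (mu nu : probability (borel (point_of K)) R)
    (c : V * V -> R) (v : R) : convex_order mu nu ->
  {within body K `*` body K, continuous c} ->
  (forall (f1 f2 : V -> R) (H : 'I_n -> V -> R),
    {within K, continuous f1} -> {within K, continuous f2} ->
    (forall k, {within K, continuous (H k)}) ->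
    (forall x y, body K x -> body K y ->
      f1 x - f2 y + \sum_k H k x * (y ord0 k - x ord0 k) <= c (x, y)) ->
    mean mu (fun x => f1 (coords x)) - mean nu (fun x => f2 (coords x)) <= v) ->
  exists d (T : measurableType d) (P : probability T R) (X Y : T -> V),
    [/\ (borel_fun X /\ borel_fun Y) /\
          ((forall t, body K (X t)) /\ (forall t, body K (Y t))),
        martingale P X Y, has_law P X mu, has_law P Y nu &
        mean P (fun t => c (X t, Y t)) <= v].
Proof.
move=> mn cc fv.
pose G (f1 f2 : V -> R) (H : 'I_n -> V -> R) (t : R) (z : V * V) :=
  f1 z.1 - f2 z.2 + \sum_k H k z.1 * (z.2 ord0 k - z.1 ord0 k) + t * c z.
pose E (f1 f2 : V -> R) t := mean mu (fun x => f1 (coords x)) -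
  mean nu (fun x => f2 (coords x)) + t * v.
pose W := [set w : (V * V -> R) * R | exists f1 f2 H t,
  [/\ {within K, continuous f1} /\ {within K, continuous f2},
      forall k, {within K, continuous (H k)}, 0 <= t & w = (G f1 f2 H t, E f1 f2 t)]].
have cKK : compact (body K `*` body K) := compact_setX (@body_compact _ _ K) (@body_compact _ _ K).
have x0 := coordsP (point : point_of K).
have KK0 : body K `*` body K !=set0.
  by exists (coords (point : point_of K), coords (point : point_of K)).
have cfst (f : V -> R) : {within K, continuous f} ->
    {within body K `*` body K, continuous (fun z => f z.1)}.
  have c1 : {within body K `*` body K, continuous (fst : V * V -> V)}.
    by apply: continuous_subspaceT => z; exact: cvg_fst.
  by move=> cf; apply: (within_comp c1 _ cf) => z [].
have csnd (f : V -> R) : {within K, continuous f} ->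
    {within body K `*` body K, continuous (fun z => f z.2)}.
  have c2 : {within body K `*` body K, continuous (snd : V * V -> V)}.
    by apply: continuous_subspaceT => z; exact: cvg_snd.
  by move=> cf; apply: (within_comp c2 _ cf) => z [].
have W_cont w : W w -> {within body K `*` body K, continuous w.1}.
  move=> [f1 [f2 [H [t [[cf1 cf2] cH _ ->]]]]] /=.
  apply: withinD; [apply: withinD; [apply: withinB; [exact: (cfst f1)|exact: (csnd f2)]|]|].
    apply: within_sum => k; apply: withinM; first exact: (cfst (H k) (cH k)).
    by apply: withinB; [apply: (csnd (fun v : V => v ord0 k))|
      apply: (cfst (fun v : V => v ord0 k))]; exact: within_coord.
  by apply: withinM => //; exact: within_cst.
have WD u w : W u -> W w -> W (fun x => u.1 x + w.1 x, u.2 + w.2).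
  move=> [f1 [f2 [H [t [[cf1 cf2] cH t0 ->]]]]] [f1' [f2' [H' [t' [[cf1' cf2'] cH' t0' ->]]]]].
  exists (fun x => f1 x + f1' x), (fun x => f2 x + f2' x), (fun k x => H k x + H' k x), (t + t').
  split => /=; [by split; exact: withinD|by move=> k; exact: withinD|exact: addr_ge0|].
  congr pair.
    apply/funext => z; rewrite /G (_ : \sum_k (H k z.1 + H' k z.1) * _ =
      \sum_k H k z.1 * (z.2 ord0 k - z.1 ord0 k) + \sum_k H' k z.1 * (z.2 ord0 k - z.1 ord0 k)).
      by ring.
    by rewrite -big_split; apply: eq_bigr => k _; rewrite mulrDl.
  by rewrite /E !meanD; [ring|exact: bm_contOn..].
have WZ a w : 0 <= a -> W w -> W (fun x => a * w.1 x, a * w.2).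
  move=> a0 [f1 [f2 [H [t [[cf1 cf2] cH t0 ->]]]]].
  exists (fun x => a * f1 x), (fun x => a * f2 x), (fun k x => a * H k x), (a * t).
  have cZ (f : V -> R) : {within K, continuous f} -> {within K, continuous (fun x => a * f x)}.
    by move=> cf; apply: withinM => //; exact: within_cst.
  split => /=; [by split; exact: cZ|by move=> k; exact: cZ|exact: mulr_ge0|].
  congr pair.
    apply/funext => z; rewrite /G (_ : \sum_k (a * H k z.1) * _ =
      a * \sum_k H k z.1 * (z.2 ord0 k - z.1 ord0 k)); first by ring.
    by rewrite mulr_sumr; apply: eq_bigr => k _; rewrite mulrA.
  by rewrite /E !meanZ; [ring|exact: bm_contOn..].
have cst_cont r : {within K, continuous (fun=> r : R)} by exact: within_cst.
have G0 f1 f2 z : G f1 f2 (fun _ _ => 0) 0 z = f1 z.1 - f2 z.2.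
  by rewrite /G big1 ?mul0r ?addr0// => k _; rewrite mul0r.
have W_cst r : W (fun=> r, r).
  exists (fun=> r), (fun=> 0), (fun _ _ => 0), 0; split => //; congr pair.
    by apply/funext => z; rewrite G0 subr0.
  by rewrite /E !mean_cst; ring.
(* For [t = 0] this is a property of the convex order alone; for [t > 0] division by [- t] turns the
   data into a competitor of the dual problem. *)
have W_ge0 w : W w -> (forall x, (body K `*` body K) x -> 0 <= w.1 x) -> 0 <= w.2.
  move=> [f1 [f2 [H [t [[cf1 cf2] cH]]]]]; rewrite le_eqVlt => /predU1P[<-|t0] -> /= Gp.
    rewrite /E mul0r addr0 subr_ge0; apply: (convex_order_affine mn cf1 cf2 cH) => x y Kx Ky.
    by have := Gp (x, y) (conj Kx Ky); rewrite /G mul0r addr0.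
  have cN (f : V -> R) : {within K, continuous f} -> {within K, continuous (fun x => - t^-1 * f x)}.
    by move=> cf; apply: withinM => //; exact: within_cst.
  have e : t^-1 * t = 1 by rewrite mulVf// gt_eqF.
  have t'0 : 0 < t^-1 by rewrite invr_gt0.
  suff : - t^-1 * E f1 f2 t <= 0 by rewrite mulNr oppr_le0 pmulr_rge0.
  have -> : - t^-1 * E f1 f2 t = - t^-1 * mean mu (fun x => f1 (coords x)) -
      - t^-1 * mean nu (fun x => f2 (coords x)) - (t^-1 * t) * v by rewrite /E; ring.
  rewrite e mul1r subr_le0 -!meanZ; [|exact: bm_contOn..].
  apply: (fv _ _ (fun k x => - t^-1 * H k x) (cN _ cf1) (cN _ cf2)).
    by move=> k; exact: cN.
  move=> x y Kx Ky; have := Gp (x, y) (conj Kx Ky).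
  rewrite /G /= -(pmulr_rge0 _ t'0) => h; rewrite -subr_ge0; apply: (le_trans h).
  have -> : \sum_k - t^-1 * H k x * (y ord0 k - x ord0 k) =
      - t^-1 * \sum_k H k x * (y ord0 k - x ord0 k).
    by rewrite mulr_sumr; apply: eq_bigr => k _; rewrite mulrA.
  rewrite -[X in _ <= X - _](mul1r (c (x, y))) -e.
  by rewrite le_eqVlt; apply/orP; left; apply/eqP; ring.
have [d [T [q [P [bq Kq Pq]]]]] := cone_measure cKK (@norm_hausdorff _ (V * V)%type) KK0
  W_cont WD WZ W_cst W_ge0.
have bX : borel_fun (fun t => (q t).1) by move=> U oU; exact: (bq _ (@open_preimage_fst V V U oU)).
have bY : borel_fun (fun t => (q t).2) by move=> U oU; exact: (bq _ (@open_preimage_snd V V U oU)).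
have KX t : body K (q t).1 by case: (Kq t).
have KY t : body K (q t).2 by case: (Kq t).
have PG f1 f2 H t : {within K, continuous f1} -> {within K, continuous f2} ->
    (forall k, {within K, continuous (H k)}) -> 0 <= t ->
    mean P (fun s => G f1 f2 H t (q s)) <= E f1 f2 t.
  by move=> cf1 cf2 cH t0; apply: (Pq (G f1 f2 H t, E f1 f2 t)); exists f1, f2, H, t.
have bfX (g : V -> R) : {within K, continuous g} -> bounded_measurable (fun s => g (q s).1).
  by move=> cg; exact: (borel_fun_bm (@body_compact _ _ K) bX KX cg).
have bfY (g : V -> R) : {within K, continuous g} -> bounded_measurable (fun s => g (q s).2).
  by move=> cg; exact: (borel_fun_bm (@body_compact _ _ K) bY KY cg).
exists d, T, P, (fun t => (q t).1), (fun t => (q t).2); split => //.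
- move=> i B mB.
  have bXi := bfX (fun v : V => v ord0 i) (@within_coord _ _ K i).
  have bYi := bfY (fun v : V => v ord0 i) (@within_coord _ _ K i).
  apply: (borel_mean_unique bX bX bXi bYi _ mB) => g cg _.
  have cg' := continuous_subspaceT cg : {within K, continuous g}.
  (* All multipliers except [t] occur with both signs, so the one-sided bounds are equalities, here
     and for both marginals. *)
  have half (h : V -> R) : {within K, continuous h} ->
      mean P (fun t => h (q t).1 * (q t).2 ord0 i) <=
      mean P (fun t => h (q t).1 * (q t).1 ord0 i).
    move=> ch; rewrite -subr_le0 -meanB; last 2 first.
    - by apply: bmM; [exact: bfX|exact: bYi].
    - by apply: bmM; [exact: bfX|exact: bXi].
    pose H k (x : V) := if k == i then h x else 0.
    have cH k : {within K, continuous (H k)} by rewrite /H; case: eqP.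
    have := @PG (fun=> 0) (fun=> 0) H 0 (cst_cont 0) (cst_cont 0) cH (lexx _).
    rewrite /E !mean_cst mul0r subr0 addr0; congr (mean P _ <= _).
    apply/funext => t; rewrite /G mul0r addr0 subr0 add0r (bigD1 i)//=.
    rewrite {1}/H eqxx big1 ?addr0 ?mulrBr// => k /negPf ki.
    by rewrite /H ki mul0r.
  apply/eqP; rewrite eq_le half// andbT -lerN2.
  rewrite -(meanN _ (bmM (bfX g cg') bXi)) -(meanN _ (bmM (bfX g cg') bYi)).
  have := half _ (withinN cg'); congr (mean P _ <= mean P _);
    by apply/funext => t; rewrite mulNr.
- apply: has_lawP => // g cg.
  have half (h : V -> R) : {within K, continuous h} ->
      mean P (fun t => h (q t).1) <= mean mu (fun x => h (coords x)).
    move=> ch; have := @PG h (fun=> 0) (fun _ _ => 0) 0 ch (cst_cont 0) (fun=> cst_cont 0) (lexx _).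
    rewrite /E mean_cst subr0 mul0r addr0; congr (mean P _ <= _).
    by apply/funext => t; rewrite G0 subr0.
  apply/eqP; rewrite eq_le half//= -lerN2 -!meanN; [|exact: bm_contOn|exact: bfX].
  exact: half (withinN cg).
- apply: has_lawP => // g cg.
  have half (h : V -> R) : {within K, continuous h} ->
      mean nu (fun x => h (coords x)) <= mean P (fun t => h (q t).2).
    move=> ch; have := @PG (fun=> 0) h (fun _ _ => 0) 0 (cst_cont 0) ch (fun=> cst_cont 0) (lexx _).
    rewrite /E mean_cst sub0r mul0r addr0 -lerN2 opprK -meanN; last first.
      by rewrite (_ : (fun s => _) = fun s => - h (q s).2); [apply: bmN; exact: bfY|
        apply/funext => t; rewrite G0 sub0r].
    congr (_ <= mean P _).
    by apply/funext => t; rewrite G0 sub0r opprK.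
  apply/eqP; rewrite eq_le half// andbT -lerN2 -!meanN; [|exact: bfY|exact: bm_contOn].
  exact: half (withinN cg).
- have := @PG (fun=> 0) (fun=> 0) (fun _ _ => 0) 1 (cst_cont 0) (cst_cont 0) (fun=> cst_cont 0) ler01.
  rewrite /E !mean_cst subr0 add0r mul1r; congr (mean P _ <= _).
  apply/funext => t; rewrite /G big1 => [|k _]; last by rewrite mul0r.
  by rewrite subr0 !add0r mul1r -surjective_pairing.
Qed.

(** Averaged over the nodes, the term with [H] vanishes, because [b] is their barycentre. *)
Lemma affine_admissible (c : V * V -> R) (f1 f2 : contOn K) (H : 'I_n -> V -> R) :
  (forall x y, body K x -> body K y ->
      f1 x - f2 y + \sum_k H k x * (y ord0 k - x ord0 k) <= c (x, y)) ->
  admissible c (f1, f2).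
Proof.
move=> f12 l x l0 l1 Kx /=.
pose b := \sum_i l i *: x i.
have Kb : body K b.
  by apply: convex_set_sum => // *; apply: convex_setE => //; exact: (@body_convex _ _ K).
have -> : f1 b - \sum_i l i * f2 (x i) =
    \sum_i l i * (f1 b - f2 (x i) + \sum_k H k b * (x i ord0 k - b ord0 k)).
  transitivity (\sum_i l i * f1 b - \sum_i l i * f2 (x i) +
    \sum_k H k b * (\sum_i l i * x i ord0 k - \sum_i l i * b ord0 k)).
    rewrite -mulr_suml l1 mul1r [X in _ = _ + X]big1 ?addr0// => k _.
    rewrite -mulr_suml l1 mul1r {2}/b summxE.
    by rewrite (eq_bigr (fun i => (l i *: x i) ord0 k)) ?subrr ?mulr0// => i _; rewrite mxE.
  rewrite (eq_bigr (fun k => \sum_i l i * (H k b * (x i ord0 k - b ord0 k)))); last first.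
    by move=> k _; rewrite -sumrB mulr_sumr; apply: eq_bigr => i _; ring.
  rewrite exchange_big -sumrB -!big_split/=; apply: eq_bigr => i _.
  by rewrite -mulr_sumr; ring.
by apply: ler_sum => i _; apply: ler_wpM2l => //; exact: f12.
Qed.

End coupling.

(** * Identification of means, image laws and conditioning *)

Section mean_unique.
Context d (T : measurableType d) (R : realType).
Local Notation bm := bounded_measurable.

Lemma bm_approx (h : T -> R) (e : R) : bm h -> 0 < e ->
  exists m (a : 'I_m -> R) (B : 'I_m -> set T), (forall k, measurable (B k)) /\
    forall t, `|h t - \sum_k a k * \1_(B k) t| <= e.
Proof.
move=> [mh [M hM]] e0.
have cM : compact (`[- M, M]%classic : set R) by exact: segment_compact.
have [m [J [mJ JM]]] := small_partition cM e0.
have Mh t : `[- M, M]%classic (h t) by rewrite /= in_itv /= -ler_norml.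
have bh : borel_fun h.
  by move=> U oU; rewrite -[_ @^-1` _]setTI; apply: mh => //; exact: open_measurable.
have /choice[a aP] : forall k : 'I_m.+1, exists a, `[- M, M]%classic a /\
    forall x, `[- M, M]%classic x -> J x = k -> J a = k.
  move=> k; have [[x [Kx Jx]]|nx] := pselect (exists x, `[- M, M]%classic x /\ J x = k).
    by exists x.
  by exists (h point); split => // x Kx Jx; exfalso; apply: nx; exists x.
exists m.+1, a, (fun k => h @^-1` (J @^-1` [set k])); split.
  by move=> k; exact: borel_fun_sigma bh (mJ k).
move=> t; rewrite (_ : \sum_k _ = a (J (h t))).
  by have [Ka aJ] := aP (J (h t)); apply: JM => //; rewrite (aJ (h t)).
rewrite -(sum_indic_fiber J a (h t)); apply: eq_bigr => k _; rewrite mulrC.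
by rewrite !indicE; congr (_%:R * _); apply/idP/idP; rewrite !inE.
Qed.

(** Linearity of [L] is replaced by its values on simple functions and a Lipschitz bound in the
    uniform norm; simple functions are uniformly dense among the bounded measurable ones. *)
Lemma mean_unique (Q : probability T R) (L : (T -> R) -> R) (C : R) :
  (forall m (a : 'I_m -> R) (B : 'I_m -> set T), (forall k, measurable (B k)) ->
    L (fun t => \sum_k a k * \1_(B k) t) = \sum_k a k * mean Q (\1_(B k))) ->
  (forall h h' e, bm h -> bm h' -> 0 <= e -> (forall t, `|h t - h' t| <= e) ->
    `|L h - L h'| <= C * e) ->
  forall h, bm h -> L h = mean Q h.
Proof.
move=> Lsimple Llip h bh; apply/eqP; rewrite -subr_eq0 -normr_le0.
apply/ler_addgt0Pr => e e0; rewrite add0r.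
pose e' := e / (`|C| + 1).
have C1 : 0 < `|C| + 1 by rewrite ltr_wpDl.
have e'0 : 0 < e' by rewrite divr_gt0.
have [m [a [B [mB hB]]]] := bm_approx bh e'0.
pose s t := \sum_k a k * \1_(B k) t.
have bs : bm s by apply: bm_sum => k; apply: bmM; [exact: bm_cst|exact: bm_indic].
have Ls : L s = mean Q s.
  rewrite Lsimple// mean_sum => [|k]; last first.
    by apply: bmM; [exact: bm_cst|exact: bm_indic].
  by apply: eq_bigr => k _; rewrite meanZ//; exact: bm_indic.
rewrite (_ : L h - mean Q h = (L h - L s) + (mean Q s - mean Q h)); last first.
  by rewrite Ls; ring.
apply: (le_trans (ler_normD _ _)).
have h1 : `|L h - L s| <= C * e' by apply: Llip => //; exact: ltW.
have h2 : `|mean Q s - mean Q h| <= e'.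
  by apply: mean_dist => // t; rewrite distrC.
have h3 : C * e' <= `|C| * e' by rewrite ler_wpM2r ?ler_norm// ltW.
have h4 : `|C| * e' + e' = e by rewrite /e'; field; rewrite gt_eqF.
lra.
Qed.

End mean_unique.

Lemma measure_mean d (T : measurableType d) (R : realType) (P : probability T R) A :
  measurable A -> P A = (mean P \1_A)%:E.
Proof. by move=> mA; rewrite mean_indic// fineK// fin_num_measure. Qed.

(** One change of variables for image laws, with [psi] equal to 1, and for densities, with [f] the
    identity. *)
Lemma mean_transfer d (T : measurableType d) d' (T' : measurableType d') (R : realType)
    (P : probability T R) (Q : probability T' R) (f : T -> T') (psi : T -> R) :
  measurable_fun setT f -> bounded_measurable psi ->
  (forall B, measurable B -> mean Q \1_B = mean P (fun t => psi t * \1_B (f t))) ->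
  forall h, bounded_measurable h -> mean Q h = mean P (fun t => psi t * h (f t)).
Proof.
move=> mf bpsi QP h bh.
have bf (g : T' -> R) : bounded_measurable g -> bounded_measurable (fun t => g (f t)).
  move=> [mg [M gM]]; split; last by exists M.
  exact: (measurableT_comp mg mf).
have [_ [M psiM]] := bpsi.
symmetry; apply: (@mean_unique _ _ _ Q (fun h => mean P (fun t => psi t * h (f t))) M) => //.
  move=> m a B mB.
  rewrite (_ : (fun t => _) = fun t => \sum_k a k * (psi t * \1_(B k) (f t))).
    rewrite mean_sum => [|k]; last first.
      by apply: bmM; [exact: bm_cst|apply: bmM => //; apply: bf; exact: bm_indic].
    apply: eq_bigr => k _; rewrite meanZ ?QP//.
    by apply: bmM => //; apply: bf; exact: bm_indic.
  by apply/funext => t; rewrite mulr_sumr; apply: eq_bigr => k _; ring.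
move=> g g' e bg bg' e0 gg'; apply: mean_dist.
- by apply: bmM => //; exact: bf.
- by apply: bmM => //; exact: bf.
- by move=> t; rewrite -mulrBr normrM ler_pM.
Qed.

Lemma image_probability d (T : measurableType d) d' (T' : measurableType d') (R : realType)
    (P : probability T R) (f : T -> T') : measurable_fun setT f ->
  exists Q : probability T' R, (forall A, measurable A -> Q A = P (f @^-1` A)) /\
    forall h, bounded_measurable h -> mean Q h = mean P (h \o f).
Proof.
move=> mf; pose F : {mfun T >-> T'} := HB.pack f (isMeasurableFun.Build _ _ _ _ f mf).
exists (distribution P F); split => // h bh.
rewrite (@mean_transfer _ _ _ _ _ P _ f (fun=> 1) mf (bm_cst _ _) _ _ bh).
  by congr mean; apply/funext => t; rewrite mul1r.
move=> B mB; rewrite mean_indic//.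
rewrite (_ : (fun t => _) = \1_(f @^-1` B)); last first.
  by apply/funext => t; rewrite mul1r !indicE /=; congr (_%:R); apply/idP/idP; rewrite !inE.
by rewrite mean_indic// -[_ @^-1` _]setTI; exact: (mf measurableT B mB).
Qed.

Lemma conditional_probability d (T : measurableType d) (R : realType)
    (P : probability T R) (A : set T) : measurable A -> 0 < mean P \1_A ->
  exists Q : probability T R, forall h, bounded_measurable h ->
    mean Q h = mean P (fun t => (mean P \1_A)^-1 * \1_A t * h t).
Proof.
move=> mA A0; exists (mnormalize (mrestr P mA) P) => h bh.
have bA : bounded_measurable (fun t => (mean P \1_A)^-1 * \1_A t).
  by apply: bmM; [exact: bm_cst|exact: bm_indic].
apply: (@mean_transfer _ _ _ _ _ P _ id (fun t => (mean P \1_A)^-1 * \1_A t)) => // B mB.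
have QE : (mnormalize (mrestr P mA) P B = (mean P \1_(B `&` A) * (mean P \1_A)^-1)%:E)%E.
  have PA := measure_mean P mA; have PBA := measure_mean P (measurableI _ _ mB mA).
  by rewrite /mnormalize /= /mrestr setTI PA eqe gt_eqF//= PBA.
rewrite (mean_indic _ mB).
transitivity (mean P \1_(B `&` A) / mean P \1_A); first by rewrite -[RHS]/(fine (_%:E)) -QE.
rewrite mulrC (_ : (fun t => _) = fun t => (mean P \1_A)^-1 * \1_(B `&` A) t).
  by rewrite meanZ//; apply: bm_indic; exact: measurableI.
by apply/funext => t; rewrite indicI /= -mulrA [\1_A _ * _]mulrC.
Qed.

(** * Martingales and the convex order *)

Section coupling_order.
Variables (R : realType) (n : nat) (K : convexBody R n).
Local Notation V := 'rV[R]_n.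
Context d (T : measurableType d) (P : probability T R) (X Y : T -> V).
Variables mu nu : probability (borel (point_of K)) R.
Hypotheses (bX : borel_fun X) (bY : borel_fun Y).
Hypotheses (KX : forall t, body K (X t)) (KY : forall t, body K (Y t)).
Hypotheses (XY : martingale P X Y) (lX : has_law P X mu) (lY : has_law P Y nu).

Lemma has_law_mean (Z : T -> V) (m : probability (borel (point_of K)) R) :
  borel_fun Z -> (forall t, body K (Z t)) -> has_law P Z m ->
  forall h, bounded_measurable h -> mean m h = mean P (fun t => h (to_point K (Z t))).
Proof.
move=> bZ KZ lZ h bh.
rewrite (@mean_transfer _ _ _ _ _ P m (to_point K \o Z) (fun=> 1)
  (measurable_to_point bZ KZ) (bm_cst _ _) _ _ bh).
  by congr mean; apply/funext => t; rewrite mul1r.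
move=> A /borel_point_preimage[B mB AB]; have := lZ _ mB.
rewrite (_ : (fun x => \1_B (coords x)) = \1_A); last first.
  by apply/funext => x; rewrite AB !indicE; congr (_%:R); apply/idP/idP; rewrite !inE.
move=> <-; congr mean; apply/funext => t; rewrite mul1r AB !indicE; congr ((nat_of_bool _)%:R).
by apply/idP/idP => /set_mem h1; apply/mem_set; move: h1; rewrite /= to_pointK.
Qed.

Lemma has_law_contOn (Z : T -> V) (m : probability (borel (point_of K)) R) :
  borel_fun Z -> (forall t, body K (Z t)) -> has_law P Z m ->
  forall g : V -> R, {within K, continuous g} ->
  mean m (fun x => g (coords x)) = mean P (g \o Z).
Proof.
move=> bZ KZ lZ g cg; rewrite (has_law_mean bZ KZ lZ); last exact: bm_contOn.
by congr mean; apply/funext => t; rewrite to_pointK.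
Qed.

Lemma coupling_inequality (c : V * V -> R) (f : contOn K * contOn K) :
  {within body K `*` body K, continuous c} -> admissible c f ->
  mean mu (fun x => f.1 (coords x)) - mean nu (fun x => f.2 (coords x)) <=
  mean P (fun t => c (X t, Y t)).
Proof.
move=> cc fc; have cf1 := @contOn_continuous _ _ _ f.1.
have cf2 := @contOn_continuous _ _ _ f.2.
rewrite (has_law_contOn bX KX lX cf1) (has_law_contOn bY KY lY cf2).
exact: (martingale_inequality (@body_compact _ _ K) (@body_convex _ _ K) bX bY KX KY XY).
Qed.

(** For zero cost and a convex [g], admissibility of [(g, g)] is Jensen's inequality for finite
    combinations. *)
Lemma martingale_convex_order : convex_order mu nu.
Proof.
move=> g cg; rewrite !integral_contOn lee_fin -subr_le0 -(mean_cst P 0).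
apply: (@coupling_inequality (fun=> 0) (g, g)); first exact: within_cst.
move=> l x l0 l1 Kx /=; rewrite [leRHS]big1 => [|i _]; last by rewrite mulr0.
by rewrite subr_le0; apply: (jensen (@body_convex _ _ K)).
Qed.

End coupling_order.

Lemma indic_setC (T : Type) (R : realType) (B : set T) t : \1_(~` B) t = 1 - \1_B t :> R.
Proof. by rewrite !indicE in_setC; case: (_ \in _); rewrite ?subrr ?subr0. Qed.

(** * Extreme pairs *)

Section extreme.
Variables (R : realType) (n : nat) (K : convexBody R n).
Local Notation V := 'rV[R]_n.
Local Notation PrK := (probability (borel (point_of K)) R).
Local Notation bm := bounded_measurable.

(** Conditioning on an event that depends on [X] alone preserves the martingale property: the test
    sets [B] merely become [A] intersected with [B]. *)
Lemma conditional_pair d (T : measurableType d) (P : probability T R) (X Y : T -> V)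
    (A : set V) : borel_fun X -> borel_fun Y ->
  (forall t, body K (X t)) -> (forall t, body K (Y t)) -> martingale P X Y ->
  <<s @open V >> A -> 0 < mean P (fun t => \1_A (X t)) ->
  exists a b : PrK, [/\ convex_order a b,
    forall h, bm h -> mean P (fun t => \1_A (X t)) * mean a h =
      mean P (fun t => \1_A (X t) * h (to_point K (X t))) &
    forall h, bm h -> mean P (fun t => \1_A (X t)) * mean b h =
      mean P (fun t => \1_A (X t) * h (to_point K (Y t)))].
Proof.
move=> bX bY KX KY XY mA.
have e1t t : \1_A (X t) = \1_(X @^-1` A) t :> R.
  by rewrite !indicE; congr ((nat_of_bool _)%:R); apply/idP/idP; rewrite !inE.
have mXA : measurable (X @^-1` A) := borel_fun_sigma bX mA.
rewrite (funext e1t : (fun t => \1_A (X t)) = \1_(X @^-1` A)) => s0.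
have [Q0 Q0E] := conditional_probability mXA s0.
set s := mean P _ in s0 Q0E *.
have QE h : bm h -> s * mean Q0 h = mean P (fun t => \1_A (X t) * h t).
  move=> bh; rewrite Q0E// -meanZ; last first.
    by apply: bmM => //; apply: bmM; [exact: bm_cst|exact: bm_indic].
  congr mean; apply/funext => t; rewrite e1t !mulrA divff ?mul1r//.
  by rewrite gt_eqF.
have image (Z : T -> V) : borel_fun Z -> (forall t, body K (Z t)) ->
    exists a : PrK, has_law Q0 Z a /\
      forall h, bm h -> mean a h = mean Q0 (fun t => h (to_point K (Z t))).
  move=> bZ KZ; have [a [_ aE]] := image_probability Q0 (measurable_to_point bZ KZ).
  exists a; split => // B mB; rewrite aE; last by apply: bm_indic_borel => //; exact: borel_coords.
  by congr mean; apply/funext => t; rewrite /= to_pointK.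
have [a [la aE]] := image X bX KX; have [b [lb bE]] := image Y bY KY.
have bZ (Z : T -> V) (h : borel (point_of K) -> R) : borel_fun Z -> (forall t, body K (Z t)) ->
    bm h -> bm (fun t => h (to_point K (Z t))).
  move=> bZ KZ [mh [M hM]]; split; last by exists M.
  exact: (measurableT_comp mh (measurable_to_point bZ KZ)).
exists a, b; split.
- apply: (martingale_convex_order bX bY KX KY _ la lb) => i B mB.
  apply: (mulfI (lt0r_neq0 s0)).
  have bc (Z : T -> V) : borel_fun Z -> (forall t, body K (Z t)) ->
      bm (fun t => \1_B (X t) * Z t ord0 i).
    move=> bZ' KZ; apply: bmM; first exact: bm_indic_borel.
    exact: (bm_coord (@body_compact _ _ K) _ bZ' KZ).
  rewrite !QE; [|exact: bc|exact: bc].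
  have e (Z : T -> V) : (fun t => \1_A (X t) * (\1_B (X t) * Z t ord0 i)) =
      fun t => \1_(A `&` B) (X t) * Z t ord0 i.
    by apply/funext => t; rewrite indicI mulrA.
  rewrite !e; apply: XY.
  pose V' : ptopologicalType := HB.pack V (isPointed.Build V 0).
  exact: (@measurableI _ (g_sigma_algebraType (@open V')) _ _ mA mB).
- by move=> h bh; rewrite aE// QE//; exact: bZ.
- by move=> h bh; rewrite bE// QE//; exact: bZ.
Qed.

Lemma extreme_indic (xi : weakProb K * weakProb K) (A : set V) : extreme_pairs xi ->
  <<s @open V >> A -> mean (xi.1 : PrK) (fun x => \1_A (coords x)) = 0 \/
    mean (xi.1 : PrK) (fun x => \1_A (coords x)) = 1.
Proof.
move=> [oxi ext] mA.
(* Strassen's theorem, as the case of zero cost and [v = 0]. *)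
have [d [T [P [X [Y [[[bX bY] [KX KY]] XY lX lY _]]]]]] :
    exists d (T : measurableType d) (P : probability T R) (X Y : T -> V),
    [/\ (borel_fun X /\ borel_fun Y) /\
          ((forall t, body K (X t)) /\ (forall t, body K (Y t))),
        martingale P X Y, has_law P X xi.1, has_law P Y xi.2 & mean P (fun t => 0) <= 0].
  apply: (@exists_martingale _ _ _ xi.1 xi.2 (fun=> 0) 0 oxi); first exact: within_cst.
  move=> f1 f2 H cf1 cf2 cH f12.
  have := @convex_order_affine _ _ _ xi.1 xi.2 (fun x => - f1 x) (fun x => - f2 x)
    (fun k x => - H k x) oxi (withinN cf1) (withinN cf2) (fun k => withinN (cH k)) _.
  rewrite !meanN; [|exact: bm_contOn|exact: bm_contOn].
  rewrite lerN2 subr_le0; apply => x y Kx Ky; have := f12 x y Kx Ky.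
  rewrite [X in _ -> _ <= _ + X](_ : _ = - \sum_k H k x * (y ord0 k - x ord0 k)); first lra.
  by rewrite -sumrN; apply: eq_bigr => k _; rewrite mulNr.
rewrite -(lX _ mA); set s := mean P _.
have bA : bm (fun t => \1_A (X t) : R) by exact: bm_indic_borel.
have mAC : <<s @open V >> (~` A).
  pose V' : ptopologicalType := HB.pack V (isPointed.Build V 0).
  exact: (@measurableC _ (g_sigma_algebraType (@open V')) _ mA).
have sC : mean P (fun t => \1_(~` A) (X t)) = 1 - s.
  transitivity (mean P (fun t => 1 - \1_A (X t))).
    by congr mean; apply/funext => t; rewrite indic_setC.
  by rewrite meanB ?mean_cst//; exact: bm_cst.
have [->|sn0] := eqVneq s 0; [by left|]; have [->|sn1] := eqVneq s 1; [by right|exfalso].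
have s0 : 0 < s by rewrite lt_neqAle eq_sym sn0/=; apply: mean_ge0 => t; rewrite indicE.
have s1 : s < 1.
  rewrite lt_neqAle sn1/=; apply: (@le_trans _ _ (mean P (fun=> 1))); last by rewrite mean_cst.
  apply: le_mean => //; first exact: bm_cst.
have [a1 [a2 [oa a1E a2E]]] := conditional_pair bX bY KX KY XY mA s0.
have : 0 < mean P (fun t => \1_(~` A) (X t)) by rewrite sC subr_gt0.
move=> /(conditional_pair bX bY KX KY XY mAC)[b1 [b2 [ob b1E b2E]]].
have mixture (Z : T -> V) (m a b : PrK) : borel_fun Z -> (forall t, body K (Z t)) ->
    has_law P Z m ->
    (forall h, bm h -> mean P (fun t => \1_A (X t)) * mean a h =
      mean P (fun t => \1_A (X t) * h (to_point K (Z t)))) ->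
    (forall h, bm h -> mean P (fun t => \1_(~` A) (X t)) * mean b h =
      mean P (fun t => \1_(~` A) (X t) * h (to_point K (Z t)))) -> is_mixture s m a b.
  move=> bZ KZ lZ aE bE B mB; rewrite !measure_mean// -!EFinM -EFinD; congr EFin.
  rewrite -sC aE ?bE; [|exact: bm_indic|exact: bm_indic].
  have bh : bm (fun t => \1_B (to_point K (Z t)) : R).
    have [mh [M hM]] := bm_indic R mB; split; last by exists M.
    exact: (measurableT_comp mh (measurable_to_point bZ KZ)).
  rewrite -meanD; [|by apply: bmM|by apply: bmM => //; exact: bm_indic_borel].
  rewrite (has_law_mean bZ KZ lZ); last exact: bm_indic.
  by congr mean; apply/funext => t; rewrite indic_setC -mulrDl subrKC mul1r.
have := ext (a1, a2) (b1, b2) s oa ob _ (mixture X xi.1 a1 b1 bX KX lX a1E b1E)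
  (mixture Y xi.2 a2 b2 bY KY lY a2E b2E).
rewrite s0 s1 => /(_ isT)[+ _] => /(_ (@coords R n K @^-1` A)).
have mcA : measurable (@coords R n K @^-1` A : set (borel (point_of K))).
  exact: borel_fun_sigma (@borel_coords _ _ K) mA.
move=> /(_ mcA); rewrite !measure_mean// => -[] ab.
have bcA := bm_indic R mcA.
have cA x : \1_(@coords R n K @^-1` A) x = \1_A (coords x) :> R.
  by rewrite !indicE; congr ((nat_of_bool _)%:R); apply/idP/idP => /set_mem h1; apply/mem_set.
(* The two parts cannot agree: the first one gives [A] mass 1, the second one mass 0. *)
have a1A : mean (a1 : PrK) (\1_(@coords R n K @^-1` A)) = 1.
  apply: (mulfI sn0); rewrite a1E// mulr1; congr mean; apply/funext => t.
  by rewrite cA to_pointK// !indicE; case: (_ \in _); rewrite ?mul1r ?mul0r.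
have b1A : mean (b1 : PrK) (\1_(@coords R n K @^-1` A)) = 0.
  have sC0 : 1 - s != 0 by rewrite subr_eq0 eq_sym.
  apply: (mulfI sC0); rewrite -sC b1E// mulr0 -(mean_cst P 0); congr mean; apply/funext => t.
  by rewrite cA to_pointK// indic_setC; rewrite !indicE; case: (_ \in _); rewrite ?subrr ?mul0r ?mulr0.
by move: ab; rewrite a1A b1A => /eqP; rewrite oner_eq0.
Qed.

(** In every fine partition some cell has mass 1, and the barycentre of [m] is close to all points
    of that cell. The barycentre thus gives the atom directly, without intersecting cells. *)
Lemma zero_one_dirac (m : PrK) :
  (forall A, <<s @open V >> A -> mean m (fun x => \1_A (coords x)) = 0 \/
    mean m (fun x => \1_A (coords x)) = 1) ->
  exists2 x, body K x & forall g : V -> R, {within K, continuous g} ->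
    mean m (fun z => g (coords z)) = g x.
Proof.
move=> m01; have cK := @body_compact _ _ K; have bc := @borel_coords _ _ K.
have bI (A : set V) : <<s @open V >> A -> bm (fun x : borel (point_of K) => \1_A (coords x) : R).
  by move=> mA; apply: bm_indic_borel => //; exact: bc.
have class e : 0 < e -> exists A, [/\ <<s @open V >> A,
    mean m (fun x => \1_A (coords x)) = 1 &
    forall x y, body K x -> body K y -> A x -> A y -> `|x - y| <= e].
  move=> e0; have [k [J [mJ JK]]] := small_partition cK e0.
  have J1 : \sum_i mean m (fun x => \1_(J @^-1` [set i]) (coords x)) = 1 :> R.
    rewrite -mean_sum; last by move=> i; exact: bI.
    rewrite -[RHS](mean_cst m 1); congr mean; apply/funext => x.
    rewrite -(sum_indic_fiber J (fun=> 1) (coords x)).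
    by apply: eq_bigr => i _; rewrite mulr1.
  have [i Ji] : exists i, mean m (fun x => \1_(J @^-1` [set i]) (coords x)) = 1.
    apply: contrapT => nJ; move: J1; rewrite big1 => [/eqP|i _].
      by rewrite eq_sym oner_eq0.
    by have [//|Ji] := m01 _ (mJ i); exfalso; apply: nJ; exists i.
  by exists (J @^-1` [set i]); split => // x y Kx Ky /= Jx Jy; apply: JK => //; rewrite Jx.
have full (A : set V) h : <<s @open V >> A -> mean m (fun x => \1_A (coords x)) = 1 ->
    bm h -> mean m (fun x => \1_A (coords x) * h x) = mean m h.
  move=> mA A1 bh; have bA := bI A mA.
  have bC : bm (fun x : borel (point_of K) => 1 - \1_A (coords x) : R).
    by apply: bmB => //; exact: bm_cst.
  apply/esym/eqP; rewrite -subr_eq0 -meanB//; last exact: bmM.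
  rewrite (_ : (fun x => _) = fun x => (1 - \1_A (coords x)) * h x); last first.
    by apply/funext => x; rewrite mulrBl mul1r.
  by rewrite weighted_mean_eq0//; last by rewrite meanB ?mean_cst ?A1 ?subrr//; exact: bm_cst.
pose b := barycentre m (fun=> 1) (@coords R n K).
have near_b e : 0 < e -> exists A, [/\ <<s @open V >> A,
    mean m (fun x => \1_A (coords x)) = 1 &
    forall x, body K x -> A x -> `|b - x| <= e].
  move=> e0; have [A [mA A1 Ae]] := class e e0; exists A; split => // x Kx Ax.
  rewrite (_ : b = barycentre m (fun x => \1_A (coords x)) (@coords R n K)); last first.
    apply/rowP => i; rewrite !mxE A1 mean_cst full//; last exact: (bm_coord cK _ bc (@coordsP _ _ K)).
    by congr (_ * mean _ _); apply/funext => t; rewrite mul1r.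
  apply: (barycentre_dist cK) => //; [exact: bI|by rewrite A1|exact: coordsP|exact: ltW|].
  move=> t; rewrite indicE; case: (boolP (_ \in _)) => [/set_mem At _|_]; last by rewrite eqxx.
  by apply: Ae => //; exact: coordsP.
have Kb : body K b.
  apply: (barycentre_mem cK (@body_convex _ _ K)) => //; [exact: bm_cst|by rewrite mean_cst|].
  exact: coordsP.
exists b => // g cg; apply/eqP; rewrite -subr_eq0 -normr_le0; apply/ler_addgt0Pr => e e0; rewrite add0r.
have [d d0 gd] := compact_uniform_continuity cK cg e0.
have d20 : 0 < d / 2 by rewrite divr_gt0.
have [A [mA A1 Ad]] := near_b _ d20.
have bg := bm_contOn cg.
have bgb : bm (fun x : borel (point_of K) => g (coords x) - g b) by apply: bmB => //; exact: bm_cst.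
have -> : mean m (fun z => g (coords z)) - g b =
    mean m (fun z => \1_A (coords z) * (g (coords z) - g b)).
  by rewrite full// meanB ?mean_cst//; exact: bm_cst.
have A0 (x : point_of K) : 0 <= \1_A (coords x) :> R by rewrite indicE.
have gA (x : point_of K) : \1_A (coords x) != 0 :> R -> `|g (coords x) - g b| <= e.
  rewrite indicE; case: (boolP (_ \in _)) => [/set_mem At _|_]; last by rewrite eqxx.
  rewrite distrC; apply: gd => //; first exact: coordsP.
  rewrite -ball_normE /=; apply: le_lt_trans (Ad _ (coordsP x) At) _; lra.
rewrite ler_norml -[X in _ <= _ <= X](mul1r e) -[X in X <= _ <= _]mul1r -A1.
apply/andP; split; [apply: weighted_mean_ge|apply: weighted_mean_le] => //; try exact: bI;
  by move=> _ x /gA; rewrite ler_norml => /andP[].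
Qed.

End extreme.

(** * Marginals of product measures *)

Section product_mean.
Context d1 (T1 : measurableType d1) d2 (T2 : measurableType d2) (R : realType).
Variables (P1 : probability T1 R) (P2 : probability T2 R).
Local Notation PP := ((P1 \x P2)%E : probability (T1 * T2)%type R).

Lemma bm_fst (h : T1 -> R) : bounded_measurable h ->
  bounded_measurable (fun p : T1 * T2 => h p.1).
Proof. by move=> [mh [M hM]]; split; [exact: (measurableT_comp mh measurable_fst)|exists M]. Qed.

Lemma bm_snd (h : T2 -> R) : bounded_measurable h ->
  bounded_measurable (fun p : T1 * T2 => h p.2).
Proof. by move=> [mh [M hM]]; split; [exact: (measurableT_comp mh measurable_snd)|exists M]. Qed.

Lemma mean_product_fst h : bounded_measurable h -> mean PP (fun p => h p.1) = mean P1 h.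
Proof.
move=> bh; rewrite (@mean_transfer _ _ _ _ _ PP P1 fst (fun=> 1) measurable_fst
  (bm_cst _ _) _ _ bh); first by congr mean; apply/funext => t; rewrite mul1r.
move=> B mB; rewrite (_ : (fun t => _) = \1_(B `*` setT)); last first.
  apply/funext => t; rewrite mul1r !indicE; congr ((nat_of_bool _)%:R).
  by apply/idP/idP => /set_mem h1; apply/mem_set => //; case: h1.
rewrite !mean_indic//; last exact: measurableX.
by rewrite /= product_measure1E//= probability_setT mule1.
Qed.

Lemma mean_product_snd h : bounded_measurable h -> mean PP (fun p => h p.2) = mean P2 h.
Proof.
move=> bh; rewrite (@mean_transfer _ _ _ _ _ PP P2 snd (fun=> 1) measurable_snd
  (bm_cst _ _) _ _ bh); first by congr mean; apply/funext => t; rewrite mul1r.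
move=> B mB; rewrite (_ : (fun t => _) = \1_(setT `*` B)); last first.
  apply/funext => t; rewrite mul1r !indicE; congr ((nat_of_bool _)%:R).
  by apply/idP/idP => /set_mem h1; apply/mem_set => //; case: h1.
rewrite !mean_indic//; last exact: measurableX.
by rewrite /= product_measure1E//= probability_setT mul1e.
Qed.

End product_mean.

(** * The cost of an extreme pair *)

Section extreme_cost.
Variables (R : realType) (n : nat) (K : convexBody R n).
Local Notation V := 'rV[R]_n.
Local Notation PrK := (probability (borel (point_of K)) R).
Local Notation bm := bounded_measurable.

(** A coordinate and its negative are both convex. *)
Lemma convex_order_coord (mu nu : PrK) i : convex_order mu nu ->
  mean mu (fun x => coords x ord0 i) = mean nu (fun x => coords x ord0 i).
Proof.
move=> mn; have ci := @within_coord _ _ K i.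
have half (s : R) : s * mean mu (fun x => coords x ord0 i) <= s * mean nu (fun x => coords x ord0 i).
  have cs : {within K, continuous (fun v : V => s * v ord0 i)}.
    by apply: withinM => //; exact: within_cst.
  have := mn (ContOn cs); rewrite !integral_contOn lee_fin /= !meanZ; [|exact: (bm_contOn ci)..].
  apply => t x y _ _.
  rewrite convRE [conv t x y](_ : _ = t%:num *: (x : V) + (1 - t%:num) *: (y : V))//.
  rewrite !mxE /unstable.onem.
  by rewrite le_eqVlt; apply/orP; left; apply/eqP; ring.
apply/eqP; rewrite eq_le; have := half 1; rewrite !mul1r => -> /=.
by have := half (-1); rewrite !mulN1r lerN2.
Qed.

Variables (c : V * V -> R) (L : R).
Hypothesis cL : forall z w, (body K `*` body K) z -> (body K `*` body K) w ->
  c z <= c w + L * `|z - w|.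

Lemma cost_cont : {within body K `*` body K, continuous c}.
Proof. exact: within_lipschitz cL. Qed.

Lemma cost_bm d (T : measurableType d) (X Y : T -> V) : borel_fun X -> borel_fun Y ->
  (forall t, body K (X t)) -> (forall t, body K (Y t)) -> bm (fun t => c (X t, Y t)).
Proof. by move=> bX bY KX KY; exact: (bm_joint (@body_compact _ _ K) cost_cont bX bY KX KY). Qed.

Lemma cost_cont2 x : body K x -> {within K, continuous (fun y => c (x, y))}.
Proof.
move=> Kx; apply: (@within_lipschitz _ _ _ _ L) => y y' Ky Ky'.
have := cL (conj Kx Ky : (body K `*` body K) (x, y)) (conj Kx Ky' : (body K `*` body K) (x, y')).
rewrite (_ : (x, y) - (x, y') = (0, y - y')); last by congr pair; rewrite /= subrr.
by rewrite [X in _ <= _ + L * X]prod_normE /= normr0 max_r.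
Qed.

Lemma cost_lip1 x x' y : body K x -> body K x' -> body K y ->
  c (x, y) <= c (x', y) + L * `|x - x'|.
Proof.
move=> Kx Kx' Ky.
have := cL (conj Kx Ky : (body K `*` body K) (x, y)) (conj Kx' Ky : (body K `*` body K) (x', y)).
rewrite (_ : (x, y) - (x', y) = (x - x', 0)); last by congr pair; rewrite /= subrr.
by rewrite [X in _ <= _ + L * X]prod_normE /= normr0 max_l.
Qed.

Lemma within_dist z : {within K, continuous (fun x : V => `|x - z|)}.
Proof.
apply: (@within_lipschitz _ _ _ _ 1) => x y _ _; rewrite mul1r [leRHS]addrC.
by have := ler_normD (x - y) (y - z); rewrite subrKA.
Qed.

Local Notation product_cost xi1 xi2 :=
  (mean ((xi1 : PrK) \x (xi2 : PrK))%E (fun p => c (coords p.1, coords p.2))).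

Lemma bm_product_cost : bm (fun p : borel (point_of K) * borel (point_of K) =>
  c (coords p.1, coords p.2)).
Proof.
have bc := @borel_coords _ _ K.
apply: (@cost_bm _ (borel (point_of K) * borel (point_of K))%type
  (fun p => coords p.1) (fun p => coords p.2)).
- move=> U oU; rewrite -[_ @^-1` _]setTI.
  exact: (@measurable_fst _ _ (borel (point_of K)) (borel (point_of K)) measurableT _ (bc _ oU)).
- move=> U oU; rewrite -[_ @^-1` _]setTI.
  exact: (@measurable_snd _ _ (borel (point_of K)) (borel (point_of K)) measurableT _ (bc _ oU)).
- by move=> p; exact: coordsP.
- by move=> p; exact: coordsP.
Qed.

(** The first argument of [c] is moved to [z] at the price of the Lipschitz bound. The right-hand
    side integrates each component separately, so it depends continuously on the pair in the weak
    topology. *)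
Lemma product_cost_le (xi1 xi2 : PrK) z : body K z -> product_cost xi1 xi2 <=
  mean xi2 (fun y => c (z, coords y)) + L * mean xi1 (fun x => `|coords x - z|).
Proof.
move=> Kz; have b2 := bm_contOn (cost_cont2 Kz); have b1 := bm_contOn (@within_dist z).
rewrite -meanZ// -(mean_product_snd xi1 xi2 b2) -(mean_product_fst xi1 xi2 (bmM (bm_cst _ L) b1)).
have bs := @bm_snd _ (borel (point_of K)) _ (borel (point_of K)) _ _ b2.
have bf := @bm_fst _ (borel (point_of K)) _ (borel (point_of K)) _ _ (bmM (bm_cst _ L) b1).
rewrite -meanD; [|exact: bs|exact: bf].
apply: le_mean; first exact: bm_product_cost.
  by apply: bmD; [exact: bs|exact: bf].
by move=> p; apply: cost_lip1 => //; exact: coordsP.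
Qed.

(** The distance to the atom [x] has mean zero under the first component, so the Lipschitz bounds in
    both directions collapse the product integral. *)
Lemma extreme_dirac (xi : weakProb K * weakProb K) : extreme_pairs xi ->
  exists x, [/\ body K x, forall g : V -> R, {within K, continuous g} ->
      mean (xi.1 : PrK) (fun z => g (coords z)) = g x,
    forall i, mean (xi.2 : PrK) (fun z => coords z ord0 i) = x ord0 i &
    product_cost xi.1 xi.2 = mean (xi.2 : PrK) (fun y => c (x, coords y))].
Proof.
move=> exi; have [x Kx xi1] := zero_one_dirac (fun A mA => extreme_indic exi mA).
exists x; split => //.
  move=> i; rewrite -(xi1 (fun v => v ord0 i)); last exact: within_coord.
  by rewrite (convex_order_coord i exi.1).
apply/eqP; rewrite eq_le; have b2 := bm_contOn (cost_cont2 Kx); have cd := @within_dist x.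
have := product_cost_le xi.1 xi.2 Kx; rewrite (xi1 _ cd) subrr normr0 mulr0 addr0 => -> /=.
have b1 := bmM (bm_cst _ (- L)) (bm_contOn cd).
have bs := @bm_snd _ (borel (point_of K)) _ (borel (point_of K)) _ _ b2.
have bf := @bm_fst _ (borel (point_of K)) _ (borel (point_of K)) _ _ b1.
have <- : mean (xi.2 : PrK) (fun y => c (x, coords y)) + mean (xi.1 : PrK)
    (fun z => - L * `|coords z - x|) = mean (xi.2 : PrK) (fun y => c (x, coords y)).
  by rewrite meanZ ?(xi1 _ cd) ?subrr ?normr0 ?mulr0 ?addr0//; exact: (bm_contOn cd).
rewrite -(mean_product_snd xi.1 xi.2 b2) -(mean_product_fst xi.1 xi.2 b1).
rewrite -meanD; [|exact: bs|exact: bf].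
apply: le_mean; [by apply: bmD; [exact: bs|exact: bf]|exact: bm_product_cost|].
move=> p; have := cost_lip1 Kx (coordsP p.1) (coordsP p.2); rewrite distrC; lra.
Qed.

(** The constant start [x], followed by a draw from the second component, is a martingale because
    that component has barycentre [x]. *)
Lemma extreme_inequality (xi : weakProb K * weakProb K) (f : contOn K * contOn K) :
  extreme_pairs xi -> admissible c f ->
  mean (xi.1 : PrK) (fun x => f.1 (coords x)) - mean (xi.2 : PrK) (fun x => f.2 (coords x)) <=
  product_cost xi.1 xi.2.
Proof.
move=> exi fc; have [x [Kx xi1 xi2 ->]] := extreme_dirac exi.
rewrite xi1; last exact: contOn_continuous.
have bX : borel_fun (fun _ : borel (point_of K) => x).
  move=> U oU; have [Ux|Ux] := pselect (U x).
    by rewrite (_ : _ @^-1` _ = setT)//; apply/seteqP; split.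
  by rewrite (_ : _ @^-1` _ = set0)//; apply/seteqP; split.
have := @martingale_inequality _ _ _ xi.2 _ _ (@body_compact _ _ K) (@body_convex _ _ K)
  (fun=> x) (@coords _ _ K) bX (@borel_coords _ _ K) (fun=> Kx) (@coordsP _ _ K) _
  f.1 f.2 c (contOn_continuous (c:=f.1)) (contOn_continuous (c:=f.2)) cost_cont fc.
rewrite (_ : f.1 \o _ = fun=> f.1 x)// mean_cst; apply => i B mB.
by rewrite !mean_cst meanZ ?xi2//; exact: bm_contOn (@within_coord _ _ K i).
Qed.

End extreme_cost.

(** * The weak topology on extreme pairs *)

Section weak_topology.
Variables (R : realType) (n : nat) (K : convexBody R n).
Local Notation V := 'rV[R]_n.
Local Notation PrK := (probability (borel (point_of K)) R).
Local Notation bm := bounded_measurable.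

Lemma weak_mean_continuous (g : contOn K) :
  continuous (fun m : weakProb K => mean (m : PrK) (fun x => g (coords x))).
Proof.
move=> m.
pose w (mu : PrK) : {ptws contOn K -> R} := fun g : contOn K => mean mu (fun x => g (coords x)).
have c1 : {for m, continuous (w : weakProb K -> _)} by exact: initial_continuous.
exact: (continuous_comp c1 (@proj_continuous (contOn K) (fun=> R) g _)).
Qed.

Lemma mean_le_bound (m : PrK) (h : borel (point_of K) -> R) M : bm h ->
  (forall x, `|h x| <= M) -> `|mean m h| <= M.
Proof.
move=> bh hM; have := @mean_dist _ _ _ m h (fun=> 0) M bh (bm_cst _ _).
by rewrite mean_cst subr0; apply => x; rewrite subr0.
Qed.

Lemma continuous_extreme_fst (g : V -> R) : {within K, continuous g} ->
  continuous (fun xi : extremePair K => mean (extreme_fst xi) (fun x => g (coords x))).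
Proof.
move=> cg xi.
have c1 : {for xi, continuous (set_val : extremePair K -> _)} by exact: initial_continuous.
have c2 : {for set_val xi, continuous (fun z : weakProb K * weakProb K => z.1)} by exact: cvg_fst.
have c3 := continuous_comp c1 c2.
exact: (@continuous_comp _ _ _ ((fun z => z.1) \o set_val : extremePair K -> weakProb K) _ xi c3
  (@weak_mean_continuous (ContOn cg) _)).
Qed.

Lemma continuous_extreme_snd (g : V -> R) : {within K, continuous g} ->
  continuous (fun xi : extremePair K => mean (extreme_snd xi) (fun x => g (coords x))).
Proof.
move=> cg xi.
have c1 : {for xi, continuous (set_val : extremePair K -> _)} by exact: initial_continuous.
have c2 : {for set_val xi, continuous (fun z : weakProb K * weakProb K => z.2)} by exact: cvg_snd.
have c3 := continuous_comp c1 c2.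
exact: (@continuous_comp _ _ _ ((fun z => z.2) \o set_val : extremePair K -> weakProb K) _ xi c3
  (@weak_mean_continuous (ContOn cg) _)).
Qed.

Lemma continuous_measurable_borel (h : extremePair K -> R) :
  continuous h -> measurable_fun setT (h : borel (extremePair K) -> R).
Proof.
move=> ch.
have bid : borel_fun (id : borel (extremePair K) -> extremePair K).
  by move=> U oU; exact: sub_sigma_algebra.
have cT : {within setT, continuous h} by exact: continuous_subspaceT.
exact: (borel_fun_within (h := h) bid (fun=> I) cT).
Qed.

Lemma bm_extreme_fst (g : V -> R) : {within K, continuous g} ->
  bm (fun xi : borel (extremePair K) => mean (extreme_fst xi) (fun x => g (coords x))).
Proof.
move=> cg; split; first exact: continuous_measurable_borel (continuous_extreme_fst cg).
have [M gM] := within_bounded (@body_compact _ _ K) cg.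
by exists M => xi; apply: mean_le_bound; [exact: bm_contOn|move=> x; apply: gM; exact: coordsP].
Qed.

Lemma bm_extreme_snd (g : V -> R) : {within K, continuous g} ->
  bm (fun xi : borel (extremePair K) => mean (extreme_snd xi) (fun x => g (coords x))).
Proof.
move=> cg; split; first exact: continuous_measurable_borel (continuous_extreme_snd cg).
have [M gM] := within_bounded (@body_compact _ _ K) cg.
by exists M => xi; apply: mean_le_bound; [exact: bm_contOn|move=> x; apply: gM; exact: coordsP].
Qed.

Variables (c : V * V -> R) (L : R).
Hypothesis cL : forall z w, (body K `*` body K) z -> (body K `*` body K) w ->
  c z <= c w + L * `|z - w|.

Definition product_cost (xi : extremePair K) :=
  mean (extreme_fst xi \x extreme_snd xi)%E (fun p => c (coords p.1, coords p.2)).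

(* The first component of an extreme pair is a Dirac mass at some [z], at which
   the bound [product_cost_le] is attained. *)
Lemma bm_extreme_cost : bm (product_cost : borel (extremePair K) -> R).
Proof.
have bc := bm_product_cost cL.
split; last first.
  have [M cM] := within_bounded (compact_setX (@body_compact _ _ K) (@body_compact _ _ K)) (cost_cont cL).
  exists M => xi; have := @mean_dist _ _ _ (extreme_fst xi \x extreme_snd xi)%E _ (fun=> 0) M bc (bm_cst _ _).
  rewrite mean_cst subr0; apply => p; rewrite subr0; apply: cM.
  by split; exact: coordsP.
apply: (measurability _ (RGenInftyO.measurableE R)).
move=> /= _ [_ [a ->]] <-; rewrite setTI.
pose bound z (xi : extremePair K) := mean (extreme_snd xi) (fun y => c (z, coords y)) +
  L * mean (extreme_fst xi) (fun x => `|coords x - z|).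
(* The cost is the minimum over [z] of continuous functions, so its strict sublevel sets are unions
   of open sets and [z] need not be chosen measurably. *)
rewrite (_ : _ @^-1` _ = \bigcup_(z in body K) (bound z @^-1` `]-oo, a[%classic)).
  apply: sub_sigma_algebra; apply: bigcup_open => z Kz.
  apply: open_comp (lray_open a) => xi _.
  have cs := @continuous_extreme_snd _ (cost_cont2 cL Kz) xi.
  have cf := @continuous_extreme_fst _ (@within_dist _ _ K z) xi.
  exact: (cvgD cs (cvgM (cvg_cst L) cf)).
apply/seteqP; split => xi /=; rewrite in_itv /=.
  have [x [Kx xi1 xi2 xiE]] := extreme_dirac cL (set_valP xi).
  move=> h; exists x => //=; rewrite in_itv /= (le_lt_trans _ h)//.
  rewrite /bound (xi1 _ (@within_dist _ _ K x)) subrr normr0 mulr0 addr0.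
  by rewrite /product_cost xiE.
move=> [z Kz /=]; rewrite in_itv /=; apply: le_lt_trans.
exact: (product_cost_le cL).
Qed.

Lemma extreme_costE (pi : probability (borel (extremePair K)) R) :
  extreme_cost c pi = (mean pi product_cost)%:E.
Proof.
rewrite -(meanE pi bm_extreme_cost); apply: eq_integral => xi _.
by rewrite (meanE _ (bm_product_cost cL)).
Qed.

Lemma representingP (mu nu : PrK) (pi : probability (borel (extremePair K)) R) :
  representing mu nu pi <-> forall g : V -> R, {within K, continuous g} ->
  mean mu (fun x => g (coords x)) =
    mean pi (fun xi => mean (extreme_fst xi) (fun x => g (coords x))) /\
  mean nu (fun x => g (coords x)) =
    mean pi (fun xi => mean (extreme_snd xi) (fun x => g (coords x))).
Proof.
have e1 (g : contOn K) : (\int[pi]_xi \int[extreme_fst xi]_x (g (coords x))%:E =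
    (mean pi (fun xi => mean (extreme_fst xi) (fun x => g (coords x))))%:E)%E.
  rewrite -(meanE pi (bm_extreme_fst (contOn_continuous (c:=g)))).
  by apply: eq_integral => xi _; rewrite integral_contOn.
have e2 (g : contOn K) : (\int[pi]_xi \int[extreme_snd xi]_x (g (coords x))%:E =
    (mean pi (fun xi => mean (extreme_snd xi) (fun x => g (coords x))))%:E)%E.
  rewrite -(meanE pi (bm_extreme_snd (contOn_continuous (c:=g)))).
  by apply: eq_integral => xi _; rewrite integral_contOn.
split => [H g cg|H g].
  by have := H (ContOn cg); rewrite e1 e2 !integral_contOn => -[[->] [->]].
by rewrite e1 e2 !integral_contOn; have [-> ->] := H g (contOn_continuous (c:=g)).
Qed.

Lemma weak_duality (mu nu : PrK) pi (f : contOn K * contOn K) : representing mu nu pi ->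
  admissible c f ->
  mean mu (fun x => f.1 (coords x)) - mean nu (fun x => f.2 (coords x)) <= mean pi product_cost.
Proof.
move=> /representingP Hpi fc; have cf1 := contOn_continuous (c:=f.1).
have cf2 := contOn_continuous (c:=f.2).
rewrite (Hpi _ cf1).1 (Hpi _ cf2).2 -meanB; [|exact: bm_extreme_fst|exact: bm_extreme_snd].
apply: le_mean; last by move=> xi; exact: (extreme_inequality cL (set_valP xi) fc).
  by apply: bmB; [exact: bm_extreme_fst|exact: bm_extreme_snd].
exact: bm_extreme_cost.
Qed.

End weak_topology.

(** * Finitely supported measures *)

Section finite_probability.
Context d (T : measurableType d) (R : realType).
Local Notation bm := bounded_measurable.

Lemma finite_probability m (l : 'I_m.+1 -> R) (x : 'I_m.+1 -> T) :
  (forall i, 0 <= l i) -> \sum_i l i = 1 ->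
  exists P : probability T R, forall h, bm h -> mean P h = \sum_i l i * h (x i).
Proof.
move=> l0 l1.
pose mu := msum (fun k => mscale (NngNum (l0 (inord k))) (\d_(x (inord k)))) m.+1.
have muE A : mu A = (\sum_i l i * \1_A (x i))%:E.
  rewrite /mu /msum /= sumEFin; congr EFin; apply: eq_bigr => i _.
  by rewrite inord_val.
have mu1 : mu setT = 1%E.
  rewrite muE -[in RHS]l1; congr EFin; apply: eq_bigr => i _.
  by rewrite indicE in_setT mulr1.
pose P : probability T R := HB.pack mu (Measure_isProbability.Build _ _ _ mu mu1).
exists P => h bh.
symmetry; apply: (@mean_unique _ _ _ P (fun h => \sum_i l i * h (x i)) 1) => //.
  move=> k a B mB; rewrite (eq_bigr (fun i => \sum_j a j * (l i * \1_(B j) (x i)))); last first.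
    by move=> i _; rewrite mulr_sumr; apply: eq_bigr => j _; ring.
  rewrite exchange_big; apply: eq_bigr => j _; rewrite -mulr_sumr; congr (_ * _).
  by rewrite mean_indic// -[P (B j)]/(mu (B j)) muE.
move=> g g' e _ _ e0 gg'; rewrite -sumrB; apply: (le_trans (ler_norm_sum _ _ _)).
rewrite -[in leRHS]l1 mulr_suml; apply: ler_sum => i _.
by rewrite -mulrBr normrM ger0_norm// ler_wpM2l.
Qed.

Lemma same_measure_mean (a b : probability T R) :
  (forall A, measurable A -> a A = b A) -> forall h, bm h -> mean a h = mean b h.
Proof.
move=> ab h bh; rewrite (@mean_transfer _ _ _ _ _ b a id (fun=> 1)) //.
- by congr mean; apply/funext => t; rewrite mul1r.
- exact: bm_cst.
- move=> B mB; rewrite mean_indic// ab// -mean_indic//.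
  by congr mean; apply/funext => t; rewrite mul1r.
Qed.

Lemma mixture_mean (m a b : probability T R) (s : R) : 0 <= s <= 1 ->
  (forall A, measurable A -> m A = s%:E * a A + (1 - s)%:E * b A)%E ->
  forall h, bm h -> mean m h = s * mean a h + (1 - s) * mean b h.
Proof.
move=> /andP[s0 s1] mE h bh.
symmetry; apply: (@mean_unique _ _ _ m (fun h => s * mean a h + (1 - s) * mean b h) 1) => //.
  move=> k c B mB; have bB j : bm (fun t => c j * \1_(B j) t).
    by apply: bmM; [exact: bm_cst|exact: bm_indic].
  rewrite !mean_sum// !mulr_sumr -big_split/=; apply: eq_bigr => j _.
  rewrite !meanZ; [|exact: bm_indic..].
  rewrite mulrCA [X in _ + X]mulrCA -mulrDr; congr (_ * _).
  by have := mE _ (mB j); rewrite !measure_mean// => -[->].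
move=> g g' e bg bg' e0 gg'; rewrite mul1r.
rewrite (_ : _ - _ = s * (mean a g - mean a g') + (1 - s) * (mean b g - mean b g')); last by ring.
have h1 : `|mean a g - mean a g'| <= e by apply: mean_dist.
have h2 : `|mean b g - mean b g'| <= e by apply: mean_dist.
have s1' : 0 <= 1 - s by rewrite subr_ge0.
apply: (le_trans (ler_normD _ _)); rewrite !normrM (ger0_norm s0) (ger0_norm s1').
apply: (le_trans (lerD (ler_wpM2l s0 h1) (ler_wpM2l s1' h2))).
by rewrite -mulrDl subrKC mul1r.
Qed.

End finite_probability.

(** A quantitative substitute for vanishing almost everywhere. *)
Lemma mean_dominated_eq0 d (T : measurableType d) (R : realType) (a : probability T R)
    (g h : T -> R) M : bounded_measurable g -> bounded_measurable h ->
  mean a (fun t => `|g t|) = 0 -> (forall t, `|h t| <= M * `|g t|) -> mean a h = 0.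
Proof.
move=> bg bh g0 hg; have bMg := bmM (bm_cst T M) (bm_norm bg).
apply/eqP; rewrite -normr_le0 ler_norml oppr0.
have e : mean a (fun t => M * `|g t|) = 0 by rewrite meanZ ?g0 ?mulr0//; exact: bm_norm.
apply/andP; split.
  rewrite -[leLHS]oppr0 -e -meanN//; apply: le_mean => //; first exact: bmN.
  by move=> t; rewrite lerNl (le_trans _ (hg t))// -normrN ler_norm.
by rewrite -e; apply: le_mean => // t; rewrite (le_trans (ler_norm _))// hg.
Qed.

(* The function [kappa] below is [1] at the [x i] of positive mass and [0]
   elsewhere, so that both parts of the mixture are carried by [kappa = 1]. *)
Lemma finite_mixture d (T : measurableType d) (R : realType) m
    (l : 'I_m -> R) (x : 'I_m -> T) (nu : probability T R) (s : R)
    (a b : probability T R) :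
  (forall y : T, measurable [set y]) -> (forall i, 0 <= l i) ->
  (forall h, bounded_measurable h -> mean nu h = \sum_i l i * h (x i)) ->
  0 < s < 1 ->
  (forall A, measurable A -> nu A = s%:E * a A + (1 - s)%:E * b A)%E ->
  exists la lb : 'I_m -> R, [/\ forall i, 0 <= la i, forall i, 0 <= lb i,
    forall i, l i = s * la i + (1 - s) * lb i,
    forall h, bounded_measurable h -> mean a h = \sum_i la i * h (x i) &
    forall h, bounded_measurable h -> mean b h = \sum_i lb i * h (x i)].
Proof.
move=> mx l0 nuE /andP[s0 s1] nuab.
have s01 : 0 <= s <= 1 by rewrite !ltW.
have mixE := mixture_mean s01 nuab.
pose N i := mean nu \1_[set x i].
have bx i : bounded_measurable (\1_[set x i] : T -> R) by exact: bm_indic.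
have N_ge i : l i <= N i.
  rewrite /N nuE// (bigD1 i)//= indicE mem_set// mulr1 lerDl.
  by apply: sumr_ge0 => j _; rewrite mulr_ge0// indicE.
(* Nodes may coincide, and [N i] is the total mass of the point [x i]. So [w i] is the share of
   index [i] in it, equal to 0 when the point has no mass. *)
pose w i := l i / N i.
have w0 i : 0 <= w i by rewrite divr_ge0// (le_trans (l0 i)).
have wN i : w i * N i = l i.
  rewrite /w; have [N0|N0] := eqVneq (N i) 0; last by rewrite divfK.
  by rewrite N0 mulr0; apply/esym/eqP; rewrite eq_le l0 -N0 N_ge.
pose kappa y : R := \sum_i w i * \1_[set x i] y.
have bk : bounded_measurable kappa.
  by apply: bm_sum => i; apply: bmM => //; exact: bm_cst.
have bk1 : bounded_measurable (fun y => 1 - kappa y) by apply: bmB => //; exact: bm_cst.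
have kappa1 j : l j != 0 -> kappa (x j) = 1.
  move=> lj; have Nj : N j != 0.
    by apply: contra lj => /eqP Nj; rewrite eq_le l0 -Nj N_ge.
  rewrite /kappa (eq_bigr (fun i => (N j)^-1 * (l i * \1_[set x j] (x i)))).
    by rewrite -mulr_sumr -nuE// mulVf.
  move=> i _; have [xij|xij] := pselect (x i = x j).
    have Nij : N i = N j by rewrite /N xij.
    by rewrite /w Nij xij !indicE !mem_set// !mulr1 mulrC.
  by rewrite !indicE !memNset ?mulr0//= => /esym.
have nuk : mean nu (fun y => `|1 - kappa y|) = 0.
  rewrite nuE; last exact: bm_norm.
  rewrite big1// => j _; have [->|lj] := eqVneq (l j) 0; first by rewrite mul0r.
  by rewrite kappa1// subrr normr0 mulr0.
have [ak bk0] : mean a (fun y => `|1 - kappa y|) = 0 /\ mean b (fun y => `|1 - kappa y|) = 0.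
  have := mixE _ (bm_norm bk1); rewrite nuk => /esym/eqP.
  have ha : 0 <= mean a (fun y => `|1 - kappa y|) by exact: mean_ge0.
  have hb : 0 <= mean b (fun y => `|1 - kappa y|) by exact: mean_ge0.
  have s1' : 0 < 1 - s by rewrite subr_gt0.
  rewrite paddr_eq0 ?mulr_ge0// ?ltW// !mulf_eq0 (gt_eqF s0) (gt_eqF s1') /=.
  by move=> /andP[/eqP -> /eqP ->].
have concl (p : probability T R) : mean p (fun y => `|1 - kappa y|) = 0 ->
    forall h, bounded_measurable h -> mean p h = \sum_i (w i * mean p \1_[set x i]) * h (x i).
  move=> pk h bh; have bhk := bmM bh bk.
  have [_ [M hM]] := bh.
  have : mean p (fun y => h y * (1 - kappa y)) = 0.
    apply: (mean_dominated_eq0 (M := M) bk1 _ pk); first exact: bmM.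
    by move=> t; rewrite normrM ler_wpM2r.
  rewrite (_ : (fun y => _) = fun y => h y - h y * kappa y); last first.
    by apply/funext => y; ring.
  rewrite meanB// => /eqP; rewrite subr_eq0 => /eqP ->.
  rewrite (_ : (fun y => _) = fun y => \sum_i (w i * h (x i)) * \1_[set x i] y).
    rewrite mean_sum; last by move=> i; apply: bmM => //; exact: bm_cst.
    by apply: eq_bigr => i _; rewrite meanZ//; ring.
  apply/funext => y; rewrite mulr_sumr; apply: eq_bigr => i _.
  rewrite indicE; have [->|xy] := pselect (y = x i); first by ring.
  by rewrite memNset//= !mulr0.
exists (fun i => w i * mean a \1_[set x i]), (fun i => w i * mean b \1_[set x i]); split.
- by move=> i; rewrite mulr_ge0// mean_ge0// => y; rewrite indicE.
- by move=> i; rewrite mulr_ge0// mean_ge0// => y; rewrite indicE.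
- by move=> i; rewrite -[LHS]wN /N mixE//; ring.
- exact: concl.
- exact: concl.
Qed.

(** The defect in the convexity inequality is [s * (1 - s)] times the sum of the squares of
    [a i - b i]. *)
Lemma sum_sq_strictly_convex (R : realType) m (a b l : 'I_m -> R) (s : R) : 0 < s < 1 ->
  (forall i, l i = s * a i + (1 - s) * b i) ->
  s * (\sum_i a i ^+ 2) + (1 - s) * (\sum_i b i ^+ 2) <= \sum_i l i ^+ 2 ->
  forall i, a i = b i.
Proof.
move=> /andP[s0 s1] lE; rewrite -subr_le0.
rewrite (_ : _ - _ = \sum_i (s * (1 - s)) * (a i - b i) ^+ 2); last first.
  rewrite !mulr_sumr -big_split/= -sumrB; apply: eq_bigr => i _; rewrite lE; ring.
have s2 : 0 < s * (1 - s) by rewrite mulr_gt0// subr_gt0.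
have pos i : true -> 0 <= s * (1 - s) * (a i - b i) ^+ 2.
  by move=> _; rewrite mulr_ge0 ?sqr_ge0// ltW.
move=> le0; have /psumr_eq0P : \sum_i (s * (1 - s)) * (a i - b i) ^+ 2 = 0.
  by apply/eqP; rewrite eq_le le0 sumr_ge0.
move=> /(_ pos) H i; have /eqP := H i isT.
by rewrite mulf_eq0 (gt_eqF s2)/= sqrf_eq0 subr_eq0 => /eqP.
Qed.

Section finite_pairs.
Variables (R : realType) (n : nat) (K : convexBody R n).
Local Notation V := 'rV[R]_n.
Local Notation PrK := (probability (borel (point_of K)) R).
Local Notation bm := bounded_measurable.

Lemma weak_continuous (W : topologicalType) (F : W -> weakProb K) :
  (forall g : V -> R, {within K, continuous g} ->
    continuous (fun x => mean (F x : PrK) (fun z => g (coords z)))) -> continuous F.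
Proof.
move=> cF; apply: continuous_comp_initial => x; apply/cvg_sup => i.
move: x; apply/(@continuousP _ (initial_topology (@^~ i))) => A [B oB <-].
exact: (open_comp (fun x _ => cF i (@contOn_continuous _ _ _ i) x) oB).
Qed.

Lemma measurable_point (y : borel (point_of K)) : measurable [set y].
Proof.
have -> : [set y] = @coords R n K @^-1` [set coords y].
  apply/seteqP; split => [z ->//|z /= zy].
  by rewrite -(coordsK z) zy coordsK.
apply: (borel_fun_sigma (@borel_coords _ _ K)).
pose V' : ptopologicalType := HB.pack V (isPointed.Build V 0).
rewrite -[X in <<s _ >> X]setCK.
apply: (@measurableC _ (g_sigma_algebraType (@open V'))).
apply: sub_sigma_algebra; rewrite /= openC.
exact: (accessible_closed_set1 (hausdorff_accessible (@norm_hausdorff _ V))).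
Qed.

Lemma mean_dirac (y : borel (point_of K)) h : bm h -> mean (\d_y : PrK) h = h y.
Proof.
move=> [mh _]; rewrite /mean /Rintegral integral_dirac ?diracT ?mul1e//.
by apply/measurable_EFinP.
Qed.

(** Both parts of a splitting start from the same Dirac mass and are carried by the same nodes. They
    amount to a splitting of the weights with unchanged barycentre, which the last hypothesis
    excludes. *)
Lemma finite_extreme (l : 'I_n.+1 -> R) (x : 'I_n.+1 -> V) (nu : PrK) :
  (forall i, 0 <= l i) -> \sum_i l i = 1 -> (forall i, body K (x i)) ->
  (forall h, bm h -> mean nu h = \sum_i l i * h (to_point K (x i))) ->
  (forall (la lb : 'I_n.+1 -> R) (s : R), 0 < s < 1 ->
    (forall i, 0 <= la i) -> (forall i, 0 <= lb i) ->
    \sum_i la i = 1 -> \sum_i lb i = 1 ->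
    \sum_i la i *: x i = \sum_i l i *: x i -> \sum_i lb i *: x i = \sum_i l i *: x i ->
    (forall i, l i = s * la i + (1 - s) * lb i) -> forall i, la i = lb i) ->
  extreme_pairs ((\d_(to_point K (\sum_i l i *: x i) : borel (point_of K)) : PrK), nu).
Proof.
move=> l0 l1 Kx nuE lext; set b := \sum_i l i *: x i.
have Kb : body K b.
  by apply: convex_set_sum => // *; apply: convex_setE => //; exact: (@body_convex _ _ K).
split=> [g gconv|a b' s oa ob s01 mix1 mix2] /=.
  have bg := bm_contOn (@contOn_continuous _ _ _ g).
  rewrite !integral_contOn lee_fin mean_dirac// nuE// to_pointK//.
  rewrite [leRHS](eq_bigr (fun i => l i * g (x i))); last by move=> i _; rewrite to_pointK.
  exact: (jensen (@body_convex _ _ K)).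
have s01' : 0 < 1 - s < 1.
  by case/andP: s01 => s0 s1; rewrite subr_gt0 s1 ltrBlDr ltrDl s0.
have sw (m c d : PrK) : is_mixture s m c d -> is_mixture (1 - s) m d c.
  by move=> h A mA; rewrite h// opprB addrCA subrr addr0 addeC.
have a1 := dirac_extremal s01 mix1.
have b1 := dirac_extremal s01' (sw _ _ _ mix1).
split; first by move=> A mA; rewrite a1// b1.
have [la [lb [la0 lb0 lE aE bE]]] := finite_mixture measurable_point l0 nuE s01 mix2.
have sum1 (m : PrK) (w : 'I_n.+1 -> R) :
    (forall h, bm h -> mean m h = \sum_i w i * h (to_point K (x i))) -> \sum_i w i = 1.
  move=> mE; rewrite -(mean_cst m 1) mE; last exact: bm_cst.
  by apply: eq_bigr => i _; rewrite mulr1.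
have bary (m1 m2 : PrK) (w : 'I_n.+1 -> R) : convex_order m1 m2 ->
    same_measure m1 (\d_(to_point K b : borel (point_of K)) : PrK) ->
    (forall h, bm h -> mean m2 h = \sum_i w i * h (to_point K (x i))) ->
    \sum_i w i *: x i = b.
  move=> m12 m1b m2E; apply/rowP => k.
  have bk := bm_contOn (@within_coord _ _ K k).
  have := convex_order_coord k m12; rewrite (same_measure_mean m1b bk) mean_dirac// m2E//.
  rewrite to_pointK// => ->; rewrite summxE; apply: eq_bigr => i _.
  by rewrite mxE to_pointK.
have lab := lext la lb s s01 la0 lb0 (sum1 _ _ aE) (sum1 _ _ bE)
  (bary _ _ _ oa a1 aE) (bary _ _ _ ob b1 bE) lE.
move=> A mA; rewrite !measure_mean//; congr EFin.
rewrite aE ?bE; [|exact: bm_indic|exact: bm_indic].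
by apply: eq_bigr => i _; rewrite lab.
Qed.

Lemma extreme_product_cost (c : V * V -> R) L (xi : extremePair K) (b : V) :
  (forall z w, (body K `*` body K) z -> (body K `*` body K) w -> c z <= c w + L * `|z - w|) ->
  body K b ->
  (forall g : V -> R, {within K, continuous g} ->
    mean (extreme_fst xi) (fun z => g (coords z)) = g b) ->
  product_cost c xi = mean (extreme_snd xi) (fun y => c (b, coords y)).
Proof.
move=> cL Kb xib; have [x [Kx xi1 xi2 xiE]] := extreme_dirac cL (set_valP xi).
suff -> : b = x by exact: xiE.
apply/rowP => k; have ck := @within_coord _ _ K k.
by rewrite -(xib _ ck) -(xi1 _ ck).
Qed.

End finite_pairs.

Lemma entry_continuous (R : realType) (V : pseudoMetricType R) m n i j :
  continuous (fun A : 'M[V]_(m, n) => A i j).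
Proof.
move=> A B /nbhs_ballP[e /= e0 eB]; apply/nbhs_ballP; exists e => //= A' [_ AA'].
exact/eB/AA'.
Qed.

Lemma continuous_sum (W : topologicalType) (R : realType) (V : normedModType R)
    (I : Type) (s : seq I) (g : I -> W -> V) :
  (forall i, continuous (g i)) -> continuous (fun x => \sum_(i <- s) g i x).
Proof.
move=> cg; elim: s => [|i s ih].
  rewrite (_ : (fun=> _) = fun=> 0); first by move=> x; exact: cvg_cst.
  by apply/funext => x; rewrite big_nil.
rewrite (_ : (fun x => _) = fun x => g i x + \sum_(j <- s) g j x).
  by move=> x; apply: cvgD; [exact: cg|exact: ih].
by apply/funext => x; rewrite big_cons.
Qed.

Lemma hausdorff_separated (R : realType) (W : topologicalType) :
  (forall x y : W, x != y -> exists2 f : W -> R, continuous f & f x != f y) ->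
  hausdorff_space W.
Proof.
move=> sep; rewrite open_hausdorff => x y /sep[f cf].
have := @norm_hausdorff R R^o; rewrite open_hausdorff => /[apply] -[[A B]] /=.
move=> [/set_mem Ax /set_mem By] [oA oB /eqP AB].
exists (f @^-1` A, f @^-1` B); first by split; exact: mem_set.
split; [exact: open_comp (fun x _ => cf x) oA|exact: open_comp (fun x _ => cf x) oB|].
by rewrite -preimage_setI AB preimage_set0.
Qed.

(** * The representing measure *)

Section configurations.
Variables (R : realType) (n : nat) (K : convexBody R n).
Local Notation V := 'rV[R]_n.

(* A choice of weights [l] and of nodes [x] as in the definition of
   [admissible]. *)
Definition configuration := ('rV[R]_n.+1 * 'rV['rV[R]_n]_n.+1)%type.

Definition weight i (s : configuration) : R := s.1 ord0 i.
Definition node i (s : configuration) : V := s.2 ord0 i.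
Definition centre (s : configuration) : V := \sum_i weight i s *: node i s.
Definition configurations : set configuration :=
  [set s | [/\ forall i, 0 <= weight i s, \sum_i weight i s = 1 &
    forall i, body K (node i s)]].

Lemma weight_continuous i : continuous (weight i).
Proof.
move=> s; have c1 : {for s, continuous (fst : configuration -> 'rV[R]_n.+1)} by exact: cvg_fst.
exact: (continuous_comp c1 (@coord_continuous _ _ _ ord0 i _)).
Qed.

Lemma node_continuous i : continuous (node i).
Proof.
move=> s; have c1 : {for s, continuous (snd : configuration -> 'rV[V]_n.+1)} by exact: cvg_snd.
exact: (continuous_comp c1 (@entry_continuous _ _ _ _ ord0 i _)).
Qed.

Lemma centre_continuous : continuous centre.
Proof.
apply: continuous_sum => i s; apply: cvgZ; [exact: weight_continuous|exact: node_continuous].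
Qed.

Lemma configuration_hausdorff : hausdorff_space configuration.
Proof.
apply: (@hausdorff_separated R) => -[l x] [l' x'] /= xx'.
have [ll'|ll'] := eqVneq l l'; last first.
  have [i li] : exists i, l ord0 i != l' ord0 i.
    apply: contrapT => nl; move/eqP: ll'; apply; apply/rowP => i.
    by apply/eqP; apply: contrapT => li; apply: nl; exists i; exact/negP.
  by exists (weight i) => //; exact: weight_continuous.
have [i [j xij]] : exists i j, x ord0 i ord0 j != x' ord0 i ord0 j.
  apply: contrapT => nx; move/eqP: xx'; apply; rewrite ll'; congr pair.
  apply/rowP => i; apply/rowP => j.
  by apply/eqP; apply: contrapT => li; apply: nx; exists i, j; exact/negP.
exists (fun s => node i s ord0 j) => // s.
exact: (continuous_comp (@node_continuous i s) (@coord_continuous _ _ _ ord0 j _)).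
Qed.

Lemma configurations_compact : compact configurations.
Proof.
pose V' : ptopologicalType := HB.pack V (isPointed.Build V 0).
have cl : compact [set l : 'rV[R]_n.+1 | forall i, `[0, 1]%classic (l ord0 i)].
  by apply: (@rV_compact R n.+1 (fun=> `[0, 1]%classic)) => i; exact: segment_compact.
have cx : compact [set x : 'rV[V]_n.+1 | forall i, body K (x ord0 i)].
  apply: (@rV_compact V' n.+1 (fun=> body K)) => i; exact: body_compact.
have -> : configurations = [set s | \sum_i weight i s = 1] `&`
   ([set l : 'rV[R]_n.+1 | forall i, `[0, 1]%classic (l ord0 i)] `*`
    [set x : 'rV[V]_n.+1 | forall i, body K (x ord0 i)]).
  apply/seteqP; split => [s [l0 l1 Kx]|s [l1 [/= ls xs]]].
    split => //; split => // i /=; rewrite in_itv /= l0 -l1 (bigD1 i)//= lerDl.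
    by apply: sumr_ge0 => j _; exact: l0.
  by split => // i; have := ls i; rewrite /= in_itv /= => /andP[].
rewrite setIC; apply: compact_closedI; first exact: compact_setX.
have cs : continuous (fun s : configuration => \sum_i weight i s : R^o).
  by apply: continuous_sum => i; exact: weight_continuous.
exact: (closed_comp (fun s _ => cs s) (@closed_eq R 1)).
Qed.

Lemma configurations_nonempty : configurations !=set0.
Proof.
exists (\row_i (i == ord0)%:R, \row_i coords (point : point_of K)); split.
- by move=> i; rewrite /weight mxE.
- rewrite (bigD1 ord0)//= big1 ?addr0 /weight ?mxE// => i /negPf i0.
  by rewrite mxE i0.
- by move=> i; rewrite /node mxE; exact: coordsP.
Qed.

Lemma centre_mem s : configurations s -> body K (centre s).
Proof.
move=> [l0 l1 Kx].
by apply: convex_set_sum => // *; apply: convex_setE => //; exact: (@body_convex _ _ K).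
Qed.

End configurations.

(** * Dual functions on configurations *)

Section second_problem.
Variables (R : realType) (n : nat) (K : convexBody R n).
Local Notation V := 'rV[R]_n.
Local Notation PrK := (probability (borel (point_of K)) R).
Local Notation bm := bounded_measurable.
Local Notation S := (configurations K).
Variables (c : V * V -> R).
Hypothesis cc : {within body K `*` body K, continuous c}.

Definition mean_cost (s : configuration R n) : R :=
  \sum_i weight i s * c (centre s, node i s).

(** [f1] and [f2] are the multipliers of the laws of the centre and of a random node, [t] that of
    the cost bound. The martingale property is built in, the centre being the mean of the nodes. *)
Definition dual_fun (f1 f2 : V -> R) (t : R) (s : configuration R n) : R :=
  f1 (centre s) - \sum_i weight i s * f2 (node i s) + t * mean_cost s.

Definition sq_weight (s : configuration R n) : R := \sum_i weight i s ^+ 2.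

Lemma within_weight i : {within S, continuous (weight i : configuration R n -> R)}.
Proof. by apply: continuous_subspaceT; exact: weight_continuous. Qed.

Lemma within_centre (f : V -> R) : {within K, continuous f} ->
  {within S, continuous (fun s => f (centre s))}.
Proof.
move=> cf; apply: (within_comp _ _ cf); last exact: centre_mem.
by apply: continuous_subspaceT; exact: centre_continuous.
Qed.

Lemma within_node (f : V -> R) i : {within K, continuous f} ->
  {within S, continuous (fun s => f (node i s))}.
Proof.
move=> cf; apply: (within_comp _ _ cf); last by move=> s [].
by apply: continuous_subspaceT; exact: node_continuous.
Qed.

Lemma within_mean_node (f : V -> R) : {within K, continuous f} ->
  {within S, continuous (fun s => \sum_i weight i s * f (node i s))}.
Proof.
by move=> cf; apply: within_sum => i; apply: withinM; [exact: within_weight|exact: within_node].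
Qed.

Lemma within_cost : {within S, continuous mean_cost}.
Proof.
apply: within_sum => i; apply: withinM; first exact: within_weight.
have cp : continuous (fun s : configuration R n => (centre s, node i s)).
  by move=> s; exact: (cvg_pair (@centre_continuous R n s) (@node_continuous R n i s)).
apply: (within_comp (continuous_subspaceT cp) _ cc) => s Ss.
by case: (Ss) => _ _ Kx; split; [exact: centre_mem|exact: Kx].
Qed.

Lemma within_dual_fun f1 f2 t : {within K, continuous f1} -> {within K, continuous f2} ->
  {within S, continuous (dual_fun f1 f2 t)}.
Proof.
move=> cf1 cf2; apply: withinD; first apply: withinB.
- exact: within_centre.
- exact: within_mean_node.
- by apply: withinM; [exact: within_cst|exact: within_cost].
Qed.

Lemma within_sq_weight : {within S, continuous sq_weight}.
Proof. by apply: within_sum => i; exact: (withinM (@within_weight i) (@within_weight i)). Qed.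

Lemma sq_weight_le1 s : S s -> sq_weight s <= 1.
Proof.
move=> [l0 l1 _]; rewrite -[leRHS]l1; apply: ler_sum => i _; rewrite expr2 ler_piMl//.
by rewrite -l1 (bigD1 i)//= lerDl; apply: sumr_ge0 => j _; exact: l0.
Qed.

Lemma dual_fun_affine f1 f2 t (s sa sb : configuration R n) u :
  (forall i, weight i s = u * weight i sa + (1 - u) * weight i sb) ->
  (forall i, node i sa = node i s) -> (forall i, node i sb = node i s) ->
  centre sa = centre s -> centre sb = centre s ->
  dual_fun f1 f2 t s = u * dual_fun f1 f2 t sa + (1 - u) * dual_fun f1 f2 t sb.
Proof.
move=> wE na nb ca cb; rewrite /dual_fun /mean_cost ca cb.
have e (F : V -> R) : \sum_i weight i s * F (node i s) =
    u * (\sum_i weight i sa * F (node i sa)) + (1 - u) * (\sum_i weight i sb * F (node i sb)).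
  rewrite !mulr_sumr -big_split/=; apply: eq_bigr => i _; rewrite wE na nb; ring.
by rewrite (e f2) (e (fun y => c (centre s, y))); ring.
Qed.

(* [dual_fun] is affine in the weights as long as the nodes and the centre are
   fixed, while [sq_weight] is strictly convex. *)
Lemma touching_extreme s : S s ->
  (forall e, 0 < e -> exists f1 f2 t,
    (forall s', S s' -> sq_weight s' <= dual_fun f1 f2 t s') /\
    dual_fun f1 f2 t s <= sq_weight s + e) ->
  forall (la lb : 'I_n.+1 -> R) (u : R), 0 < u < 1 ->
    (forall i, 0 <= la i) -> (forall i, 0 <= lb i) ->
    \sum_i la i = 1 -> \sum_i lb i = 1 ->
    \sum_i la i *: node i s = centre s -> \sum_i lb i *: node i s = centre s ->
    (forall i, weight i s = u * la i + (1 - u) * lb i) -> forall i, la i = lb i.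
Proof.
move=> [_ _ Kx] touch la lb u u01 la0 lb0 la1 lb1 ca cb lE.
apply: (sum_sq_strictly_convex u01 lE).
pose sa : configuration R n := (\row_i la i, s.2).
pose sb : configuration R n := (\row_i lb i, s.2).
have wa i : weight i sa = la i by rewrite /weight mxE.
have wb i : weight i sb = lb i by rewrite /weight mxE.
have Ssa : S sa.
  by split; [move=> i; rewrite wa|rewrite (eq_bigr la)|exact: Kx].
have Ssb : S sb.
  by split; [move=> i; rewrite wb|rewrite (eq_bigr lb)|exact: Kx].
have csa : centre sa = centre s by rewrite -ca; apply: eq_bigr => i _; rewrite wa.
have csb : centre sb = centre s by rewrite -cb; apply: eq_bigr => i _; rewrite wb.
have -> : \sum_i la i ^+ 2 = sq_weight sa by apply: eq_bigr => i _; rewrite wa.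
have -> : \sum_i lb i ^+ 2 = sq_weight sb by apply: eq_bigr => i _; rewrite wb.
apply/ler_addgt0Pr => e e0; have [f1 [f2 [t [above near]]]] := touch e e0.
apply: le_trans near; have [u0 u1] := andP u01.
rewrite (@dual_fun_affine f1 f2 t s sa sb u)//; last by move=> i; rewrite wa wb lE.
apply: lerD; apply: ler_wpM2l; [exact: ltW|exact: above|by rewrite subr_ge0 ltW|exact: above].
Qed.

Variables mu nu : PrK.
Variable v : R.
Context d0 (T0 : measurableType d0) (P0 : probability T0 R) (X Y : T0 -> V).
Hypotheses (bX : borel_fun X) (bY : borel_fun Y).
Hypotheses (KX : forall t, body K (X t)) (KY : forall t, body K (Y t)).
Hypotheses (XY : martingale P0 X Y) (lX : has_law P0 X mu) (lY : has_law P0 Y nu).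
Hypothesis cost_le : mean P0 (fun t => c (X t, Y t)) <= v.

Definition relaxed_value (f1 f2 : V -> R) t := mean mu (fun x => f1 (coords x)) -
  mean nu (fun x => f2 (coords x)) + t * v.

(** Nonnegativity on configurations says exactly that the negatives of [f1] and [f2] are admissible
    for the cost [t * c]. The given martingale then bounds their value; scaling the cost instead of
    dividing by [t] includes [t = 0]. *)
Lemma dual_fun_ge0 (f1 f2 : V -> R) t : {within K, continuous f1} ->
  {within K, continuous f2} -> 0 <= t ->
  (forall s, S s -> 0 <= dual_fun f1 f2 t s) -> 0 <= relaxed_value f1 f2 t.
Proof.
move=> cf1 cf2 t0 G0.
have ctc : {within body K `*` body K, continuous (fun z => t * c z)}.
  by apply: withinM => //; exact: within_cst.
have adm : admissible (fun z => t * c z) (ContOn (withinN cf1), ContOn (withinN cf2)).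
  move=> l x l0 l1 Kx /=.
  pose s : configuration R n := (\row_i l i, \row_i x i).
  have ws i : weight i s = l i by rewrite /weight mxE.
  have ns i : node i s = x i by rewrite /node mxE.
  have cs : centre s = \sum_i l i *: x i by apply: eq_bigr => i _; rewrite ws ns.
  have /G0 : S s.
    by split; [move=> i; rewrite ws|rewrite (eq_bigr l)|move=> i; rewrite ns].
  rewrite /dual_fun /mean_cost cs mulr_sumr.
  rewrite (eq_bigr (fun i => l i * f2 (x i))); last by move=> i _; rewrite ws ns.
  rewrite [X in _ + X](eq_bigr (fun i => l i * (t * c (\sum_j l j *: x j, x i)))); last first.
    by move=> i _; rewrite ws ns; ring.
  rewrite [X in _ -> _ - X <= _](eq_bigr (fun i => - (l i * f2 (x i)))); last first.
    by move=> i _; rewrite mulrN.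
  by rewrite sumrN; lra.
have := coupling_inequality bX bY KX KY XY lX lY ctc adm.
rewrite /= !meanN; [|exact: bm_contOn|exact: bm_contOn].
rewrite meanZ; last exact: (bm_joint (@body_compact _ _ K) cc bX bY KX KY).
have := ler_wpM2l t0 cost_le; rewrite /relaxed_value; lra.
Qed.

End second_problem.

(** * The law of maximal mean square weight *)

Section touching_law.
Variables (R : realType) (n : nat) (K : convexBody R n).
Local Notation V := 'rV[R]_n.
Local Notation PrK := (probability (borel (point_of K)) R).
Local Notation bm := bounded_measurable.
Local Notation S := (configurations K).
Variables (c : V * V -> R).
Hypothesis cc : {within body K `*` body K, continuous c}.
Variables mu nu : PrK.
Variable v : R.
Context d0 (T0 : measurableType d0) (P0 : probability T0 R) (X Y : T0 -> V).
Hypotheses (bX : borel_fun X) (bY : borel_fun Y).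
Hypotheses (KX : forall t, body K (X t)) (KY : forall t, body K (Y t)).
Hypotheses (XY : martingale P0 X Y) (lX : has_law P0 X mu) (lY : has_law P0 Y nu).
Hypothesis cost_le : mean P0 (fun t => c (X t, Y t)) <= v.

Local Notation E := (relaxed_value mu nu v).
Local Notation G := (dual_fun c).

Let feasible (f1 f2 : V -> R) (t : R) := [/\ {within K, continuous f1}, {within K, continuous f2},
  0 <= t & forall s, S s -> sq_weight s <= G f1 f2 t s].

Let values := [set e | exists f1 f2 t, feasible f1 f2 t /\ e = E f1 f2 t].

Let G_ge0 (f1 f2 : V -> R) (t : R) :
  {within K, continuous f1} -> {within K, continuous f2} -> 0 <= t ->
  (forall s, S s -> 0 <= G f1 f2 t s) -> 0 <= E f1 f2 t.
Proof. exact: (dual_fun_ge0 cc bX bY KX KY XY lX lY cost_le). Qed.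

Let G_cst (r : R) s : G (fun=> r) (fun=> 0) 0 s = r.
Proof. by rewrite /dual_fun big1 ?mul0r ?addr0 ?subr0// => i _; rewrite mulr0. Qed.

Let E_cst r : E (fun=> r) (fun=> 0) 0 = r.
Proof. by rewrite /relaxed_value !mean_cst mul0r addr0 subr0. Qed.

Let GD (f1 f2 : V -> R) (t : R) (f1' f2' : V -> R) (t' : R) s :
  G (fun x => f1 x + f1' x) (fun x => f2 x + f2' x) (t + t') s = G f1 f2 t s + G f1' f2' t' s.
Proof.
rewrite /dual_fun (eq_bigr (fun i => weight i s * f2 (node i s) + weight i s * f2' (node i s))).
  by rewrite big_split/=; ring.
by move=> i _; rewrite mulrDr.
Qed.

Let GZ (a : R) (f1 f2 : V -> R) (t : R) s :
  G (fun x => a * f1 x) (fun x => a * f2 x) (a * t) s = a * G f1 f2 t s.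
Proof.
rewrite /dual_fun (eq_bigr (fun i => a * (weight i s * f2 (node i s)))).
  by rewrite -mulr_sumr; ring.
by move=> i _; rewrite mulrCA.
Qed.

Let ED (f1 f2 : V -> R) (t : R) (f1' f2' : V -> R) (t' : R) :
  {within K, continuous f1} -> {within K, continuous f2} ->
  {within K, continuous f1'} -> {within K, continuous f2'} ->
  E (fun x => f1 x + f1' x) (fun x => f2 x + f2' x) (t + t') = E f1 f2 t + E f1' f2' t'.
Proof.
move=> *; rewrite /relaxed_value !meanD; [ring|exact: bm_contOn..].
Qed.

Let EZ (a : R) (f1 f2 : V -> R) (t : R) : {within K, continuous f1} -> {within K, continuous f2} ->
  E (fun x => a * f1 x) (fun x => a * f2 x) (a * t) = a * E f1 f2 t.
Proof. by move=> *; rewrite /relaxed_value !meanZ; [ring|exact: bm_contOn..]. Qed.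

Let has_inf_values : has_inf values.
Proof.
split.
  exists (E (fun=> 1) (fun=> 0) 0), (fun=> 1), (fun=> 0), 0; split => //.
  split => //; [exact: within_cst|exact: within_cst|].
  by move=> s Ss; rewrite G_cst; exact: (sq_weight_le1 Ss).
exists 0 => _ [f1 [f2 [t [[cf1 cf2 t0 Gs] ->]]]]; apply: G_ge0 => // s Ss.
by apply: le_trans (Gs s Ss); apply: sumr_ge0 => i _; exact: sqr_ge0.
Qed.

(** The dual value of maximising the mean of [sq_weight] among laws that respect all bounds [E]. No
    such law exceeds it, since [sq_weight] lies below every feasible dual function. *)
Let p0 := inf values.

Let p0_le (f1 f2 : V -> R) (t : R) : feasible f1 f2 t -> p0 <= E f1 f2 t.
Proof. by move=> f; apply: ge_inf; [exact: has_inf_values.2|exists f1, f2, t]. Qed.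

(** The demand that the mean of [sq_weight] be at least [p0] joins the cone as one more generator,
    with multiplier [r]. For [r > 0] its consistency is the definition of [p0] as an infimum, after
    division by [r]. *)
Lemma exists_optimal_law : exists d (T : measurableType d)
    (q : T -> configuration R n) (P : probability T R),
  [/\ borel_fun q, forall t, S (q t),
    forall (f1 f2 : V -> R) (t : R), {within K, continuous f1} -> {within K, continuous f2} -> 0 <= t ->
      mean P (fun s => G f1 f2 t (q s)) <= E f1 f2 t &
    p0 <= mean P (fun s => sq_weight (q s))].
Proof.
pose W := [set w : (configuration R n -> R) * R | exists (f1 f2 : V -> R) (t r : R),
  [/\ {within K, continuous f1} /\ {within K, continuous f2}, 0 <= t, 0 <= r &
    w = (fun s => G f1 f2 t s - r * sq_weight s, E f1 f2 t - r * p0)]].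
have W_cont w : W w -> {within S, continuous w.1}.
  move=> [f1 [f2 [t [r [[cf1 cf2] t0 r0 ->]]]]] /=.
  apply: withinB; first exact: within_dual_fun.
  by apply: withinM; [exact: within_cst|exact: within_sq_weight].
have WD u w : W u -> W w -> W (fun x => u.1 x + w.1 x, u.2 + w.2).
  move=> [f1 [f2 [t [r [[cf1 cf2] t0 r0 ->]]]]] [f1' [f2' [t' [r' [[cf1' cf2'] t0' r0' ->]]]]].
  exists (fun x => f1 x + f1' x), (fun x => f2 x + f2' x), (t + t'), (r + r').
  split; [by split; exact: withinD|exact: addr_ge0|exact: addr_ge0|].
  by congr pair; [apply/funext => s; rewrite GD /=; ring|rewrite ED//=; ring].
have WZ a w : 0 <= a -> W w -> W (fun x => a * w.1 x, a * w.2).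
  move=> a0 [f1 [f2 [t [r [[cf1 cf2] t0 r0 ->]]]]].
  exists (fun x => a * f1 x), (fun x => a * f2 x), (a * t), (a * r).
  split; [|exact: mulr_ge0|exact: mulr_ge0|].
    by split; apply: withinM => //; exact: within_cst.
  by congr pair; [apply/funext => s; rewrite GZ /=; ring|rewrite EZ//=; ring].
have W_cst r : W (fun=> r, r).
  exists (fun=> r), (fun=> 0), 0, 0; split => //; first by split; exact: within_cst.
  by congr pair; [apply/funext => s; rewrite G_cst mul0r subr0|rewrite E_cst mul0r subr0].
have W_ge0 w : W w -> (forall s, S s -> 0 <= w.1 s) -> 0 <= w.2.
  move=> [f1 [f2 [t [r [[cf1 cf2] t0 r0 ->]]]]] /= G0.
  have [r00|rn0] := eqVneq r 0.
    rewrite r00 mul0r subr0; apply: G_ge0 => // s Ss.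
    by have := G0 s Ss; rewrite r00 mul0r subr0.
  have rp : 0 < r by rewrite lt_neqAle eq_sym rn0.
  rewrite subr_ge0 -ler_pdivlMl// -EZ//; apply: p0_le; split => //.
  - by apply: withinM => //; exact: within_cst.
  - by apply: withinM => //; exact: within_cst.
  - by rewrite mulr_ge0// invr_ge0.
  - by move=> s Ss; rewrite GZ ler_pdivlMl// -subr_ge0; exact: G0.
have [d [T [q [P [bq Sq Pq]]]]] := cone_measure (@configurations_compact _ _ K)
  (@configuration_hausdorff R n) (@configurations_nonempty _ _ K) W_cont WD WZ W_cst W_ge0.
exists d, T, q, P; split => //.
  move=> f1 f2 t cf1 cf2 t0.
  have := Pq (fun s => G f1 f2 t s - 0 * sq_weight s, E f1 f2 t - 0 * p0).
  rewrite /= mul0r subr0.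
  rewrite (_ : _ \o q = fun s => G f1 f2 t (q s)); last first.
    by apply/funext => s /=; rewrite mul0r subr0.
  by apply; exists f1, f2, t, 0; split => //; rewrite mul0r subr0.
have := Pq (fun s => G (fun=> 0) (fun=> 0) 0 s - 1 * sq_weight s, E (fun=> 0) (fun=> 0) 0 - 1 * p0).
have bsq : bm (fun s => sq_weight (q s)).
  exact: (borel_fun_bm (@configurations_compact _ _ K) bq Sq (@within_sq_weight _ _ K)).
rewrite /= E_cst sub0r mul1r.
rewrite (_ : _ \o q = fun s => - sq_weight (q s)); last first.
  by apply/funext => s /=; rewrite G_cst mul1r sub0r.
rewrite meanN// lerN2; apply.
exists (fun=> 0), (fun=> 0), 0, 1; split => //; first by split; exact: within_cst.
by rewrite E_cst sub0r mul1r.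
Qed.

(** Majorants [f k] that are optimal up to [k.+1%:R^-1] exceed [sq_weight] by [D k], whose mean
    tends to 0; hence the infimum of the [D k] vanishes almost surely. The dual infimum may not be
    attained, which is why contact holds only up to every [e]. *)
Theorem exists_touching_law : exists d (T : measurableType d)
    (q : T -> configuration R n) (P : probability T R) (N : set T),
  [/\ borel_fun q /\ forall t, S (q t),
    forall (f1 f2 : V -> R) (t : R), {within K, continuous f1} -> {within K, continuous f2} ->
      0 <= t -> mean P (fun s => G f1 f2 t (q s)) <= E f1 f2 t,
    measurable N, mean P \1_N = 0 &
    forall t, ~ N t -> forall e, 0 < e -> exists f1 f2 r,
      (forall s, S s -> sq_weight s <= G f1 f2 r s) /\ G f1 f2 r (q t) <= sq_weight (q t) + e].
Proof.
have [d [T [q [P [bq Sq PG Psq]]]]] := exists_optimal_law.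
have /choice[f fP] : forall k : nat, exists f : ((V -> R) * (V -> R)) * R,
    feasible f.1.1 f.1.2 f.2 /\ E f.1.1 f.1.2 f.2 <= p0 + k.+1%:R^-1.
  move=> k; have k0 : (0 : R) < k.+1%:R^-1 by rewrite invr_gt0.
  have [_ [f1 [f2 [t [ft ->]]]] le] := inf_adherent k0 has_inf_values.
  by exists (f1, f2, t); split => //; exact: ltW.
pose D k t := G (f k).1.1 (f k).1.2 (f k).2 (q t) - sq_weight (q t).
have bsq : bm (fun s => sq_weight (q s)).
  exact: (borel_fun_bm (@configurations_compact _ _ K) bq Sq (@within_sq_weight _ _ K)).
have bG k : bm (fun t => G (f k).1.1 (f k).1.2 (f k).2 (q t)).
  have [[cf1 cf2 _ _] _] := fP k.
  have cG := @within_dual_fun _ _ _ c cc (f k).1.1 (f k).1.2 (f k).2 cf1 cf2.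
  exact: (borel_fun_bm (@configurations_compact _ _ K) bq Sq cG).
have bD k : bm (D k) by exact: bmB.
have D0 k t : 0 <= D k t.
  by have [[_ _ _ Gs] _] := fP k; rewrite subr_ge0; exact: Gs.
have meanD_le k : mean P (D k) <= k.+1%:R^-1.
  have [[cf1 cf2 t0 _] Ek] := fP k.
  have h1 := PG _ _ _ cf1 cf2 t0; rewrite /D meanB// lerBlDr.
  by apply: (le_trans h1); apply: (le_trans Ek); rewrite addrC lerD2l.
(* Here all the excesses stay above [m.+1%:R^-1]; Markov's inequality shows that this set is
   null. *)
pose N m := \bigcap_k (D k @^-1` `]m.+1%:R^-1, +oo[%classic).
have mN m : measurable (N m).
  apply: bigcapT_measurable => k; rewrite -[_ @^-1` _]setTI.
  by case: (bD k) => mD _; apply: mD => //; exact: measurable_itv.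
have N0 m : P (N m) = 0%E.
  rewrite (measure_mean P (mN m)); congr EFin; apply/eqP; rewrite eq_le.
  apply/andP; split; last by apply: mean_ge0 => t; rewrite indicE.
  apply/ler_addgt0Pr => e e0; rewrite add0r.
  have m0 : (0 : R) < m.+1%:R^-1 by rewrite invr_gt0.
  have [k] := ltr_add_invr (mulr_gt0 m0 e0); rewrite add0r => ke.
  rewrite -(ler_pM2l m0) -meanZ; last exact: bm_indic.
  apply: le_trans (ltW ke); apply: le_trans (meanD_le k).
  apply: le_mean => //; first by apply: bmM; [exact: bm_cst|exact: bm_indic].
  move=> t; rewrite indicE; case: (boolP (t \in N m)) => [/set_mem Nt|_]; last by rewrite mulr0.
  by rewrite mulr1; have := Nt k I; rewrite /= in_itv /= andbT => /ltW.
have mU : measurable (\bigcup_m N m) by exact: bigcupT_measurable.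
exists d, T, q, P, (\bigcup_m N m); split => //.
  rewrite mean_indic//; have -> : P (\bigcup_m N m) = 0%E; last by [].
  apply/(negligibleP P mU)/negligible_bigcup => m.
  exact: (negligibleP P (mN m)).2 (N0 m).
move=> t Nt e e0; have [m] := ltr_add_invr e0; rewrite add0r => me.
have [k Dk] : exists k, D k t <= m.+1%:R^-1.
  apply: contrapT => nk; apply: Nt; exists m => // k _; rewrite /= in_itv /= andbT ltNge.
  by apply/negP => Dk; apply: nk; exists k.
exists (f k).1.1, (f k).1.2, (f k).2; split; first by have [[]] := fP k.
by rewrite -lerBlDl (le_trans Dk)// ltW.
Qed.

End touching_law.

Lemma mean_eq_off d (T : measurableType d) (R : realType) (P : probability T R)
    (N : set T) (g h : T -> R) : measurable N -> mean P \1_N = 0 ->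
  bounded_measurable g -> bounded_measurable h ->
  (forall t, ~ N t -> g t = h t) -> mean P g = mean P h.
Proof.
move=> mN N0 bg bh gh; apply/eqP; rewrite -subr_eq0 -meanB//; apply/eqP.
have bgh := bmB bg bh; have [_ [M ghM]] := bgh.
apply: (mean_dominated_eq0 (M := M) (bm_indic R mN) bgh).
  by rewrite -[RHS]N0; congr mean; apply/funext => t; rewrite ger0_norm// indicE.
move=> t; rewrite indicE; case: (boolP (t \in N)) => [_|/negP Nt].
  by rewrite normr1 mulr1.
by rewrite gh ?subrr ?normr0 ?mulr0// => tN; apply: Nt; exact: mem_set.
Qed.

Section representation.
Variables (R : realType) (n : nat) (K : convexBody R n).
Local Notation V := 'rV[R]_n.
Local Notation PrK := (probability (borel (point_of K)) R).
Local Notation bm := bounded_measurable.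
Local Notation S := (configurations K).

Lemma exists_node_law : exists nodes : configuration R n -> PrK, forall s, S s ->
  forall h, bm h -> mean (nodes s) h = \sum_i weight i s * h (to_point K (node i s)).
Proof.
suff /choice[nodes H] : forall s, exists m : PrK, S s ->
    forall h, bm h -> mean m h = \sum_i weight i s * h (to_point K (node i s)).
  by exists nodes.
move=> s; have [[l0 l1 Kx]|nS] := pselect (S s); last by exists (\d_point : PrK).
have [m mE] := @finite_probability _ (borel (point_of K)) R _ (fun i => weight i s)
  (fun i => to_point K (node i s)) l0 l1.
by exists m.
Qed.

Variables (c : V * V -> R) (L : R).
Hypothesis cL : forall z w, (body K `*` body K) z -> (body K `*` body K) w ->
  c z <= c w + L * `|z - w|.
Variables mu nu : PrK.
Variable v : R.
Context d0 (T0 : measurableType d0) (P0 : probability T0 R) (X Y : T0 -> V).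
Hypotheses (bX : borel_fun X) (bY : borel_fun Y).
Hypotheses (KX : forall t, body K (X t)) (KY : forall t, body K (Y t)).
Hypotheses (XY : martingale P0 X Y) (lX : has_law P0 X mu) (lY : has_law P0 Y nu).
Hypothesis cost_le : mean P0 (fun t => c (X t, Y t)) <= v.

Theorem exists_representing : exists2 pi, representing mu nu pi &
  mean pi (product_cost c) <= v.
Proof.
have cc := cost_cont cL; have cS := @configurations_compact _ _ K.
have [d [T [q [P [N [[bq Sq] PG mN N0 touch]]]]]] :=
  exists_touching_law cc bX bY KX KY XY lX lY cost_le.
have [nodes nodesE] := exists_node_law.
pose dirac_at (z : V) : PrK := \d_(to_point K z : borel (point_of K)).
have diracE z (g : V -> R) : body K z -> {within K, continuous g} ->
    mean (dirac_at z) (fun x => g (coords x)) = g z.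
  by move=> Kz cg; rewrite mean_dirac ?to_pointK//; exact: bm_contOn.
have nodes_contOn s (g : V -> R) : S s -> {within K, continuous g} ->
    mean (nodes s) (fun x => g (coords x)) = \sum_i weight i s * g (node i s).
  move=> Ss cg; rewrite (nodesE s Ss _ (bm_contOn cg)); apply: eq_bigr => i _.
  by rewrite to_pointK//; case: Ss.
pose F s : weakProb K * weakProb K := (dirac_at (centre s), nodes s).
(* The laws [nodes s] come from the axiom of choice, but the weak topology sees only means of
   continuous functions, and these are determined on [S]. *)
have cF : {within S, continuous F}.
  have c1 : continuous ((fun s => dirac_at (centre s)) : subspace S -> weakProb K).
    apply: weak_continuous => g cg.
    apply: (subspace_eq_continuous _ (within_centre cg)) => s /set_mem Ss.
    by rewrite diracE//; exact: centre_mem.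
  have c2 : continuous (nodes : subspace S -> weakProb K).
    apply: weak_continuous => g cg.
    apply: (subspace_eq_continuous _ (within_mean_node cg)) => s /set_mem Ss.
    by rewrite nodes_contOn.
  by move=> s; exact: (cvg_pair (c1 s) (c2 s)).
have ext t : ~ N t -> extreme_pairs (F (q t)).
  move=> Nt; have [l0 l1 Kx] := Sq t.
  apply: finite_extreme => //; first exact: (nodesE _ (Sq t)).
  exact: (touching_extreme (Sq t) (touch t Nt)).
(* On the null set [N] the pair may fail to be extreme and is replaced by a default one. *)
pose Psi t : extremePair K := if pselect (N t) is right Nt then
  exist _ (F (q t)) (mem_set (ext t Nt)) else point.
have bPsi : borel_fun Psi.
  (* An open set of extreme pairs is the trace of an open set [U0] of pairs, so off [N] its preimage
     is that of [U0] under the continuous [F]. *)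
  move=> U [U0 oU0 UU0]; rewrite (_ : _ @^-1` _ =
      ((F \o q) @^-1` U0 `\` N) `|` (N `&` [set _ | U point])).
    apply: measurableU.
      by apply: measurableD => //; exact: (borel_fun_comp bq Sq cF oU0).
    apply: measurableI => //; have [Up|Up] := pselect (U point).
      by rewrite (_ : [set _ | _] = setT)//; apply/seteqP; split.
    by rewrite (_ : [set _ | _] = set0)//; apply/seteqP; split.
  apply/seteqP; split => t /=; rewrite /Psi; case: pselect => Nt.
  - by move=> Up; right.
  - by move=> Ut; left; split => //; move: Ut; rewrite -UU0.
  - by move=> [[]|[]].
  - by move=> [[Ut _]|[]//]; rewrite -UU0.
have mPsi : measurable_fun setT (Psi : T -> borel (extremePair K)).
  by move=> _ A mA; rewrite setTI; exact: borel_fun_sigma bPsi mA.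
have PsiE t : ~ N t -> set_val (Psi t) = F (q t) by rewrite /Psi; case: pselect.
have [pi [_ piE]] := image_probability P mPsi.
have bPsi_comp (h : borel (extremePair K) -> R) : bm h -> bm (fun t => h (Psi t)).
  by move=> [mh [M hM]]; split; [exact: (measurableT_comp mh mPsi)|exists M].
have fstE t (g : V -> R) : ~ N t -> {within K, continuous g} ->
    mean (extreme_fst (Psi t)) (fun x => g (coords x)) = g (centre (q t)).
  by move=> Nt cg; rewrite /extreme_fst PsiE//= diracE//; exact: centre_mem.
have sndE t (g : V -> R) : ~ N t -> {within K, continuous g} ->
    mean (extreme_snd (Psi t)) (fun x => g (coords x)) =
    \sum_i weight i (q t) * g (node i (q t)).
  by move=> Nt cg; rewrite /extreme_snd PsiE//= nodes_contOn.
have bcentre (g : V -> R) : {within K, continuous g} -> bm (fun t => g (centre (q t))).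
  by move=> cg; exact: (borel_fun_bm cS bq Sq (within_centre cg)).
have bnodes (g : V -> R) : {within K, continuous g} ->
    bm (fun t => \sum_i weight i (q t) * g (node i (q t))).
  by move=> cg; exact: (borel_fun_bm cS bq Sq (within_mean_node cg)).
have c0 := @within_cst R V K 0.
have muE (g : V -> R) : {within K, continuous g} ->
    mean P (fun t => g (centre (q t))) = mean mu (fun x => g (coords x)).
  move=> cg; have half (h : V -> R) : {within K, continuous h} ->
      mean P (fun t => h (centre (q t))) <= mean mu (fun x => h (coords x)).
    move=> ch; have := PG h (fun=> 0) 0 ch c0 (lexx _).
    rewrite /relaxed_value mean_cst mul0r subr0 addr0; congr (mean P _ <= _).
    apply/funext => t; rewrite /dual_fun big1 ?subr0 ?mul0r ?addr0// => i _.
    by rewrite mulr0.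
  apply/eqP; rewrite eq_le half//= -lerN2 -!meanN; [|exact: bm_contOn|exact: bcentre].
  exact: half (withinN cg).
have nuE (g : V -> R) : {within K, continuous g} ->
    mean P (fun t => \sum_i weight i (q t) * g (node i (q t))) = mean nu (fun x => g (coords x)).
  move=> cg; have half (h : V -> R) : {within K, continuous h} ->
      mean nu (fun x => h (coords x)) <= mean P (fun t => \sum_i weight i (q t) * h (node i (q t))).
    move=> ch; have := PG (fun=> 0) h 0 c0 ch (lexx _).
    rewrite /relaxed_value mean_cst mul0r sub0r addr0.
    rewrite (_ : (fun s => _) = fun t => - \sum_i weight i (q t) * h (node i (q t))).
      by rewrite meanN ?lerN2//; exact: bnodes.
    by apply/funext => t; rewrite /dual_fun sub0r mul0r addr0.
  apply/eqP; rewrite eq_le half// andbT -lerN2 -!meanN; [|exact: bnodes|exact: bm_contOn].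
  have := half _ (withinN cg); congr (_ <= mean P _); apply/funext => t.
  by rewrite -sumrN; apply: eq_bigr => i _; rewrite mulrN.
exists pi.
  apply/representingP => g cg; rewrite -muE// -nuE// !piE; [|exact: bm_extreme_snd|exact: bm_extreme_fst].
  split; apply: (mean_eq_off mN N0).
  - exact: bcentre.
  - exact: (bPsi_comp _ (bm_extreme_fst cg)).
  - by move=> t Nt; rewrite /= fstE.
  - exact: bnodes.
  - exact: (bPsi_comp _ (bm_extreme_snd cg)).
  - by move=> t Nt; rewrite /= sndE.
rewrite piE; last exact: (bm_extreme_cost cL).
rewrite (@mean_eq_off _ _ _ _ _ _ (fun t => mean_cost c (q t)) mN N0).
- have := PG (fun=> 0) (fun=> 0) 1 c0 c0 ler01.
  rewrite /relaxed_value !mean_cst subr0 add0r mul1r; congr (mean P _ <= _).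
  apply/funext => t; rewrite /dual_fun big1 ?subr0 ?mul1r ?add0r// => i _.
  by rewrite mulr0.
- exact: (bPsi_comp _ (bm_extreme_cost cL)).
- exact: (borel_fun_bm cS bq Sq (within_cost cc)).
- move=> t Nt /=; have Kb := centre_mem (Sq t).
  rewrite (extreme_product_cost cL Kb); last by move=> g cg; rewrite fstE.
  by rewrite (@sndE t (fun y => c (centre (q t), y)) Nt (cost_cont2 cL Kb)).
Qed.

End representation.

Lemma integral_indic_mean d (T : measurableType d) (R : realType) (P : probability T R)
    (A : set T) (h : T -> R) : measurable A -> bounded_measurable h ->
  (\int[P]_(x in A) (h x)%:E = (mean P (fun x => \1_A x * h x))%:E)%E.
Proof.
move=> mA bh; rewrite integral_mkcond -meanE; last by apply: bmM => //; exact: bm_indic.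
apply: eq_integral => x _; rewrite patchE indicE.
by case: (x \in A); rewrite ?mul1r ?mul0r.
Qed.

(** * Duality *)

Section couplings.
Variables (R : realType) (n : nat) (K : convexBody R n).
Local Notation V := 'rV[R]_n.
Local Notation PrK := (probability (borel (point_of K)) R).
Local Notation bm := bounded_measurable.
Local Notation B := (borel (point_of K)).
Variables mu nu : PrK.

Let X (p : B * B) : V := coords p.1.
Let Y (p : B * B) : V := coords p.2.

Let bX : borel_fun X.
Proof.
move=> U oU; rewrite -[_ @^-1` _]setTI.
exact: (@measurable_fst _ _ B B measurableT _ (@borel_coords _ _ K _ oU)).
Qed.

Let bY : borel_fun Y.
Proof.
move=> U oU; rewrite -[_ @^-1` _]setTI.
exact: (@measurable_snd _ _ B B measurableT _ (@borel_coords _ _ K _ oU)).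
Qed.

Let bXi i : bm (fun p : B * B => coords p.1 ord0 i).
Proof. exact: (@bm_fst _ B _ B _ _ (bm_contOn (@within_coord _ _ K i))). Qed.

Let bYi i : bm (fun p : B * B => coords p.2 ord0 i).
Proof. exact: (@bm_snd _ B _ B _ _ (bm_contOn (@within_coord _ _ K i))). Qed.

Lemma indic_preimage (U W : Type) (f : U -> W) (A : set W) x :
  \1_(f @^-1` A) x = \1_A (f x) :> R.
Proof.
by rewrite !indicE; congr ((nat_of_bool _)%:R); apply/idP/idP => /set_mem h; apply/mem_set.
Qed.

(** The sigma-algebra of the first coordinate consists of preimages of Borel sets of points, which
    are themselves traces of Borel subsets of the ambient space. *)
Lemma martingale_couplingsP (pi : pairProb K) : martingale_couplings mu nu pi <->
  [/\ has_law pi X mu, has_law pi Y nu & martingale pi X Y].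
Proof.
have mcoords A : <<s @open V >> A -> measurable (@coords R n K @^-1` A : set B).
  by move=> mA; exact: borel_fun_sigma (@borel_coords _ _ K) mA.
have mfst (A : set B) : measurable A -> measurable ((fst : B * B -> B) @^-1` A).
  by move=> mA; rewrite -[_ @^-1` _]setTI; exact: measurable_fst.
have msnd (A : set B) : measurable A -> measurable ((snd : B * B -> B) @^-1` A).
  by move=> mA; rewrite -[_ @^-1` _]setTI; exact: measurable_snd.
have law (f : B * B -> B) (m : PrK) :
    (forall A : set B, measurable A -> measurable (f @^-1` A)) ->
    (forall A : set B, measurable A -> pushforward pi f A = m A) <->
    has_law pi (fun p => coords (f p)) m.
  move=> mf; split => [H A mA|H A /borel_point_preimage[A' mA' ->]].
    have mcA := mcoords _ mA; have := H _ mcA; rewrite /pushforward.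
    rewrite (measure_mean m mcA) (measure_mean pi (mf _ mcA)) => -[].
    by congr (mean _ _ = mean _ _); apply/funext => p; rewrite !indic_preimage.
  have mcA := mcoords _ mA'; rewrite /pushforward.
  rewrite (measure_mean m mcA) (measure_mean pi (mf _ mcA)); congr EFin.
  have := H _ mA'; congr (mean _ _ = mean _ _); apply/funext => p; by rewrite !indic_preimage.
have mart : one_step_martingale pi <-> martingale pi X Y.
  split => [H i A mA|H i].
    have [_ _ _ HA] := H i; have mA' := mcoords _ mA.
    have : preimage_set_system setT (fst : B * B -> B) measurable
        (fst @^-1` (@coords R n K @^-1` A)).
      by exists (@coords R n K @^-1` A) => //; rewrite setTI.
    move=> /HA; rewrite !integral_indic_mean; [|exact: mfst|exact: bYi|exact: mfst|exact: bXi].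
    case.
    by congr (mean _ _ = mean _ _); apply/funext => p; rewrite !indic_preimage.
  split.
  - exact: bm_integrable.
  - exact: bm_integrable.
  - move=> A mA; have [mi _] := bm_contOn (@within_coord _ _ K i).
    exists ((fun x : B => coords x ord0 i) @^-1` A); last by rewrite setTI.
    by rewrite -[_ @^-1` _]setTI; exact: mi.
  - move=> _ [A mA <-]; rewrite setTI.
    rewrite !integral_indic_mean; [|exact: mfst|exact: bYi|exact: mfst|exact: bXi].
    have [A' mA' AA'] := borel_point_preimage mA; congr EFin.
    etransitivity; [|etransitivity; [exact: H i A' mA'|]];
      by congr mean; apply/funext => p; rewrite AA' !indic_preimage.
split => [[h1 h2 h3]|[h1 h2 h3]]; split.
- exact: (law fst mu mfst).1.
- exact: (law snd nu msnd).1.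
- exact: mart.1.
- exact: (law fst mu mfst).2.
- exact: (law snd nu msnd).2.
- exact: mart.2.
Qed.

Variables (c : V * V -> R) (L : R).
Hypothesis cL : forall z w, (body K `*` body K) z -> (body K `*` body K) w ->
  c z <= c w + L * `|z - w|.

Lemma transport_costE (pi : pairProb K) :
  transport_cost c pi = (mean pi (fun p => c (coords p.1, coords p.2)))%:E.
Proof. by rewrite /transport_cost (meanE _ (bm_product_cost cL)). Qed.

Lemma transport_cost_ge (pi : pairProb K) (f : contOn K * contOn K) :
  martingale_couplings mu nu pi -> admissible c f ->
  mean mu (fun x => f.1 (coords x)) - mean nu (fun x => f.2 (coords x)) <=
  mean pi (fun p => c (coords p.1, coords p.2)).
Proof.
move=> /martingale_couplingsP[lX lY XY] fc.
have KX p : body K (X p) by exact: coordsP.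
have KY p : body K (Y p) by exact: coordsP.
exact: (coupling_inequality bX bY KX KY XY lX lY (cost_cont cL) fc).
Qed.

Lemma coupling_of_martingale d (T : measurableType d) (P : probability T R)
    (X' Y' : T -> V) : borel_fun X' -> borel_fun Y' ->
  (forall t, body K (X' t)) -> (forall t, body K (Y' t)) ->
  martingale P X' Y' -> has_law P X' mu -> has_law P Y' nu ->
  exists2 pi, martingale_couplings mu nu pi &
    mean pi (fun p => c (coords p.1, coords p.2)) = mean P (fun t => c (X' t, Y' t)).
Proof.
move=> bX' bY' KX KY XY lX lY.
have mXY := measurable_fun_pair (measurable_to_point bX' KX) (measurable_to_point bY' KY).
have [pi [_ piE]] := image_probability P mXY.
exists pi; last first.
  rewrite piE; last exact: bm_product_cost cL.
  by congr mean; apply/funext => t /=; rewrite !to_pointK.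
apply/martingale_couplingsP; split.
- move=> A mA; rewrite piE; last exact: bm_indic_borel.
  by rewrite -(lX _ mA); congr mean; apply/funext => t; rewrite /X /= to_pointK.
- move=> A mA; rewrite piE; last exact: bm_indic_borel.
  by rewrite -(lY _ mA); congr mean; apply/funext => t; rewrite /Y /= to_pointK.
- move=> i A mA; rewrite !piE; last 2 first.
  + by apply: bmM; [exact: bm_indic_borel|exact: bYi].
  + by apply: bmM; [exact: bm_indic_borel|exact: bXi].
  etransitivity; [|etransitivity; [exact: XY i A mA|]];
    by congr mean; apply/funext => t; rewrite /X /Y /= !to_pointK.
Qed.

End couplings.

Lemma lipschitz_bound (R : realType) (U W : normedModType R) (A : set U) (f : U -> W) :
  [lipschitz f x | x in A] ->
  exists L, forall z w, A z -> A w -> `|f z - f w| <= L * `|z - w|.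
Proof.
(* The bound is granted for all constants above [M], hence [M + 1]. *)
move=> [M [_ fM]]; exists (M + 1) => z w Az Aw.
by apply: (fM (M + 1) _ (z, w)); rewrite ?ltrDl.
Qed.

Theorem theorem3p2 (R : realType) (n : nat) (K : convexBody R n)
    (c : 'rV[R]_n * 'rV[R]_n -> R)
    (c_lip : [lipschitz c p | p in body K `*` body K])
    (mu nu : probability (borel (point_of K)) R)
    (mu_nu : convex_order mu nu)
    (sup_attained : exists2 f, admissible c f &
       dual_value mu nu f =
         ereal_sup [set dual_value mu nu g | g in admissible c]) :
  [/\ ereal_sup [set dual_value mu nu f | f in admissible c] =
        ereal_inf [set extreme_cost c pi | pi in representing mu nu],
      (exists2 pi, representing mu nu pi &
         extreme_cost c pi =
           ereal_inf [set extreme_cost c pi' | pi' in representing mu nu]) &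
      ereal_sup [set dual_value mu nu f | f in admissible c] =
        ereal_inf [set transport_cost c pi | pi in martingale_couplings mu nu]].
Proof.
have [L cLn] := lipschitz_bound c_lip.
have cL z w : (body K `*` body K) z -> (body K `*` body K) w -> c z <= c w + L * `|z - w|.
  by move=> Kz Kw; rewrite -lerBlDl (le_trans (ler_norm _))// cLn.
have valueE (f : contOn K * contOn K) : dual_value mu nu f =
    (mean mu (fun x => f.1 (coords x)) - mean nu (fun x => f.2 (coords x)))%:E.
  by rewrite /dual_value !integral_contOn.
have [f fc fE] := sup_attained.
(* Attainment makes the supremum a real number, and the maximiser [f] is the competitor in both weak
   duality bounds below. *)
set v := mean mu (fun x => f.1 (coords x)) - mean nu (fun x => f.2 (coords x)).
have supE : ereal_sup [set dual_value mu nu g | g in admissible c] = v%:E by rewrite -fE valueE.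
have le_v (g : contOn K * contOn K) : admissible c g ->
    mean mu (fun x => g.1 (coords x)) - mean nu (fun x => g.2 (coords x)) <= v.
  by move=> gc; rewrite -lee_fin -(valueE g) -supE; apply: ereal_sup_ubound; exists g.
have [d [T [P [X [Y [[[bX bY] [KX KY]] XY lX lY cost_v]]]]]] :
    exists d (T : measurableType d) (P : probability T R) (X Y : T -> 'rV[R]_n),
    [/\ (borel_fun X /\ borel_fun Y) /\
          ((forall t, body K (X t)) /\ (forall t, body K (Y t))),
        martingale P X Y, has_law P X mu, has_law P Y nu &
        mean P (fun t => c (X t, Y t)) <= v].
  (* Discarding the multiplier [H] leaves an admissible pair, so the relaxed dual problem has values
     at most [v]. *)
  apply: (exists_martingale mu_nu (cost_cont cL)) => f1 f2 H cf1 cf2 cH f12.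
  exact: (le_v (ContOn cf1, ContOn cf2) (@affine_admissible _ _ _ c (ContOn cf1) (ContOn cf2) H f12)).
(* The same martingale serves twice: it makes the bounds on configurations consistent, and its joint
   law is an optimal coupling. *)
have [pi0 rpi0 pi0_v] := exists_representing cL bX bY KX KY XY lX lY cost_v.
have [pi1 mpi1 pi1E] := coupling_of_martingale cL bX bY KX KY XY lX lY.
have inf1 : ereal_inf [set extreme_cost c pi | pi in representing mu nu] = v%:E.
  apply/eqP; rewrite eq_le; apply/andP; split.
    apply: (@le_trans _ _ (extreme_cost c pi0)); first by apply: ereal_inf_lbound; exists pi0.
    by rewrite (extreme_costE cL) lee_fin.
  apply: le_ereal_inf_tmp => _ [pi rpi <-]; rewrite (extreme_costE cL) lee_fin.
  exact: (weak_duality cL rpi fc).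
have inf2 : ereal_inf [set transport_cost c pi | pi in martingale_couplings mu nu] = v%:E.
  apply/eqP; rewrite eq_le; apply/andP; split.
    apply: (@le_trans _ _ (transport_cost c pi1)); first by apply: ereal_inf_lbound; exists pi1.
    by rewrite (transport_costE cL) lee_fin pi1E.
  apply: le_ereal_inf_tmp => _ [pi mpi <-]; rewrite (transport_costE cL) lee_fin.
  exact: (transport_cost_ge cL mpi fc).
split; [by rewrite supE inf1| |by rewrite supE inf2].
exists pi0 => //; rewrite inf1 (extreme_costE cL); congr EFin; apply/eqP.
by rewrite eq_le pi0_v; exact: (weak_duality cL rpi0 fc).
Qed.
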